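(* For every integer $k\ge 3$, $$\Big\lfloor\frac{k^2}{4}\Big\rfloor< g(k)\le \frac{k^2-k+2}{2}.$$ That is, the following hold for every integer $k\ge3$. (i) Let $r=\frac{k^2-k+2}{2}$. For every $\varepsilon>0$ there exists $c=c(\varepsilon)>0$ (which may also depend on $k$) such that for every $n$-vertex ordered graph $G$ with no induced monotone $P_{2k}$, if $\varrho_r(\overline{G})>\varepsilon$, then $\overline{G}$ contains a copy of $K_2\big[\tfrac{cn}{\log n}\big]$. (ii) On the other hand, there exist a constant $\eta>0$ and, for all sufficiently large $n$, $n$-vertex ordered graphs $G_n$ with no induced monotone path $P_{2k-1}$ such that $\varrho_{\lfloor k^2/4\rfloor}(\overline{G_n})\ge\eta$ and $\overline{G_n}$ has no biclique of size $n/e^{o(\sqrt{\log n/\log\log n})}$; that is, for every real function $\varphi$ with $\varphi(n)=o\big(\sqrt{\log n/\log\log n}\big)$, for all sufficiently large $n$ the graph $\overline{G_n}$ contains no copy of $K_2\big[n/e^{\varphi(n)}\big]$.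
   Context: All graphs are finite and simple. An ordered graph is a graph with a total ordering $<$ on its vertex set. A monotone path $P_m$ is an ordered graph with vertices $v_1<v_2<\dots<v_m$ in which $v_i,v_j$ are adjacent if and only if $|i-j|=1$; an ordered graph $G$ has no induced monotone $P_m$ if there are no vertices $v_1<\dots<v_m$ of $G$ such that $v_iv_j\in E(G)$ if and only if $|i-j|=1$. $\overline{G}$ is the complement of $G$. $\varrho_r(G)$ is the number of copies of $K_r$ in $G$ divided by $\binom{|V(G)|}{r}$. $K_2[t]=K_{t,t}$ is the complete bipartite graph with parts of size $t$, also called a biclique of size $t$. Containing a copy means as a not necessarily induced subgraph. Floor signs are omitted: for non-integer $t$, read $\lfloor t\rfloor$. $g(k)$ is the minimum $r\in\mathbb{N}$ such that any $n$-vertex ordered graph $G$ with no induced monotone $P_{2k}$ and with $\varrho_r(\overline{G})>0$ has a copy of $K_2[\Omega(\frac{n}{\log n})]$ in $\overline{G}$; precisely, such that for every $\varepsilon>0$ there is $c>0$ such that for every $n\ge 2$ and every $n$-vertex ordered graph $G$ with no induced monotone $P_{2k}$ and $\varrho_r(\overline{G})>\varepsilon$, $\overline{G}$ contains a copy of $K_2[\frac{cn}{\log n}]$. *)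

(* Defs.v *)
From mathcomp Require Import all_boot all_order all_algebra.
From mathcomp Require Import all_classical all_reals all_analysis.
Import Order.TTheory GRing.Theory Num.Theory.
Import numFieldNormedType.Exports.

Set Implicit Arguments.
Unset Strict Implicit.
Unset Printing Implicit Defensive.

Local Open Scope ring_scope.

(* The vertex set is 'I_n with its usual order: every totally ordered set of
   n elements is isomorphic to it. *)
Record ograph (n : nat) := OGraph {
  edge :> rel 'I_n;
  edge_sym : symmetric edge;
  edge_irr : irreflexive edge }.

Section Graphs.
Variable n : nat.
Implicit Type G : ograph n.

Definition compl_edge G : rel 'I_n := fun x y => (x != y) && ~~ G x y.

Lemma compl_edge_sym G : symmetric (compl_edge G).
Proof. by move=> x y; rewrite /compl_edge eq_sym edge_sym. Qed.

Lemma compl_edge_irr G : irreflexive (compl_edge G).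
Proof. by move=> x; rewrite /compl_edge eqxx. Qed.

Definition compl G : ograph n :=
  OGraph (compl_edge_sym G) (compl_edge_irr G).

Definition has_induced_monotone_path (m : nat) G : Prop :=
  exists v : 'I_m -> 'I_n,
    (forall i j : 'I_m, (i < j)%N -> (v i < v j)%N) /\
    (forall i j : 'I_m,
       G (v i) (v j) = ((i.+1 == j :> nat) || (j.+1 == i :> nat))).

Definition is_clique G (A : {set 'I_n}) : bool :=
  [forall x in A, forall y in A, (x != y) ==> G x y].

(* If n < r, the denominator is 0 and so is the quotient. *)
Definition clique_density (R : realType) (r : nat) G : R :=
  #|[set A : {set 'I_n} | (#|A| == r) && is_clique G A]|%:R / 'C(n, r)%:R.

Definition has_biclique (t : nat) G : Prop :=
  exists A B : {set 'I_n},
    [/\ #|A| = t, #|B| = t, [disjoint A & B] &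
        forall x y, x \in A -> y \in B -> G x y].

End Graphs.

(* K_2[t] for a real t >= 0 is read as K_2[floor t]. *)
Definition has_biclique_real (R : realType) (t : R) (n : nat) (G : ograph n) :
  Prop := has_biclique (Num.truncn t) G.

Definition forces_biclique (R : realType) (k r : nat) : Prop :=
  forall eps : R, 0 < eps ->
  exists2 c : R, 0 < c &
  forall (n : nat) (G : ograph n), (2 <= n)%N ->
    ~ has_induced_monotone_path (2 * k) G ->
    eps < clique_density R r (compl G) ->
    has_biclique_real (c * n%:R / ln n%:R) (compl G).

(* "g(k) = r" *)
Definition is_g (R : realType) (k r : nat) : Prop :=
  forces_biclique R k r /\
  forall r' : nat, forces_biclique R k r' -> (r <= r')%N.

(* Main.v *)
(* Upper bound.  Suppose the complement of G has no biclique of size c n / log n.  By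
   averaging one finds many tuples (z_1, ..., z_r), with r = C(k,2) + 1, of pairwise
   nonadjacent vertices whose i-th entries all precede all (i+1)-st entries.  Attach to each
   coordinate i an induced path with 2 l_i - 1 vertices that continues to every z_i and sees
   no later z_j.  An edge between two coordinates lets one path be prolonged by two vertices
   towards the other coordinate, at the cost of a constant fraction of the tuples.  When this
   is impossible, some label l is carried by k - l + 1 coordinates, and the neighbourhoods of
   their entries are pairwise sparse; a path zigzagging between these neighbourhoods prolongs
   one of the attached paths to 2k vertices.  If instead the neighbourhoods within some linear
   set are all small, Gyarfas' path argument applies; only there is the factor log n lost.

   Lower bound.  Arrange floor(k^2/4) parts in a grid of floor(k/2) rows, make each part
   complete, and label the vertices by tuples of points of a d-dimensional grid, one point per
   block, a block being two pairs of distinct parts from two rows.  Two parts in a row are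
   joined when the labels are close.  For two rows vertices are joined unless, in each block,
   the inner products of the points of the two parts have a prescribed sign and absolute
   value at least tau ~ sqrt d.  Two edges inside different rows with no edges between them
   would give vectors x1 - x2 and x3 - x4 that are short but have a large inner product.
   Counting parts then bounds induced paths.  Nonadjacent labels are at squared distance of
   order tau, so concentration of measure bounds bicliques of the complement, whereas moments of
   the inner product and the Sidorenko property of the 4-cycle give the clique density. *)
Require Import Defs.
From mathcomp Require Import all_boot all_algebra zify ring.

Set Implicit Arguments.
Unset Strict Implicit.
Unset Printing Implicit Defensive.

Local Open Scope nat_scope.

(** * Induced monotone paths in graphs with linear edge density *)

Section Paths.
Variables (n : nat) (e : rel 'I_n).

(** Only increasing pairs are tested: each vertex against its successor and against all later ones.
    [indpath_nth] recovers the indexed form. *)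
Fixpoint indpath (s : seq 'I_n) : bool :=
  if s is x :: s' then
    [&& (if s' is y :: s'' then e x y && all (fun z => ~~ e x z) s'' else true),
        all (fun y : 'I_n => x < y) s' & indpath s']
  else true.

Lemma indpath_cat s x y t :
  indpath (rcons s x) -> indpath (y :: t) ->
  (forall u v, u \in rcons s x -> v \in y :: t -> u < v) ->
  e x y ->
  (forall u v, u \in rcons s x -> v \in y :: t -> e u v -> u = x /\ v = y) ->
  indpath (rcons s x ++ y :: t).
Proof.
move=> + ht; elim: s => [|a s IH] /=.
  move=> _ lt_xt exy only_xy.
  have x_in : x \in rcons [::] x by rewrite inE.
  rewrite exy; apply/and3P; split; last by [].
    rewrite /=; apply/allP => z zt; apply/negP => exz.
    have [_ zy] := only_xy x z x_in (mem_behead (s := y :: t) zt) exz.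
    move: ht => /= /and3P[_ lt_t _].
    by move: (allP lt_t z zt); rewrite zy ltnn.
  by apply/(@allP _ _ (y :: t)) => z zt; apply: lt_xt.
move=> /and3P[adj lt_as path_s] lt_st exy only_xy.
have sub u : u \in rcons s x -> u \in rcons (a :: s) x.
  by move=> us; rewrite /= inE us orbT.
have a_in : a \in rcons (a :: s) x by rewrite /= inE eqxx.
apply/and3P; split.
- case: s adj lt_as sub {IH path_s lt_st only_xy a_in} (only_xy) (lt_st) => [|b s] /=.
    move=> /andP[eax _] /andP[lt_ax _] sub only_xy lt_st; rewrite eax /=.
    have no z : z \in y :: t -> ~~ e a z.
      move=> zt; apply/negP => eaz.
      have [ax _] := only_xy a z (mem_head _ _) zt eaz.
      by rewrite ax ltnn in lt_ax.
    by rewrite no ?mem_head //=; apply/allP => z zt; apply: no; rewrite inE zt orbT.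
  move=> /andP[-> all_s] /andP[_ lt_as] sub only_xy lt_st /=.
  rewrite all_cat all_s /=.
  have no z : z \in y :: t -> ~~ e a z.
    move=> zt; apply/negP => eaz.
    have [ax _] := only_xy a z (mem_head _ _) zt eaz.
    have : x \in rcons s x by rewrite mem_rcons mem_head.
    by move/(allP lt_as); rewrite ax ltnn.
  by rewrite no ?mem_head //=; apply/allP => z zt; apply: no; rewrite inE zt orbT.
- rewrite all_cat lt_as /=.
  by apply/andP; split; [|apply/allP => z zt]; apply: lt_st; rewrite // inE ?eqxx ?zt ?orbT.
- apply: IH => // u v us vt; first by apply: lt_st => //; apply: sub.
  by apply: only_xy => //; apply: sub.
Qed.

Lemma indpath_take m s : indpath s -> indpath (take m s).
Proof.
elim: s m => [|x s IH] [|m] //= /and3P[adj lt_s hs].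
apply/and3P; split; last exact: IH.
- case: s adj {IH lt_s hs} => [|y s] //=; case: m => [|m] //= /andP[-> h] /=.
  by apply/allP => z /mem_take; apply: (allP h).
- by apply/allP => z /mem_take; apply: (allP lt_s).
Qed.

Lemma indpath_nth x0 s : indpath s -> forall i j, i < j < size s ->
  (nth x0 s i < nth x0 s j) && (e (nth x0 s i) (nth x0 s j) == (j == i.+1)).
Proof.
elim: s => [|x s IH] hs i j; first by rewrite ltn0 andbF.
move: hs => /= /and3P[adj lt_s hs] /andP[ij js].
case: j ij js => [|j] //; case: i => [|i] /= ij js; last by rewrite eqSS; apply: IH => //; rewrite -ltnS ij.
rewrite (allP lt_s) ?mem_nth //=.
case: s adj js {IH lt_s hs} => [|y s] //= /andP[exy h] js.
case: j js {ij} => [|j] /= js; first by rewrite exy.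
by rewrite (negbTE (allP h _ _)) // mem_nth.
Qed.

(** Move the largest remaining element into [C], [c] times. This peels off the end of a set, what is
    left lying before it. *)
Lemma top_set (F : {set 'I_n}) c : c <= #|F| ->
  exists C : {set 'I_n}, [/\ C \subset F, #|C| = c &
    forall x y, x \in F :\: C -> y \in C -> x < y].
Proof.
elim: c => [|c IH] hc.
  by exists set0; split; rewrite ?sub0set ?cards0 // => x y _; rewrite in_set0.
have [C [CF cC ltC]] := IH (ltnW hc).
have /card_gt0P[x0 x0F] : 0 < #|F :\: C| by rewrite cardsD (setIidPr CF) cC subn_gt0.
case: (arg_maxnP (fun x : 'I_n => val x) x0F) => x xF xmax.
have [xF' xC] : x \in F /\ x \notin C by have /setDP[] : x \in F :\: C by [].
exists (x |: C); split.
- by rewrite subUset sub1set xF' CF.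
- by rewrite cardsU1 xC cC.
- move=> u v; rewrite !inE negb_or => /andP[/andP[ux uC] uF] /orP[/eqP ->|vC].
    have uFC : u \in F :\: C by rewrite !inE uC uF.
    have := xmax u uFC.
    by rewrite /= ltn_neqAle => le_ux; apply/andP; split.
  by apply: ltC => //; rewrite !inE uC uF.
Qed.

End Paths.

Section Update.
Variables (I A : finType).

Definition upd (y : {ffun I -> A}) i v : {ffun I -> A} :=
  [ffun j => if j == i then v else y j].

Lemma updE y i v j : upd y i v j = if j == i then v else y j.
Proof. by rewrite ffunE. Qed.

Lemma upd_upd y i v w : upd (upd y i v) i w = upd y i w.
Proof. by apply/ffunP => j; rewrite !ffunE; case: eqP. Qed.

Lemma upd_id y i : upd y i (y i) = y.
Proof. by apply/ffunP => j; rewrite !ffunE; case: eqP => [->|]. Qed.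

(** Exchanging the [i]-th value of [y] with [v] is an involution on the pairs [(y, v)]. *)
Lemma big_upd (S : Type) (idx : S) (op : Monoid.com_law idx) i (F : {ffun I -> A} -> S) :
  \big[op/idx]_y \big[op/idx]_(v : A) F (upd y i v) = \big[op/idx]_y \big[op/idx]_(v : A) F y.
Proof.
pose h (p : {ffun I -> A} * A) := (upd p.1 i p.2, p.1 i).
have hK : involutive h.
  by case=> y v; rewrite /h /= upd_upd updE eqxx upd_id.
rewrite !pair_bigA /= (reindex_inj (inv_inj hK)) /=.
by apply: eq_bigr => -[y v] _ /=; rewrite upd_upd upd_id.
Qed.

Lemma sum_fibres i (S : {set {ffun I -> A}}) :
  \sum_y #|[set v | upd y i v \in S]| = #|A| * #|S|.
Proof.
under eq_bigr => y _ do rewrite -sum1dep_card big_mkcond.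
rewrite (big_upd _ i (fun y => if y \in S then 1 else 0)).
under eq_bigr => y _ do rewrite sum_nat_const.
by rewrite -big_distrr /= -big_mkcond sum1dep_card cardsE.
Qed.

End Update.

Lemma exists_big_term (I : finType) (P : pred I) (F : I -> nat) c :
  0 < #|P| -> \sum_(i | P i) c <= \sum_(i | P i) F i -> exists2 i, P i & c <= F i.
Proof.
move=> P0 le_sum; apply/exists_inP; rewrite -[X in is_true X]negbK; apply/negP => /exists_inPn H.
have : \sum_(i | P i) F i < \sum_(i | P i) c.
  have [i0 Pi0] := card_gt0P P0; rewrite (bigD1 i0) // [X in _ < X](bigD1 i0) //=.
  rewrite -addSn leq_add //; first by rewrite ltnNge H.
  by apply: leq_sum => i /andP[Pi _]; rewrite ltnW // ltnNge H.
by rewrite ltnNge le_sum.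
Qed.

(** * Gyarfas' path argument in sets with small backward degrees *)

Section SparseSet.
Variables (n : nat) (e : rel 'I_n).

Definition before (A B : {set 'I_n}) := forall x y : 'I_n, x \in A -> y \in B -> x < y.

Definition edge_between (A B : {set 'I_n}) := exists x y, [/\ x \in A, y \in B & e x y].

Definition back (U : {set 'I_n}) (s : 'I_n) : {set 'I_n} := [set w in U | (w < s) && e w s].

(** Only the target of a step must lie in [B], so a walk may start outside: the sources used later
    are neighbours of a path that [B] avoids. *)
Definition down (B : {set 'I_n}) : rel 'I_n := fun u v => [&& v < u, e v u & v \in B].

Variable t : nat.
Hypothesis no_hole : forall A B : {set 'I_n},
  before A B -> t <= #|A| -> t <= #|B| -> edge_between A B.

(** The vertices of [C] without neighbour in [T] span no edge with [T], so [no_hole] leaves fewer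
    than [t] of them. *)
Lemma cover_card (C T : {set 'I_n}) : before C T -> t <= #|T| ->
  #|C| < #|[set z in C | [exists y in T, e z y]]| + t.
Proof.
move=> ltCT leT; rewrite ltnNge; apply/negP => le_C.
set Q := [set z in C | _] in le_C.
have QC : Q \subset C by apply/subsetP => z; rewrite inE => /andP[].
have le_t : t <= #|C :\: Q| by rewrite cardsD (setIidPr QC); lia.
have lt' : before (C :\: Q) T by move=> x y /setDP[xC _]; apply: ltCT.
have [x [y [/setDP[xC xQ] yT exy]]] := no_hole lt' le_t leT.
by case/negP: xQ; rewrite inE xC; apply/exists_inP; exists y.
Qed.

Lemma down_le B u v : connect (down B) u v -> v <= u.
Proof.
move/connectP => [p + ->]; elim: p u => [|w p IH] u //= /andP[/and3P[lt_wu _ _] /IH].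
by move/leq_trans; apply; apply: ltnW.
Qed.

(** Each round spends the last [3 * t] vertices of [F]. More than [2 * t] of them have a neighbour
    in [T], hence are reached from [S], and so one half of [S] reaches [t] of them. After [h] rounds
    a single source remains. *)
Lemma halving B h (S T F : {set 'I_n}) : 0 < #|S| <= 2 ^ h -> t <= #|T| ->
  (forall y, y \in T -> exists2 s, s \in S & connect (down B) s y) ->
  F \subset B -> before F T -> 3 * t * h <= #|F| ->
  exists (s : 'I_n) (T' F' : {set 'I_n}), [/\ s \in S, t <= #|T'|,
    (forall y, y \in T' -> connect (down B) s y), before F' T' &
    F' \subset F /\ #|F| <= #|F'| + 3 * t * h].
Proof.
elim: h S T F => [|h IH] S T F /andP[S0 leS] leT reach FB ltFT leF.
  have /cards1P[s Ss] : #|S| == 1 by rewrite eqn_leq leS S0.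
  exists s, T, F; split => //; first by rewrite Ss inE.
  - by move=> y /reach[s']; rewrite Ss => /set1P->.
  - by rewrite muln0 addn0.
have [C [CF cC ltC]] : exists C : {set 'I_n}, [/\ C \subset F, #|C| = 3 * t &
    forall x y, x \in F :\: C -> y \in C -> x < y] by apply: top_set; lia.
have cF : #|F :\: C| = #|F| - 3 * t by rewrite cardsD (setIidPr CF) cC.
have ltCT : before C T by move=> x y /(subsetP CF); apply: ltFT.
have := cover_card ltCT leT; set Q := [set z in C | _] => leQ.
(* The size bound is halved rather than [S] itself: both [S1] and its complement in [S] have at most
   [2 ^ h] elements. *)
have [S1 [S1S cS1 _]] : exists S1 : {set 'I_n}, [/\ S1 \subset S, #|S1| = minn #|S| (2 ^ h) &
    forall x y, x \in S :\: S1 -> y \in S1 -> x < y] by apply: top_set; lia.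
have cS2 : #|S :\: S1| = #|S| - #|S1| by rewrite cardsD (setIidPr S1S).
have step (S' : {set 'I_n}) : S' \subset S -> #|S'| <= 2 ^ h ->
    t <= #|[set z in Q | [exists s in S', connect (down B) s z]]| -> 0 < t ->
    exists (s : 'I_n) (T' F' : {set 'I_n}), [/\ s \in S, t <= #|T'|,
    (forall y, y \in T' -> connect (down B) s y), before F' T' &
    F' \subset F /\ #|F| <= #|F'| + 3 * t * h.+1].
  move=> S'S leS'; set T1 := [set z in Q | _] => leT1 t0.
  have [|||||| s [T' [F' [sS' leT' reach' ltFT' [F'F leF']]]]] := IH S' T1 (F :\: C).
  - rewrite leS' andbT; have /card_gt0P[z] : 0 < #|T1| by apply: leq_trans leT1.
    by rewrite inE => /andP[_ /exists_inP[s sS' _]]; apply/card_gt0P; exists s.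
  - by [].
  - by move=> y; rewrite inE => /andP[_ /exists_inP].
  - by apply: subset_trans FB; apply: subsetDl.
  - move=> x y xFC; rewrite !inE => /andP[/andP[yC _] _]; exact: ltC.
  - by rewrite cF; lia.
  exists s, T', F'; split => //; first exact: (subsetP S'S).
  split; first by apply: subset_trans F'F (subsetDl _ _).
  by rewrite cF in leF'; lia.
(* For [t = 0] an empty target will do. For [t > 0] the reached set is nonempty, and hence so is the
   chosen half of [S]. *)
have [t0|t0] := posnP t.
  have /card_gt0P[s sS] := S0.
  exists s, set0, F; split => //; first by rewrite t0.
  - by move=> y; rewrite inE.
  - by move=> x y _; rewrite inE.
  - by rewrite leq_addr.
have Qcov : Q \subset [set z in Q | [exists s in S1, connect (down B) s z]]
    :|: [set z in Q | [exists s in S :\: S1, connect (down B) s z]].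
  apply/subsetP => z zQ; have := zQ; rewrite inE => /andP[zC /exists_inP[y yT ezy]].
  have [s sS sy] := reach y yT.
  have sz : connect (down B) s z.
    apply: connect_trans sy _; apply: connect1; rewrite /down ezy ltCT //.
    by rewrite (subsetP FB) // (subsetP CF).
  apply/setUP; have [sS1|sS1] := boolP (s \in S1).
    by left; rewrite in_set zQ; apply/exists_inP; exists s.
  by right; rewrite in_set zQ; apply/exists_inP; exists s => //; rewrite inE sS1.
have := leq_trans (subset_leq_card Qcov) (leq_card_setU _ _).
have [le1 _|le1 le12] := leqP t #|[set z in Q | [exists s in S1, connect (down B) s z]]|.
  by apply: (step S1) => //; rewrite cS1 geq_minr.
apply: (step (S :\: S1)) => //; first exact: subsetDl.
  by rewrite cS2 cS1; move: leS; rewrite expnS; lia.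
lia.
Qed.

(* The last vertex of the walk adjacent to [s] can replace its beginning. *)
Lemma connect_avoid B s z : connect (down B) s z -> z != s -> ~~ e z s ->
  exists2 w, w \in back B s & connect (down (B :\: [set x | e x s])) w z.
Proof.
move/connectP => [p]; elim/last_ind: p z => [|p z' IH] z /=.
  by move=> _ -> /eqP.
rewrite rcons_path last_rcons => /andP[path_p last_p] -> zs ezs.
set u := last s p in last_p.
have /and3P[lt_zu ezu zB] := last_p.
have us : u <= s by apply: (down_le (B := B)); apply/connectP; exists p.
have [usE|u_s] := eqVneq u s; first by rewrite -usE ezu in ezs.
have step w : connect (down (B :\: [set x | e x s])) w u ->
    connect (down (B :\: [set x | e x s])) w z'.
  by move/connect_trans; apply; apply: connect1; rewrite /down lt_zu ezu !inE ezs.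
have [eus|eus] := boolP (e u s).
  exists u; last exact: step.
  rewrite inE eus andbT ltn_neqAle us u_s !andbT.
  case/lastP: p {IH} @u us u_s lt_zu ezu path_p last_p step eus => [|p v] /=.
    by rewrite eqxx.
  rewrite last_rcons => _ _ _ _; rewrite rcons_path => /andP[_ /and3P[_ _ ->]] //.
have [w ws wu] := IH u path_p erefl u_s eus.
by exists w => //; apply: step.
Qed.

(** One vertex [s] is added to the path: its neighbourhood leaves [B], and its earlier neighbours
    are the next sources. The reserve [F] pays [3 * t * h] for finding [s], [d] for the neighbours
    of [s] and [2 * t] for a new target. *)
Lemma sparse_step B h d (S T F : {set 'I_n}) : 0 < t ->
  0 < #|S| <= 2 ^ h -> t <= #|T| ->
  (forall y, y \in T -> exists2 s, s \in S & connect (down B) s y) ->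
  F \subset B -> before F T -> (forall s, s \in S -> #|back B s| <= d) ->
  3 * t * h + 2 * t + d <= #|F| ->
  exists (s : 'I_n) (T' F' : {set 'I_n}), let B' := B :\: [set x | e x s] in
   [/\ s \in S, t <= #|T'|,
    (forall y, y \in T' -> exists2 w, w \in back B s & connect (down B') w y),
    before F' T' & F' \subset B' /\ #|F| <= #|F'| + (3 * t * h + 2 * t + d)].
Proof.
move=> t0 cS leT reach FB ltFT degS leF.
have [|s [T1 [F1 [sS leT1 reach1 ltFT1 [F1F leF1]]]]] := halving cS leT reach FB ltFT.
  by lia.
set N := [set x | e x s].
(* [F1] precedes [T1], which descending walks reach from [s]; hence every neighbour of [s] in [F1]
   is counted by [back B s]. *)
have lt_s x : x \in F1 -> x < s.
  move=> xF; have /card_gt0P[y yT] : 0 < #|T1| by apply: leq_trans leT1.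
  exact: leq_trans (ltFT1 x y xF yT) (down_le (reach1 y yT)).
have leFN : #|F1| <= #|F1 :\: N| + d.
  rewrite cardsD; have := degS s sS.
  have : F1 :&: N \subset back B s.
    apply/subsetP => x; rewrite !inE => /andP[xF ->].
    by rewrite (subsetP FB) ?(subsetP F1F) //= lt_s.
  by move/subset_leq_card; lia.
have [C [CF cC ltC]] : exists C : {set 'I_n}, [/\ C \subset F1 :\: N, #|C| = 2 * t &
    forall x y, x \in (F1 :\: N) :\: C -> y \in C -> x < y] by apply: top_set; lia.
have CF1 x : x \in C -> x \in F1 /\ x \notin N by move/(subsetP CF)/setDP.
have ltCT : before C T1 by move=> x y /CF1[xF _]; apply: ltFT1.
have := cover_card ltCT leT1; set Q := [set z in C | _] => leQ.
exists s, Q, ((F1 :\: N) :\: C) => /=; split => //.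
- by move: leQ; rewrite cC mul2n -addnn ltn_add2r; apply: ltnW.
- move=> z; rewrite inE => /andP[zC /exists_inP[y yT ezy]].
  have [zF zN] := CF1 z zC.
  have zB : z \in B by rewrite (subsetP FB) ?(subsetP F1F).
  apply: connect_avoid.
  + apply: connect_trans (reach1 y yT) _; apply: connect1.
    by rewrite /down ezy zB ltFT1.
  + by apply/eqP => zs; have := lt_s z zF; rewrite zs ltnn.
  + by rewrite inE in zN.
- by move=> x y xF; rewrite inE => /andP[yC _]; apply: ltC.
- split; last first.
    rewrite cardsD (setIidPr CF) cC; move: leF1 leFN; clear.
    by move: (3 * t * h) #|F| #|F1| #|F1 :\: N| => a x y z; lia.
  apply/subsetP => x; rewrite !inE => /and3P[_ -> xF].
  by rewrite (subsetP FB) ?(subsetP F1F).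
Qed.

Lemma sparse_path m h d (U : {set 'I_n}) : 0 < t -> n <= 2 ^ h ->
  (forall s, s \in U -> #|back U s| <= d) ->
  3 * t + m * (3 * t * h + 2 * t + d) <= #|U| ->
  exists2 s, indpath e s & size s = m.
Proof.
move=> t0 le_h degU leU.
pose c := 3 * t * h + 2 * t + d.
(* The path [P] grows from right to left. Every [s] in [S] can be put in front of it, no vertex of
   [B] is adjacent to it, and [F] is the reserve for the [m - j] steps still to come. *)
suff: forall j, j <= m -> exists (P : seq 'I_n) (S T B F : {set 'I_n}),
   [/\ size P = j, 0 < #|S| /\ t <= #|T|,
    (forall s, s \in S -> indpath e (s :: P)),
    [/\ S \subset U, B \subset U, F \subset B, before F T &
      forall y, y \in T -> exists2 s, s \in S & connect (down B) s y] &
    (forall x p, x \in B -> p \in P -> ~~ e x p) /\ (m - j) * c <= #|F|].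
  move=> /(_ m (leqnn m)) [P [S [T [B [F [<- [/card_gt0P[s sS] _] hP _ _]]]]]].
  by exists P => //; have /= /and3P[] := hP s sS.
elim=> [|j IH] le_jm.
  (* The last [t] vertices of [U] are the first sources. Of the [2 * t] vertices before them at
     least [t] have a neighbour among the sources and form the first target. *)
  have [S [SU cS ltS]] : exists C : {set 'I_n}, [/\ C \subset U, #|C| = t &
    forall x y, x \in U :\: C -> y \in C -> x < y] by apply: top_set; lia.
  have cU : #|U :\: S| = #|U| - t by rewrite cardsD (setIidPr SU) cS.
  have [C [CU cC ltC]] : exists C : {set 'I_n}, [/\ C \subset U :\: S, #|C| = 2 * t &
    forall x y, x \in (U :\: S) :\: C -> y \in C -> x < y] by apply: top_set; lia.
  have ltCS : before C S by move=> x y /(subsetP CU) xU; apply: ltS.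
  have leS : t <= #|S| by rewrite cS.
  have := cover_card ltCS leS; set Q := [set z in C | _] => leQ.
  exists [::], S, Q, U, ((U :\: S) :\: C); split => //.
  - by split; lia.
  - split => //; first by apply: subset_trans (subsetDl _ _) (subsetDl _ _).
      by move=> x y xU; rewrite inE => /andP[yC _]; apply: ltC.
    move=> y; rewrite inE => /andP[yC /exists_inP[s sS eys]]; exists s => //.
    apply: connect1; rewrite /down eys ltCS //=.
    by have /setDP[] := subsetP CU y yC.
  - by split => //; rewrite cardsD (setIidPr CU) cC cU subn0; lia.
have [P [S [T [B [F [sP [S0 leT] hP [SU BU FB ltFT reach] [PB leF]]]]]]] := IH (ltnW le_jm).
have mj : m - j = (m - j.+1).+1 by lia.
have [|||s [T' [F' [sS leT' reach' ltFT' [F'B leF']]]]] :=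
    @sparse_step B h d S T F t0 _ leT reach FB ltFT.
- by rewrite S0 (leq_trans (max_card _)) // card_ord.
- move=> s sS; apply: leq_trans (degU s (subsetP SU s sS)); apply: subset_leq_card.
  by apply/subsetP => x; rewrite !inE => /and3P[/(subsetP BU)-> -> ->].
- by apply: leq_trans leF; rewrite mj mulSn leq_addr.
exists (s :: P), (back B s), T', (B :\: [set x | e x s]), F'; split => //.
- by rewrite /= sP.
- split => //; have /card_gt0P[y yT] : 0 < #|T'| by apply: leq_trans leT'.
  by have [w wB _] := reach' y yT; apply/card_gt0P; exists w.
- move=> w; rewrite inE => /and3P[wB lt_ws ews] /=.
  have := hP s sS => /= /and3P[adj lt_sP ->].
  rewrite adj lt_sP ews lt_ws !andbT /=; apply/andP; split.
    by apply/allP => p pP; apply: PB.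
  by apply/allP => p pP; apply: ltn_trans lt_ws (allP lt_sP p pP).
- split => //; first by apply: subset_trans BU; apply/subsetP => x; rewrite inE => /andP[].
  by apply: subset_trans BU; apply: subsetDl.
- split; last first.
    by rewrite -(leq_add2l c) [X in _ <= X]addnC; apply: leq_trans leF'; rewrite -mulSn -mj.
  move=> x p; rewrite !inE => /andP[exs xB] /orP[/eqP->|pP] //.
  exact: PB.
Qed.

End SparseSet.

(** * Zigzag paths through pairwise sparse sets *)

Section SparseParts.
Variables (n : nat) (e : rel 'I_n) (K B : nat).

Definition linear_edges := forall A C : {set 'I_n},
  before A C -> n <= B * #|A| -> n <= B * #|C| -> edge_between e A C.

Definition locally_dense := forall U : {set 'I_n},
  n <= B * #|U| -> exists2 u, u \in U & #|U| <= K * #|back e U u|.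

Definition edge_set (A C : {set 'I_n}) : {set 'I_n * 'I_n} :=
  [set p | [&& p.1 \in A, p.2 \in C & e p.1 p.2]].

Definition touching (A : {set 'I_n}) (Q : seq 'I_n) : {set 'I_n} :=
  [set u in A | has (e u) Q].

Hypotheses (edges : linear_edges) (dense : locally_dense).
Variables (s W : nat) (Y : nat -> {set 'I_n}).
Local Notation W' := (8 * W * K).
Local Notation tau := (4 * s * W').
Hypotheses (n0 : 0 < n) (K0 : 0 < K) (s0 : 0 < s) (leB : 2 * W' <= B).
Hypothesis sepY : forall i j, i < j < s -> before (Y i) (Y j).
Hypothesis largeY : forall i, i < s -> n <= W * #|Y i|.
Hypothesis sparseY : forall i j, i < j < s ->
  2 * s * W * tau * #|edge_set (Y i) (Y j)| <= n * n.

Let W0 : 0 < W.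
Proof. by have := largeY s0; case: (W) => //; rewrite mul0n leqNgt n0. Qed.

Let le8B : 8 * W <= B.
Proof. by apply: leq_trans leB; apply: leq_trans (leq_pmulr _ K0) (leq_pmull _ _). Qed.

(** The threshold [n / tau] is chosen so that [2 * s] tame vertices together touch at most
    [n / (2 * W')] vertices of an earlier set. *)
Definition tame j : {set 'I_n} :=
  [set v in Y j | all (fun i => tau * #|touching (Y i) [:: v]| <= n) (iota 0 j)].

(** Markov's inequality: every wild vertex accounts for more than [n / tau] edges, and [sparseY]
    bounds their total number. *)
Lemma few_wild i j : i < j < s ->
  2 * s * #|[set v in Y j | n < tau * #|touching (Y i) [:: v]|]| <= #|Y j|.
Proof.
move=> ijs; set bad := [set v in Y j | _].
have count : \sum_(v in bad) #|touching (Y i) [:: v]| <= #|edge_set (Y i) (Y j)|.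
  have -> : #|edge_set (Y i) (Y j)| =
      \sum_(v in Y j) #|[set u in Y i | e u v]|.
    transitivity (\sum_(u in Y i) \sum_(v | (v \in Y j) && e u v) 1).
      by rewrite pair_big_dep /= -sum1_card; apply: eq_bigl => p; rewrite inE.
    rewrite (exchange_big_dep (fun v => v \in Y j)) /=; last by move=> u v _ /andP[].
    apply: eq_bigr => v vY; rewrite -sum1dep_card; apply: eq_bigl => u.
    by rewrite vY.
  rewrite [X in _ <= X](big_setID bad) /= (setIidPr _); last first.
    by apply/subsetP => v; rewrite inE => /andP[].
  apply: leq_trans (leq_addr _ _); apply: leq_sum => v _.
  by apply: subset_leq_card; apply/subsetP => u; rewrite !inE /= orbF.
have le1 : #|bad| * n <= tau * #|edge_set (Y i) (Y j)|.
  apply: leq_trans (_ : tau * \sum_(v in bad) #|touching (Y i) [:: v]| <= _); last first.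
    by rewrite leq_mul2l count orbT.
  rewrite big_distrr /= -sum_nat_const; apply: leq_sum => v.
  by rewrite inE => /andP[_ /ltnW].
have le2 : 2 * s * W * #|bad| <= n.
  rewrite -(leq_pmul2r n0); apply: leq_trans (sparseY ijs).
  by rewrite -mulnA -[X in _ <= X]mulnA leq_mul2l le1 orbT.
have js : j < s by case/andP: ijs.
have := leq_trans le2 (largeY js).
by rewrite mulnAC [W * _]mulnC leq_pmul2r.
Qed.

(** Each of the at most [s] earlier sets spoils at most a fraction [1 / (2 * s)] of [Y j], so half
    of [Y j] is tame. *)
Lemma tame_large j : j < s -> n <= 2 * W * #|tame j|.
Proof.
move=> js.
pose bad i := [set v in Y j | n < tau * #|touching (Y i) [:: v]|].
have cov : Y j \subset tame j :|: \bigcup_(i < s | i < j) bad i.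
  apply/subsetP => v vY; apply/setUP.
  have [h|/allPn[i]] := boolP (all (fun i => tau * #|touching (Y i) [:: v]| <= n) (iota 0 j)).
    by left; rewrite inE vY.
  rewrite mem_iota -ltnNge add0n => ij lt_n.
  right; apply/bigcupP; exists (Ordinal (ltn_trans ij js)) => //.
  by rewrite inE vY.
have leU : 2 * s * #|\bigcup_(i < s | i < j) bad i| <= s * #|Y j|.
  apply: leq_trans (_ : 2 * s * (\sum_(i < s | i < j) #|bad i|) <= _).
    rewrite leq_mul2l; apply/orP; right.
    elim/big_rec2: _ => [|i x y _ le_xy]; first by rewrite cards0.
    by apply: leq_trans (leq_card_setU _ _) _; rewrite leq_add2l.
  rewrite big_distrr /=; apply: leq_trans (_ : \sum_(i < s | i < j) #|Y j| <= _).
    by apply: leq_sum => i ij; apply: few_wild; rewrite ij.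
  by rewrite sum_nat_const leq_mul2r (leq_trans (max_card _)) ?card_ord // orbT.
have le_half : 2 * #|\bigcup_(i < s | i < j) bad i| <= #|Y j|.
  by move: leU; rewrite -mulnA mulnCA leq_pmul2l.
have := leq_trans (subset_leq_card cov) (leq_card_setU _ _) => le_sum.
have le2 : #|Y j| <= 2 * #|tame j| by move: le_sum le_half; lia.
apply: leq_trans (largeY js) _; rewrite -mulnA mulnCA leq_mul2l.
by rewrite mulnC; apply/orP; right; rewrite mulnC.
Qed.

(** Otherwise local density applies to the set of low vertices itself and finds one with at least
    [n / W'] earlier neighbours there. *)
Lemma few_low (U : {set 'I_n}) : 8 * W * #|[set v in U | W' * #|back e U v| < n]| < n.
Proof.
rewrite ltnNge; apply/negP; set low := [set v in U | _] => le_n.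
have [|u ulow le_u] := dense (U := low).
  by apply: leq_trans le_n _; rewrite leq_mul2r le8B orbT.
have := ulow; rewrite inE => /andP[uU]; rewrite ltnNge => /negP; apply.
apply: leq_trans le_n _; rewrite -[X in _ <= X]mulnA leq_mul2l; apply/orP; right.
apply: leq_trans le_u _; rewrite leq_mul2l; apply/orP; right.
apply: subset_leq_card; apply/subsetP => w; rewrite !inE.
by case/andP => /andP[-> _].
Qed.

Lemma few_touching i (Q : seq 'I_n) :
  (forall q, q \in Q -> exists2 j, i < j < s & q \in tame j) ->
  tau * #|touching (Y i) Q| <= size Q * n.
Proof.
elim: Q => [_|q Q IH tameQ].
  suff -> : touching (Y i) [::] = set0 by rewrite cards0 muln0.
  by apply/setP => u; rewrite !inE andbF.
have {}IH := IH (fun q' q'Q => tameQ q' (mem_behead (s := q :: Q) q'Q)).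
have [j ijs] := tameQ q (mem_head _ _); rewrite inE => /andP[_ /allP tame_q].
have {}tame_q : tau * #|touching (Y i) [:: q]| <= n.
  by apply: tame_q; rewrite mem_iota; case/andP: ijs.
have sub : touching (Y i) (q :: Q) \subset touching (Y i) [:: q] :|: touching (Y i) Q.
  by apply/subsetP => u; rewrite !inE /= orbF => /andP[-> /=].
have := leq_trans (subset_leq_card sub) (leq_card_setU _ _).
rewrite -(leq_pmul2l (m := tau)); last by rewrite !muln_gt0 s0 W0 K0.
by move/leq_trans; apply; rewrite mulnDr /= mulSn leq_add.
Qed.

(** Working from the last set to the first, a path [x :: Q] is prolonged to [[:: v, q, x & Q]]: [q]
    is an earlier neighbour of [x] within the set of [x], and [v] lies in the preceding set. Each
    set thus contributes two vertices, except that the first contributes one. *)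
Lemma sparse_parts_path : exists x Q, [/\ indpath e (x :: Q), x \in Y 0, size Q = 2 * s.-1 &
  forall q, q \in Q -> exists2 j, 0 < j < s & q \in Y j].
Proof.
have tameY j v : v \in tame j -> v \in Y j by rewrite inE => /andP[].
(* The last clause keeps at least [n / (2 * W')] candidates for the next [q], namely earlier
   neighbours of [x] that [Q] does not touch. *)
suff: forall m, m < s -> exists x Q,
   [/\ indpath e (x :: Q), x \in tame (s.-1 - m), size Q = 2 * m,
     (forall q, q \in Q -> exists2 j, s.-1 - m < j < s & q \in tame j) &
     n <= 2 * W' * #|back e (tame (s.-1 - m)) x :\: touching (Y (s.-1 - m)) Q|].
  move=> /(_ s.-1); rewrite prednK // => /(_ (leqnn s)) [x [Q]]; rewrite subnn /=.
  move=> [pQ xY sQ tameQ _]; exists x, Q; split => //; first exact: tameY.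
  by move=> q /tameQ[j js qY]; exists j => //; apply: tameY.
(* Of at least [n / (2 * W)] tame vertices, fewer than [n / (8 * W)] have few earlier neighbours and
   at most [n / (8 * W)] touch [Q]. *)
have find i Q : i < s -> size Q <= 2 * s ->
    (forall q, q \in Q -> exists2 j, i < j < s & q \in tame j) ->
    n <= B * #|[set v in tame i | (n <= W' * #|back e (tame i) v|)
                 && ~~ has (e v) Q]|.
  move=> is_ sQ tameQ; set C := [set v in tame i | _].
  set low := [set v in tame i | W' * #|back e (tame i) v| < n].
  have cov : tame i \subset C :|: (low :|: touching (Y i) Q).
    apply/subsetP => v vT; apply/setUP.
    have [le_n|lt_n] := leqP n (W' * #|back e (tame i) v|); last first.
      by right; apply/setUP; left; rewrite in_set vT.
    have [hv|hv] := boolP (has (e v) Q).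
      by right; apply/setUP; right; rewrite in_set (tameY _ _ vT).
    by left; rewrite in_set vT le_n.
  have := leq_trans (subset_leq_card cov) (leq_card_setU _ _).
  move/leq_trans => /(_ _ (leq_add (leqnn _) (leq_card_setU _ _))) le1.
  have le2 : 8 * W * #|low| < n := few_low (tame i).
  have le3 : 8 * W * #|touching (Y i) Q| <= n.
    have := leq_trans (few_touching tameQ) (leq_mul sQ (leqnn n)).
    rewrite (_ : tau * _ = 2 * s * (2 * (W' * #|touching (Y i) Q|))); last by ring.
    rewrite leq_pmul2l ?muln_gt0 // => le_n; apply: leq_trans le_n.
    rewrite (_ : 2 * (W' * _) = 8 * W * (2 * K * #|touching (Y i) Q|)); last by ring.
    by rewrite leq_mul2l leq_pmull ?orbT // muln_gt0.
  have le4 := tame_large is_.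
  apply: leq_trans (_ : 8 * W * #|C| <= _); last first.
    by rewrite leq_mul2r le8B orbT.
  have {}le1 := leq_mul (leqnn (8 * W)) le1.
  move: le1 le2 le3 le4; rewrite !mulnDr -(mulnA 8) -(mulnA 8) -(mulnA 8) -(mulnA 8) -(mulnA 2).
  by move: (W * #|tame i|) (W * #|C|) (W * #|low|) (W * #|touching (Y i) Q|) => a b c d; lia.
elim=> [|m IH] ms; [set i := s.-1 - 0 | set i := s.-1 - m.+1].
  have lt_i : i < s by rewrite /i subn0 prednK.
  have := find i [::] lt_i isT; set C := [set v in tame i | _] => /(_ (fun q => _)) leC.
  have /card_gt0P[x] : 0 < #|C|.
    have {}leC : n <= B * #|C| by apply: leC.
    by rewrite lt0n; apply/eqP => c0; move: leC n0; rewrite c0 muln0; lia.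
  rewrite inE andbT => /andP[xT le_n].
  exists x, [::]; split => //.
  suff -> : touching (Y i) [::] = set0.
    by rewrite setD0; apply: leq_trans le_n _; rewrite -[X in _ <= X]mulnA leq_pmull.
  by apply/setP => u; rewrite !inE andbF.
have [x [Q]] := IH (ltnW ms); set i' := s.-1 - m => /= -[pQ xT sQ tameQ leA].
have i'E : i' = i.+1 by rewrite /i' /i; lia.
have i's : i' < s by rewrite /i'; lia.
have lt_i : i < s by lia.
have tame_xQ q : q \in x :: Q -> exists2 j, i < j < s & q \in tame j.
  rewrite inE => /orP[/eqP->|/tameQ[j /andP[i'j js] qj]].
    by exists i'; rewrite // i'E ltnSn -i'E.
  by exists j => //; rewrite js andbT; apply: ltn_trans i'j; rewrite i'E.
have sxQ : size (x :: Q) <= 2 * s by rewrite /= sQ; lia.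
have := find i (x :: Q) lt_i sxQ tame_xQ; set C := [set v in tame i | _] => leC.
set A := _ :\: _ in leA.
have leA' : n <= B * #|A| by apply: leq_trans leA _; rewrite leq_mul2r leB orbT.
have ltCA : before C A.
  move=> u w; rewrite !inE => /and3P[/andP[uY _] _ _] /andP[_ /andP[/andP[wY _] _]].
  by apply: sepY uY wY; rewrite i'E ltnSn -i'E.
have [v [q [vC qA evq]]] := edges ltCA leC leA'.
have [vT le_n no_vQ] : [/\ v \in tame i, n <= W' * #|back e (tame i) v| & ~~ has (e v) (x :: Q)].
  by move: vC; rewrite in_set => /and3P.
have [qT lt_qx eqx no_qQ] : [/\ q \in tame i', q < x, e q x & ~~ has (e q) Q].
  move: qA; rewrite in_setD [q \in touching _ _]in_set [q \in back _ _ _]in_set.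
  move=> /andP[h /and3P[qT lt_qx eqx]]; split => //.
  by move: h; rewrite (tameY _ _ qT).
have tame_qxQ q' : q' \in [:: q, x & Q] -> exists2 j, i < j < s & q' \in tame j.
  rewrite inE => /orP[/eqP->|/tame_xQ //].
  by exists i'; rewrite // i'E ltnSn -i'E.
exists v, [:: q, x & Q]; split => //.
- apply/and3P; split.
  + by rewrite evq; apply/allP => z zQ; apply: contra no_vQ => evz; apply/hasP; exists z.
  + apply/allP => z /tame_qxQ[j /andP[ij js] zT].
    by apply: sepY (tameY _ _ vT) (tameY _ _ zT); rewrite ij.
  + apply/and3P; split => //.
      by rewrite eqx; apply/allP => z zQ; apply: contra no_qQ => eqz; apply/hasP; exists z.
    apply/allP => z; rewrite inE => /orP[/eqP-> //|/tameQ[j /andP[ij js] zT]].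
    by apply: sepY (tameY _ _ qT) (tameY _ _ zT); rewrite ij.
- by rewrite /= sQ mulnS add2n.
(* At most [2 * s] tame vertices touch at most [n / (2 * W')] vertices, half of the guaranteed
   backward neighbourhood of [v]. *)
- have sqxQ : size [:: q, x & Q] <= 2 * s by rewrite /= sQ -add2n -mulnS leq_mul2l ltnW.
  have := leq_trans (few_touching tame_qxQ) (leq_mul sqxQ (leqnn n)).
  rewrite (_ : tau * _ = 2 * s * (2 * (W' * #|touching (Y i) [:: q, x & Q]|))); last by ring.
  rewrite leq_pmul2l ?muln_gt0 // => le_t.
  have := cardsID (touching (Y i) [:: q, x & Q]) (back e (tame i) v).
  have := subset_leq_card (subsetIr (back e (tame i) v) (touching (Y i) [:: q, x & Q])).
  move: le_n le_t; move: #|_ :&: _| #|_ :\: _| #|touching _ _| #|back _ _ _| => a b c d.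
  move: W' => w le_n le_t /(leq_mul (leqnn w)) le_ac abE; move: le_n; rewrite -abE -mulnA mulnDr.
  by move: le_t le_ac; move: (w * a) (w * b) (w * c) => a' b' c'; clear; lia.
Qed.

End SparseParts.

Lemma indpath_rcons n (e : rel 'I_n) s p x : indpath e (rcons (rcons s p) x) ->
  [/\ indpath e (rcons s p), e p x, forall a, a \in rcons s p -> a < x &
      forall a, a \in s -> ~~ e a x].
Proof.
elim: s => [|a s IH] /=; first by case/and3P=> /andP[-> _] /andP[px _] _; split => // a; rewrite inE => /eqP->.
case/and3P => adj lt_a /IH[ps epx ltx nox].
have a_x : ~~ e a x.
  case: s adj {IH lt_a ps ltx nox} => [|b s] /= /andP[_]; first by rewrite andbT.
  by rewrite !all_rcons => /andP[].
split => //.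
- rewrite ps !andbT; apply/andP; split.
    case: s adj {IH lt_a ps ltx nox} => [|b s] /= /andP[-> //].
    by rewrite all_rcons => /andP[_ ->].
  by move: lt_a; rewrite all_rcons => /andP[_ ->].
- move=> c; rewrite inE => /orP[/eqP->|/ltx//].
  by move: lt_a; rewrite all_rcons => /andP[].
- by move=> c; rewrite inE => /orP[/eqP->//|/nox].
Qed.

Lemma indpath_rcons_lt n (e : rel 'I_n) s x : indpath e (rcons s x) ->
  forall a, a \in s -> a < x.
Proof. by case/lastP: s => // s p /indpath_rcons[]. Qed.

(** * Dense systems of pairwise nonadjacent tuples *)

Section TupleSystems.
Variables (n r : nat) (e : rel 'I_n).
Local Notation T := {ffun 'I_r -> 'I_n}.
Implicit Types (D : {set T}) (y z : T).

Definition tuple_system D :=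
  (forall z (i j : 'I_r), z \in D -> i < j -> ~~ e (z i) (z j)) /\
  (forall z z' (i j : 'I_r), z \in D -> z' \in D -> i < j -> z i < z' j).

Definition proj (i : 'I_r) D : {set 'I_n} := [set z i | z : T in D].

(** The vertices that can stand before [y i] on an induced path without seeing the later coordinates
    of [y]. Being [i]-th entries themselves, they are ordered against all other coordinates of the
    system. *)
Definition entries D (i : 'I_r) y : {set 'I_n} :=
  [set v in proj i D | [&& v < y i, e v (y i) & [forall l : 'I_r, (i < l) ==> ~~ e v (y l)]]].

(** The tuples that survive when the path attached to coordinate [i] is carried over to coordinate
    [j] along the edge from [u] to [v]. *)
Definition jump D (i j : 'I_r) (u v : 'I_n) : {set T} :=
  [set z in D | (v \in entries D j z) && [forall l : 'I_r, (j <= l) ==> ~~ e u (z l)]].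

Definition good_tuples D W : {set T} :=
  [set y in D | [forall i, n <= W * #|entries D i y|]].

Section Dense.
Variables (K B d : nat) (D : {set T}).
Local Notation W := (K * (2 * r * d)).
Hypotheses (dense : locally_dense e K B) (sysD : tuple_system D).
Hypotheses (n0 : 0 < n) (r0 : 0 < r) (leB : 2 * r * d <= B).
Hypothesis leD : n ^ r <= d * #|D|.

Let d0 : 0 < d.
Proof. by move: leD; case: (d) => //; rewrite mul0n leqNgt expn_gt0 n0. Qed.

(** Fix all coordinates but the [i]-th. If more than [n / (2 * r * d)] values gave bad tuples, local
    density would find one value [u] with many earlier neighbours among them. Each such neighbour
    completes a tuple of [D], so it misses the later coordinates and is an entry for [u]. *)
Lemma few_bad i : 2 * r * #|[set y in D | W * #|entries D i y| < n]| <= #|D|.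
Proof.
set S := [set y in D | _].
have fibre y : 2 * r * d * #|[set v | upd y i v \in S]| <= n.
  set U := [set v | _]; rewrite leqNgt; apply/negP => lt_n.
  have [|u uU leU] := dense (U := U).
    by apply: leq_trans (ltnW lt_n) _; rewrite leq_mul2r leB orbT.
  move: (uU); rewrite in_set in_set => /andP[uD]; rewrite ltnNge => /negP; apply.
  apply: leq_trans (ltnW lt_n) _; rewrite -[X in _ <= X](_ : 2 * r * d * (K * #|entries D i (upd y i u)|) = _);
    last by ring.
  rewrite leq_mul2l; apply/orP; right.
  apply: leq_trans leU _; rewrite leq_mul2l; apply/orP; right.
  apply: subset_leq_card; apply/subsetP => v; rewrite in_set => /andP[].
  rewrite !in_set => /andP[vD _] /andP[lt_vu evu].
  apply/andP; split; first by apply/imsetP; exists (upd y i v) => //; rewrite updE eqxx.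
  rewrite updE eqxx lt_vu evu /=; apply/forallP => l; apply/implyP => il.
  have := sysD.1 _ _ _ vD il.
  by rewrite !updE eqxx -val_eqE /= (gtn_eqF il).
have : n * (2 * r * d * #|S|) <= n * n ^ r.
  rewrite mulnCA -{1}[n]card_ord -(sum_fibres i) big_distrr /=.
  apply: leq_trans (_ : \sum_(y : T) n <= _); first exact: leq_sum.
  by rewrite sum_nat_const card_ffun !card_ord mulnC.
rewrite leq_pmul2l // => /leq_trans /(_ leD).
by rewrite mulnAC mulnC leq_pmul2l.
Qed.

Lemma many_good : #|D| <= 2 * #|good_tuples D W|.
Proof.
pose bad (i : 'I_r) := [set y in D | W * #|entries D i y| < n].
have cov : D \subset good_tuples D W :|: \bigcup_i bad i.
  apply/subsetP => y yD; apply/setUP.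
  have [h|/forallPn[i]] := boolP [forall i, n <= W * #|entries D i y|].
    by left; rewrite in_set yD.
  by rewrite -ltnNge => lt_n; right; apply/bigcupP; exists i; rewrite // in_set yD.
have le1 : 2 * r * #|\bigcup_i bad i| <= r * #|D|.
  apply: leq_trans (_ : 2 * r * (\sum_i #|bad i|) <= _).
    rewrite leq_mul2l; apply/orP; right.
    elim/big_rec2: _ => [|i x y _ le_xy]; first by rewrite cards0.
    by apply: leq_trans (leq_card_setU _ _) _; rewrite leq_add2l.
  rewrite big_distrr /=; apply: leq_trans (_ : \sum_(i < r) #|D| <= _).
    by apply: leq_sum => i _; apply: few_bad.
  by rewrite sum_nat_const card_ord.
have le2 : 2 * #|\bigcup_i bad i| <= #|D| by move: le1; rewrite -mulnA mulnCA leq_pmul2l.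
have := leq_trans (subset_leq_card cov) (leq_card_setU _ _).
by move: le2; clear; lia.
Qed.

Lemma good_nonempty : 0 < #|good_tuples D W|.
Proof.
have := many_good; have : 0 < #|D|.
  by move: leD; case: #|D| => //; rewrite muln0 leqNgt expn_gt0 n0.
by clear; lia.
Qed.

(** Averaging over [v]: at least half of the tuples have at least [n / W] entries each. *)
Lemma common_entry j : exists v,
  n ^ r <= 2 * d * W * #|[set z in D | v \in entries D j z]|.
Proof.
set G := good_tuples D W.
have [||v _ le_v] := @exists_big_term _ xpredT
    (fun v => W * #|[set z in D | v \in entries D j z]|) #|G|.
- by rewrite card_ord.
- rewrite sum_nat_const card_ord -big_distrr /=.
  under eq_bigr => v _ do rewrite -sum1dep_card.
  rewrite (exchange_big_dep (fun z => z \in D)) /=; last by move=> v z _ /andP[].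
  apply: leq_trans (_ : \sum_(z in G) n <= _); first by rewrite sum_nat_const mulnC.
  rewrite [X in W * X](big_setID G) /= (setIidPr _); last first.
    by apply/subsetP => z; rewrite in_set => /andP[].
  rewrite mulnDr; apply: leq_trans (leq_addr _ _); rewrite big_distrr /=.
  apply: leq_sum => z; rewrite in_set => /andP[zD /forallP/(_ j) le_n].
  apply: leq_trans le_n _; rewrite leq_mul2l; apply/orP; right.
  rewrite -sum1_card [X in _ <= X](eq_bigl (fun v => v \in entries D j z)) // => v.
  by rewrite zD.
exists v; apply: leq_trans leD _.
rewrite -[2 * d * W * _](_ : d * (2 * (W * #|[set z in D | v \in entries D j z]|)) = _);
  last by ring.
rewrite leq_mul2l; apply/orP; right.
by apply: leq_trans many_good _; rewrite leq_mul2l le_v orbT.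
Qed.

(** An edge from [u] to [v] between the entry sets of [y] puts [y] into a jump set, and by
    assumption these are small. Averaging over the good tuples gives one that is sparse for all
    pairs at once: [s * s] pays for the pairs, and [2 * d] for passing from [n ^ r] to the good
    tuples. *)
Lemma sparse_choice s (f : nat -> 'I_r) E : 0 < s ->
  (forall a b, a < b < s -> forall u v, u \in proj (f a) D -> v \in proj (f b) D ->
     e u v -> 2 * (s * s) * d * E * #|jump D (f a) (f b) u v| <= n ^ r) ->
  (forall a b, a < b < s -> f a < f b) ->
  exists2 y, y \in good_tuples D W & forall a b, a < b < s ->
    E * #|edge_set e (entries D (f a) y) (entries D (f b) y)| <= n * n.
Proof.
move=> s0 poor incr; set G := good_tuples D W.
pose ed a b y := #|edge_set e (entries D (f a) y) (entries D (f b) y)|.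
pose d2 := 2 * (s * s) * d * E.
have pair_bound a b : a < b < s -> d2 * \sum_(y in G) ed a b y <= n * n * n ^ r.
  move=> abs.
  have -> : \sum_(y in G) ed a b y = \sum_(p : 'I_n * 'I_n)
      #|[set y in G | p \in edge_set e (entries D (f a) y) (entries D (f b) y)]|.
    under eq_bigr => y _ do rewrite /ed -sum1_card.
    under [RHS]eq_bigr => p _ do rewrite -sum1dep_card.
    rewrite (exchange_big_dep xpredT) //=.
  rewrite big_distrr /=; apply: leq_trans (_ : \sum_(p : 'I_n * 'I_n) n ^ r <= _); last first.
    by rewrite sum_nat_const card_prod !card_ord.
  apply: leq_sum => -[u v] _; set S := [set y in G | _].
  have [/set0Pn[y]|] := boolP (S != set0); last by rewrite negbK => /eqP->; rewrite cards0 muln0.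
  rewrite [y \in S]in_set [_ \in edge_set _ _ _]in_set => /andP[_ /and3P[]] /=.
  rewrite in_set => /andP[uP _]; rewrite in_set => /andP[vP _] euv.
  apply: leq_trans (poor a b abs u v uP vP euv); rewrite leq_mul2l; apply/orP; right.
  apply: subset_leq_card; apply/subsetP => z.
  rewrite [z \in S]in_set [_ \in edge_set _ _ _]in_set => /andP[zG /and3P[/= uz vz _]].
  rewrite in_set vz (_ : z \in D) /=; last by move: zG; rewrite in_set => /andP[].
  apply/forallP => l; apply/implyP => le_l.
  move: uz; rewrite in_set => /andP[_ /and3P[_ _ /forallP/(_ l)/implyP]]; apply.
  exact: leq_trans (incr a b abs) le_l.
pose tot y := \sum_(a < s) \sum_(b < s | a < b) ed a b y.
have tot_bound : d2 * \sum_(y in G) tot y <= s * s * (n * n * n ^ r).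
  rewrite /tot exchange_big /= big_distrr /=.
  apply: leq_trans (_ : \sum_(a < s) s * (n * n * n ^ r) <= _); last first.
    by rewrite sum_nat_const card_ord mulnA.
  apply: leq_sum => a _; rewrite exchange_big /= big_distrr /=.
  apply: leq_trans (_ : \sum_(b < s | a < b) (n * n * n ^ r) <= _).
    by apply: leq_sum => b ab; apply: pair_bound; rewrite ab ltn_ord.
  by rewrite sum_nat_const leq_mul2r (leq_trans (max_card _)) ?card_ord ?orbT.
have [/exists_inP[y yG le_y]|none] := boolP [exists y in G, E * tot y <= n * n].
  exists y => // a b /andP[ab bs]; apply: leq_trans le_y.
  rewrite leq_mul2l; apply/orP; right; rewrite /tot.
  rewrite (bigD1 (Ordinal (ltn_trans ab bs))) //= (bigD1 (Ordinal bs)) //=.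
  by rewrite -addnA leq_addr.
(* If no good tuple works, each has [E * tot y] at least [n * n + 1]; the successor turns the two
   estimates into a contradiction. *)
have : 2 * (s * s) * d * (n * n).+1 * #|G| <= s * s * (n * n) * (d * (2 * #|G|)).
  apply: leq_trans (_ : d2 * \sum_(y in G) tot y <= _).
    rewrite /d2 -!mulnA !leq_mul2l; do 4!(apply/orP; right).
    rewrite big_distrr /= [_ * #|G|]mulnC -sum_nat_const; apply: leq_sum => y yG.
    by rewrite ltnNge; apply: contra none => le_y; apply/exists_inP; exists y.
  apply: leq_trans tot_bound _; rewrite mulnA leq_mul2l; apply/orP; right.
  by apply: leq_trans leD _; rewrite leq_mul2l many_good orbT.
rewrite (_ : s * s * (n * n) * _ = 2 * (s * s) * d * (n * n) * #|G|); last by ring.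
rewrite leq_pmul2r ?good_nonempty // leq_pmul2l; first by rewrite ltnn.
by rewrite !muln_gt0 s0 d0.
Qed.

End Dense.
End TupleSystems.

Lemma linear_edges_mono n e B B' : B <= B' -> @linear_edges n e B' -> @linear_edges n e B.
Proof.
move=> le_B edges A C ltAC leA leC.
by apply: edges ltAC _ _; apply: leq_trans (leq_mul le_B (leqnn _)).
Qed.

Lemma locally_dense_mono n e K B B' :
  B <= B' -> @locally_dense n e K B' -> @locally_dense n e K B.
Proof.
by move=> le_B dense U leU; apply: dense; apply: leq_trans (leq_mul le_B (leqnn _)).
Qed.

Lemma sum_descending k : \sum_(l < k) (if l == 0 :> nat then 0 else k - l) = 'C(k, 2).
Proof.
case: k => [|k]; first by rewrite big_ord0.
rewrite -bin2_sum big_mkord big_ord_recl [RHS]big_ord_recl /= !add0n.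
rewrite (reindex_inj rev_ord_inj) /=; apply: eq_bigr => i _.
by rewrite /bump /= !add1n; have := ltn_ord i; lia.
Qed.

(** If every label [l] occurred at most [k - l] times, there would be at most [1 + ... + (k - 1)]
    coordinates. *)
Lemma large_class k r (lam : 'I_r -> nat) : (forall j, 0 < lam j < k) -> 'C(k, 2) < r ->
  exists2 l, 0 < l < k & k - l < #|[set j | lam j == l]|.
Proof.
move=> lamP lt_r.
have lt_lam j : lam j < k by case/andP: (lamP j).
have rE : r = \sum_(l < k) #|[set j | lam j == l]|.
  rewrite -[LHS]card_ord -sum1_card (partition_big (fun j => Ordinal (lt_lam j)) xpredT) //=.
  by apply: eq_bigr => l _; rewrite -sum1dep_card; apply: eq_bigl => j.
have [/existsP[l /andP[l0 lt_l]]|/existsPn none] :=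
    boolP [exists l : 'I_k, (0 < l) && (k - l < #|[set j | lam j == l]|)].
  by exists l; rewrite // l0 ltn_ord.
suff : r <= 'C(k, 2) by rewrite leqNgt lt_r.
rewrite -sum_descending rE; apply: leq_sum => l _.
case: eqP => [l0|/eqP l0]; last first.
  by have := none l; rewrite lt0n l0 /= -leqNgt.
rewrite leqn0 cards_eq0; apply/eqP/setP => j; rewrite !inE.
by have /andP[j0 _] := lamP j; rewrite l0 (gtn_eqF j0).
Qed.

(** * Induced paths attached to the coordinates of a system *)

Section Labels.
Variables (n r : nat) (e : rel 'I_n).
Local Notation T := {ffun 'I_r -> 'I_n}.
Implicit Types (D : {set T}) (lam : 'I_r -> nat) (P : 'I_r -> seq 'I_n).

(** Together with [z j] the attached path has [2 * lam j] vertices when [lam j > 0]; for [lam j = 0]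
    the truncated predecessor makes [P j] empty. *)
Definition labelled (D : {set T}) (lam : 'I_r -> nat) (P : 'I_r -> seq 'I_n) :=
  forall j, size (P j) = (2 * lam j).-1 /\
    forall z, z \in D -> indpath e (rcons (P j) (z j)) /\
      (forall l : 'I_r, j < l -> forall a, a \in P j -> ~~ e a (z l)).

Lemma labelled_sub D (D' : {set T}) lam P : D' \subset D -> labelled D lam P -> labelled D' lam P.
Proof. by move=> /subsetP sub H j; have [sP HP] := H j; split=> // z /sub /HP. Qed.

Lemma tuple_system_sub D (D' : {set T}) : D' \subset D -> tuple_system e D -> tuple_system e D'.
Proof.
move=> /subsetP sub [H1 H2]; split=> [z i j /sub zD|z z' i j /sub zD /sub zD'].
  exact: H1.
exact: H2.
Qed.

Definition relabel (A : Type) (f : 'I_r -> A) j x i := if i == j then x else f i.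

Lemma labelled_relabel D lam P j l p : labelled D lam P -> size p = (2 * l).-1 ->
  (forall z, z \in D -> indpath e (rcons p (z j)) /\
      (forall l : 'I_r, j < l -> forall a, a \in p -> ~~ e a (z l))) ->
  labelled D (relabel lam j l) (relabel P j p).
Proof. by move=> H sp Hp i; rewrite /relabel; case: eqP => [->|_]; [split|apply: H]. Qed.

Lemma sum_relabel (lam : 'I_r -> nat) j l : lam j < l ->
  \sum_i lam i < \sum_i relabel lam j l i.
Proof.
move=> lt_l; rewrite (bigD1 j) //= [X in _ < X](bigD1 j) //= {1}/relabel eqxx.
rewrite -addSn leq_add //; apply: leq_sum => i /negbTE ij.
by rewrite /relabel ij.
Qed.

Lemma start_label D lam P j v : tuple_system e D -> labelled D lam P ->
  let D' := [set z in D | v \in entries e D j z] in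
  labelled D' (relabel lam j 1) (relabel P j [:: v]).
Proof.
move=> sysD H D'; apply: labelled_relabel => //.
  by apply: labelled_sub H; apply/subsetP => z; rewrite inE => /andP[].
move=> z; rewrite inE => /andP[zD]; rewrite inE => /andP[vP /and3P[lt_v ev /forallP out]].
split; first by rewrite /= ev lt_v.
move=> l jl a; rewrite inE => /eqP->.
exact: (implyP (out l)).
Qed.

(** Since [u] is an [i]-th entry, [P i] continues to it; [P i] sees no [j]-th entry, in particular
    neither [v] nor [z j]. Positivity of [lam i] is what makes the new length [2 * lam i + 1]. *)
Lemma jump_label D lam P (i j : 'I_r) u v : tuple_system e D -> labelled D lam P ->
  i < j -> u \in proj i D -> v \in proj j D -> e u v -> 0 < lam i ->
  labelled (jump e D i j u v) (relabel lam j (lam i).+1)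
    (relabel P j (rcons (rcons (P i) u) v)).
Proof.
move=> [indD sepD] H ij /imsetP[z1 z1D uE] /imsetP[z2 z2D vE] euv lam0.
have [sP HP] := H i.
apply: labelled_relabel.
- by apply: labelled_sub H; apply/subsetP => z; rewrite inE => /andP[].
- by rewrite !size_rcons sP mulnS; lia.
move=> z; rewrite inE => /and3P[zD vz /forallP u_out].
have [pu outP1] := HP _ z1D; have [_ outP2] := HP _ z2D; have [_ outP] := HP _ zD.
rewrite -uE in pu.
have [lt_vz evz v_out] : [/\ v < z j, e v (z j) & forall l : 'I_r, j < l -> ~~ e v (z l)].
  move: vz; rewrite inE => /andP[_ /and3P[-> -> /forallP h]]; split=> // l.
  exact: (implyP (h l)).
split; last first.
  move=> l jl a; rewrite mem_rcons inE mem_rcons inE => /or3P[/eqP->|/eqP->|aP].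
  - exact: v_out.
  - by apply: (implyP (u_out l)); apply: ltnW.
  - by apply: outP => //; apply: ltn_trans jl.
have -> : rcons (rcons (rcons (P i) u) v) (z j) = rcons (P i) u ++ [:: v; z j].
  by rewrite -!cats1 -!catA.
apply: indpath_cat => //.
- by rewrite /= evz lt_vz.
- have ltb b : b \in [:: v; z j] -> u < b.
    by rewrite !inE => /orP[]/eqP->; rewrite ?vE uE; apply: sepD.
  move=> a b; rewrite mem_rcons inE => /orP[/eqP->|aP] /ltb // lt_ub.
  exact: ltn_trans (indpath_rcons_lt pu aP) lt_ub.
- move=> a b; rewrite mem_rcons !inE => /orP[/eqP->|aP] /orP[]/eqP-> // eab.
  + by rewrite (negbTE (implyP (u_out j) _)) in eab.
  + by rewrite vE (negbTE (outP2 j ij a aP)) in eab.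
  + by rewrite (negbTE (outP j ij a aP)) in eab.
Qed.

(** The attached path continues to [x], a [j]-th entry, and sees nothing of [Q], which consists of
    entries of later coordinates. *)
Lemma finish_path D lam P (j : 'I_r) x Q l : tuple_system e D -> labelled D lam P ->
  lam j = l -> 0 < l -> indpath e (x :: Q) -> x \in proj j D ->
  (forall q, q \in Q -> exists2 i : 'I_r, j < i & q \in proj i D) ->
  exists2 s, indpath e s & size s = 2 * l + size Q.
Proof.
move=> [indD sepD] H lamj l0 xQ /imsetP[z zD xE] Qproj.
have [sP HP] := H j.
have [s [p sE]] : exists s p, P j = rcons s p.
  case/lastP: (P j) sP => [|s p _]; last by exists s, p.
  by rewrite lamj /=; lia.
have [+ _] := HP z zD; rewrite sE -xE => /indpath_rcons[path_s epx lt_x no_x].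
have after q : q \in Q -> x < q /\ forall a, a \in rcons s p -> ~~ e a q.
  move=> /Qproj[i ji /imsetP[z' z'D ->]]; split; first by rewrite xE sepD.
  by have [_ out] := HP z' z'D; move=> a; rewrite -sE; apply: out.
exists (rcons s p ++ x :: Q); last first.
  by rewrite size_cat -sE sP lamj /=; lia.
apply: indpath_cat => //.
- move=> a b /lt_x lt_ax; rewrite inE => /orP[/eqP-> //|/after[lt_xb _]].
  exact: ltn_trans lt_xb.
- move=> a b aP; rewrite inE => /orP[/eqP->|/after[_ /(_ a aP)/negbTE-> //]] eax.
  split=> //; move: aP eax; rewrite mem_rcons inE => /orP[/eqP-> //|/no_x/negbTE-> //].
Qed.

End Labels.

(** Induction on the deficit [m] of the sum of the labels. Each prolongation raises this sum and
    multiplies the density parameter [d] by a constant, so [B] can be fixed in advance from [m] and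
    [d]. *)
Theorem dense_system_path k r K : 'C(k, 2) < r -> 0 < K ->
  forall m d, exists B, forall n (e : rel 'I_n) (D : {set {ffun 'I_r -> 'I_n}}) lam P,
  0 < n -> linear_edges e B -> locally_dense e K B -> tuple_system e D ->
  n ^ r <= d * #|D| -> labelled e D lam P -> r * k <= \sum_j lam j + m ->
  exists2 s, indpath e s & size s = 2 * k.
Proof.
move=> lt_r K0.
have r0 : 0 < r by apply: leq_trans lt_r.
have long n (e : rel 'I_n) (D : {set {ffun 'I_r -> 'I_n}}) d lam P j : 0 < n ->
    n ^ r <= d * #|D| -> labelled e D lam P -> k <= lam j -> 0 < k ->
    exists2 s, indpath e s & size s = 2 * k.
  move=> n0 leD H le_k k0; have [sP HP] := H j.
  have /card_gt0P[z zD] : 0 < #|D|.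
    by move: leD; case: #|D| => //; rewrite muln0 leqNgt expn_gt0 n0.
  have [pz _] := HP z zD.
  exists (take (2 * k) (rcons (P j) (z j))); first exact: indpath_take.
  by rewrite size_takel // size_rcons sP; lia.
have [-> m d|k0] := posnP k.
  by exists 0 => n e *; exists [::].
elim=> [|m IH] d.
  exists 0 => n e D lam P n0 _ _ _ leD H; rewrite addn0 => le_sum.
  have [/existsP[j le_k]|/existsPn none] := boolP [exists j, k <= lam j].
    exact: long leD H le_k k0.
  move: le_sum; rewrite leqNgt => /negP[].
  apply: leq_trans (_ : \sum_(j < r) (lam j).+1 <= _).
    rewrite [X in _ <= X](eq_bigr (fun j => lam j + 1)) => [|j _]; last by rewrite addn1.
    by rewrite big_split /= sum1_card card_ord -addn1 leq_add2l.
  apply: leq_trans (_ : \sum_(j < r) k <= _); last by rewrite sum_nat_const card_ord.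
  by apply: leq_sum => j _; rewrite ltnNge none.
pose W := K * (2 * r * d).
(* [E] is the sparsity demanded by [sparse_parts_path], with [r] in place of the number of sets;
   [d2] is the density loss at which [sparse_choice] provides it. *)
pose E := 2 * r * W * (4 * r * (8 * W * K)).
pose d2 := 2 * (r * r) * d * E.
have [B1 IH1] := IH (2 * d * W); have [B2 IH2] := IH d2.
exists (B1 + (B2 + (2 * r * d + 2 * (8 * W * K)))) => n e D lam P n0 edges dense sysD leD H le_sum.
have dense1 : locally_dense e K B1 by apply: locally_dense_mono dense; apply: leq_addr.
have dense2 : locally_dense e K B2.
  by apply: locally_dense_mono dense; rewrite addnCA leq_addr.
have edges1 : linear_edges e B1 by apply: linear_edges_mono edges; apply: leq_addr.
have edges2 : linear_edges e B2.
  by apply: linear_edges_mono edges; rewrite addnCA leq_addr.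
have dense3 : locally_dense e K (2 * r * d + 2 * (8 * W * K)).
  by apply: locally_dense_mono dense; rewrite addnA leq_addl.
have edges3 : linear_edges e (2 * r * d + 2 * (8 * W * K)).
  by apply: linear_edges_mono edges; rewrite addnA leq_addl.
have leB := leq_addr (2 * (8 * W * K)) (2 * r * d).
have [/existsP[j le_k]|/existsPn none] := boolP [exists j, k <= lam j].
  exact: long leD H le_k k0.
have [/existsP[j /eqP lamj]|/existsPn pos] := boolP [exists j, lam j == 0].
  have [v leD'] := common_entry dense3 sysD n0 r0 leB leD j.
  apply: (IH1 n e _ _ _ n0 edges1 dense1 _ leD' (start_label j v sysD H)).
    by apply: tuple_system_sub sysD; apply/subsetP => z; rewrite inE => /andP[].
  by have := @sum_relabel r lam j 1; rewrite lamj => /(_ isT); lia.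
(* The condition [lam j <= lam i] makes the new label [(lam i).+1] of [j] a gain. If no such jump is
   rich, any two coordinates of equal label are sparse to each other. *)
have [/existsP[i /existsP[j /existsP[u /existsP[v]]]]|no_jump] :=
    boolP [exists i : 'I_r, exists j : 'I_r, exists u, exists v, [&& i < j, lam j <= lam i,
     u \in proj i D, v \in proj j D & e u v && (n ^ r <= d2 * #|jump e D i j u v|)]].
  move=> /and5P[ij le_lam uP vP /andP[euv leD']].
  have lam_i : 0 < lam i by rewrite lt0n pos.
  apply: (IH2 n e _ _ _ n0 edges2 dense2 _ leD' (jump_label sysD H ij uP vP euv lam_i)).
    by apply: tuple_system_sub sysD; apply/subsetP => z; rewrite inE => /andP[].
  by have := @sum_relabel r lam j (lam i).+1; rewrite ltnS le_lam => /(_ isT); lia.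
have [l /andP[l0 lk] large] : exists2 l, 0 < l < k & k - l < #|[set j | lam j == l]|.
  by apply: large_class => // j; rewrite lt0n pos ltnNge none.
set J := [set j | lam j == l] in large.
have r_pos : 'I_r := Ordinal r0.
pose f a := nth (Ordinal r0) (enum J) a.
have s0 : 0 < #|J| by lia.
have sr : #|J| <= r by rewrite -[X in _ <= X]card_ord max_card.
have fJ a : a < #|J| -> lam (f a) = l.
  move=> aJ; have : f a \in J by rewrite -mem_enum mem_nth // -cardE.
  by rewrite inE => /eqP.
have incr a b : a < b < #|J| -> f a < f b.
  case/andP=> ab bJ.
  have srt : sorted (fun i j : 'I_r => i < j) (enum J).
    rewrite /enum_mem; apply: sorted_filter; first by move=> x y z; apply: ltn_trans.
    by have := iota_ltn_sorted 0 r; rewrite -val_enum_ord sorted_map enumT.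
  by apply: (sorted_ltn_nth _ _ srt) => //; [move=> x y z; apply: ltn_trans|
     rewrite inE -cardE; apply: ltn_trans bJ|rewrite inE -cardE].
have [y yG sparse] : exists2 y, y \in good_tuples e D W & forall a b, a < b < #|J| ->
    E * #|edge_set e (entries e D (f a) y) (entries e D (f b) y)| <= n * n.
  apply: (sparse_choice dense3 sysD n0 r0 leB leD s0 _ incr).
  move=> a b abJ u v uP vP euv.
  apply: leq_trans (_ : d2 * #|jump e D (f a) (f b) u v| <= _).
    by rewrite /d2 !leq_mul.
  rewrite leqNgt; apply: contra no_jump => lt_n.
  apply/existsP; exists (f a); apply/existsP; exists (f b).
  apply/existsP; exists u; apply/existsP; exists v.
  rewrite uP vP euv incr //= (ltnW lt_n) andbT.
  by case/andP: abJ => ab bJ; rewrite !fJ // (ltn_trans ab).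
have inP a v : v \in entries e D (f a) y -> v \in proj (f a) D by rewrite inE => /andP[].
have [||| x [Q [pQ x0 sQ Qin]]] := @sparse_parts_path n e K _ edges3 dense3 #|J| W
  (fun a => entries e D (f a) y) n0 K0 s0 (leq_addl _ _).
- move=> a b abJ u v /inP/imsetP[z1 z1D ->] /inP/imsetP[z2 z2D ->].
  by apply: sysD.2 => //; apply: incr.
- by move=> a _; move: yG; rewrite inE => /andP[_ /forallP].
- move=> a b abJ; apply: leq_trans (sparse a b abJ).
  by rewrite leq_mul2r /E; apply/orP; right; rewrite !leq_mul.
have [q qQ|p pp sp] := finish_path sysD H (fJ 0 s0) l0 pQ (inP _ _ x0).
  have [b bJ qb] := Qin q qQ; exists (f b); last exact: inP.
  by apply: incr; case/andP: bJ => -> ->.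
(* The path has [2 * l + 2 * (#|J| - 1)] vertices, and [#|J| > k - l]. *)
exists (take (2 * k) p); first exact: indpath_take.
by rewrite size_takel // sp sQ; move: large l0 lk; clear; lia.
Qed.

(** * Making the coordinates of a dense set of tuples successive *)

Lemma card_window n (S : {set 'I_n}) a m :
  (forall v, v \in S -> a <= v < a + m) -> #|S| <= m.
Proof.
move=> SP; rewrite cardE -(size_map val) -(size_iota a m).
apply: uniq_leq_size; first by rewrite (map_inj_uniq val_inj) enum_uniq.
by move=> x /mapP[v]; rewrite mem_enum => vS ->; rewrite mem_iota SP.
Qed.

Lemma card_bucket n N c : 0 < N <= n -> N * #|[set v : 'I_n | v * N %/ n == c]| <= 2 * n.
Proof.
case/andP=> N0 Nn; have n0 := leq_trans N0 Nn.
have : #|[set v : 'I_n | v * N %/ n == c]| <= n %/ N + 1.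
  (* The window starts at the ceiling of [c * n / N]. *)
  apply: (@card_window _ _ (c * n %/ N + (c * n %% N != 0))) => v.
  rewrite inE => /eqP vc.
  have h1 : c * n <= v * N by rewrite -vc leq_divM.
  have h2 : v * N < c.+1 * n by rewrite -ltn_divLR // vc.
  have e1 := divn_eq (c * n) N; have e2 := divn_eq n N.
  have l1 := ltn_pmod (c * n) N0; have l2 := ltn_pmod n N0.
  have {}h1 : c * n %/ N * N + c * n %% N <= v * N by rewrite -e1.
  have {}h2 : v * N < (n %/ N * N + n %% N) + (c * n %/ N * N + c * n %% N).
    by rewrite -e1 -e2 -mulSn.
  move: h1 h2 l1 l2; move: (c * n %/ N) (c * n %% N) (n %/ N) (n %% N) => q x w y {e1 e2 vc}.
  case: eqP => [->|/eqP x0] /= h1 h2 l1 l2; apply/andP; split;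
    apply: contraT; rewrite -?leqNgt -?ltnNge => hv;
    have := leq_mul hv (leqnn N); move: h1 h2 l1 l2; rewrite ?mulSn ?mulnDl ?mul1n ?mul0n;
    move: (v * N) (q * N) (w * N) => vN qN wN; lia.
rewrite -(leq_pmul2l N0) => /leq_trans; apply.
rewrite mulnDr muln1 mulnC mul2n -addnn leq_add // leq_divM //.
Qed.

(** Cut the vertex set into [N] intervals. For each pair of coordinates at most [#|D| / (2 * r * r)]
    tuples have both entries in one interval, so half of the tuples meet distinct intervals; the
    most frequent of the [N ^ r] patterns gives the system. *)
Lemma separate_tuples r d : 0 < r -> 0 < d -> exists N d', 0 < N /\
  forall n (e : rel 'I_n) (D : {set {ffun 'I_r -> 'I_n}}), N <= n ->
  (forall z (i j : 'I_r), z \in D -> i < j -> (z i < z j) && ~~ e (z i) (z j)) ->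
  n ^ r <= d * #|D| ->
  exists2 D' : {set {ffun 'I_r -> 'I_n}}, tuple_system e D' & n ^ r <= d' * #|D'|.
Proof.
move=> r0 d0; pose N := 4 * (r * r) * d.
have N0 : 0 < N by rewrite !muln_gt0 r0 d0.
exists N, (d * (2 * N ^ r)); split=> // n e D Nn incr leD.
have n0 := leq_trans N0 Nn.
have lt_bucket (v : 'I_n) : v * N %/ n < N by rewrite ltn_divLR // mulnC ltn_pmul2l.
pose bucket v : 'I_N := Ordinal (lt_bucket v).
have bucket_le (u v : 'I_n) : u <= v -> bucket u <= bucket v.
  by move=> uv; rewrite /= leq_div2r // leq_mul2r uv orbT.
pose bad (i j : 'I_r) := [set z in D | bucket (z i) == bucket (z j)].
have few_bad (i j : 'I_r) : i < j -> 2 * (r * r) * #|bad i j| <= #|D|.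
  move=> ij; have : n * (N * #|bad i j|) <= n ^ r * (2 * n).
    rewrite mulnCA -{1}[n]card_ord -(sum_fibres j) big_distrr /=.
    apply: leq_trans (_ : \sum_(y : {ffun 'I_r -> 'I_n}) 2 * n <= _); last first.
      by rewrite sum_nat_const card_ffun !card_ord.
    apply: leq_sum => y _; apply: leq_trans (card_bucket (bucket (y i)) (n := n) (N := N) _);
      last by rewrite N0.
    rewrite leq_mul2l; apply/orP; right; apply: subset_leq_card; apply/subsetP => v.
    have ne_ij : (i == j) = false by apply: ltn_eqF.
    by rewrite !inE !updE eqxx ne_ij => /andP[_]; rewrite eq_sym.
  rewrite [2 * n]mulnC [n ^ r * _]mulnCA leq_pmul2l // => le1.
  have := leq_trans le1 (leq_mul leD (leqnn 2)).
  rewrite (_ : N * _ = 2 * d * (2 * (r * r) * #|bad i j|)); last by rewrite /N; ring.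
  by rewrite (_ : d * _ * 2 = 2 * d * #|D|); [rewrite leq_pmul2l // muln_gt0|ring].
pose good := [set z in D | [forall i : 'I_r, forall j : 'I_r, (i < j) ==> (bucket (z i) < bucket (z j))]].
have half : #|D| <= 2 * #|good|.
  have cov : D \subset good :|: \bigcup_(i < r) \bigcup_(j < r | i < j) bad i j.
    apply/subsetP => z zD; apply/setUP.
    have [h|/forallPn[i /forallPn[j]]] := boolP [forall i : 'I_r, forall j : 'I_r,
        (i < j) ==> (bucket (z i) < bucket (z j))]; first by left; rewrite in_set zD.
    rewrite negb_imply -leqNgt => /andP[ij le_b].
    right; apply/bigcupP; exists i => //; apply/bigcupP; exists j => //.
    rewrite in_set zD -val_eqE /= eqn_leq [X in _ && X]le_b andbT.
    by apply: bucket_le; have /andP[/ltnW] := incr z i j zD ij.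
  have le1 : 2 * (r * r) * #|\bigcup_(i < r) \bigcup_(j < r | i < j) bad i j| <= (r * r) * #|D|.
    apply: leq_trans (_ : 2 * (r * r) * (\sum_(i < r) \sum_(j < r | i < j) #|bad i j|) <= _).
      rewrite leq_mul2l; apply/orP; right.
      elim/big_rec2: _ => [|i x A _ le_xy]; first by rewrite cards0.
      apply: leq_trans (leq_card_setU _ _) _; apply: leq_add => //.
      elim/big_rec2: _ => [|j x' A' _ le_xy']; first by rewrite cards0.
      by apply: leq_trans (leq_card_setU _ _) _; rewrite leq_add2l.
    rewrite big_distrr /=; apply: leq_trans (_ : \sum_(i < r) r * #|D| <= _).
      apply: leq_sum => i _; rewrite big_distrr /=.
      apply: leq_trans (_ : \sum_(j < r | i < j) #|D| <= _).
        by apply: leq_sum => j; apply: few_bad.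
      by rewrite sum_nat_const leq_mul2r (leq_trans (max_card _)) ?card_ord ?orbT.
    by rewrite sum_nat_const card_ord mulnA.
  have le2 : 2 * #|\bigcup_(i < r) \bigcup_(j < r | i < j) bad i j| <= #|D|.
    by move: le1; rewrite -mulnA mulnCA leq_pmul2l // muln_gt0 r0.
  have := leq_trans (subset_leq_card cov) (leq_card_setU _ _).
  by move: le2; clear; lia.
pose cls (c : {ffun 'I_r -> 'I_N}) := [set z in good | [ffun i => bucket (z i)] == c].
have [||c _ le_c] := @exists_big_term _ xpredT (fun c => N ^ r * #|cls c|) #|good|.
- by rewrite card_ffun !card_ord expn_gt0 N0.
- rewrite sum_nat_const card_ffun !card_ord -big_distrr leq_mul2l; apply/orP; right.
  rewrite -[#|good|]sum1_card (partition_big (fun z : {ffun 'I_r -> 'I_n} => [ffun i : 'I_r => bucket (z i)]) xpredT) //=.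
  by apply: leq_sum => c _; rewrite -sum1dep_card.
exists (cls c); last first.
  apply: leq_trans leD _; rewrite -mulnA leq_mul2l; apply/orP; right.
  by apply: leq_trans half _; rewrite -mulnA leq_mul2l le_c.
have clsP z : z \in cls c -> [/\ z \in D, z \in good & forall i, bucket (z i) = c i].
  rewrite in_set => /andP[zg /eqP <-]; split=> //; last by move=> i; rewrite ffunE.
  by move: zg; rewrite in_set => /andP[].
split=> [z i j /clsP[zD _ _] ij|z z' i j /clsP[_ zg zc] /clsP[_ _ zc'] ij].
  by have /andP[] := incr z i j zD ij.
rewrite ltnNge; apply/negP => /bucket_le.
rewrite zc' -zc leqNgt => /negP[].
by move: zg; rewrite in_set => /andP[_ /forallP/(_ i)/forallP/(_ j)/implyP]; apply.
Qed.

Theorem clique_tuples_path k r d : 'C(k, 2) < r -> 0 < k -> 0 < d -> exists B N,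
  forall n (e : rel 'I_n) (D : {set {ffun 'I_r -> 'I_n}}), N <= n ->
  linear_edges e B -> locally_dense e (8 * k) B ->
  (forall z (i j : 'I_r), z \in D -> i < j -> (z i < z j) && ~~ e (z i) (z j)) ->
  n ^ r <= d * #|D| -> exists2 s, indpath e s & size s = 2 * k.
Proof.
move=> lt_r k0 d0.
have [N [d' [N0 sep]]] := separate_tuples (leq_ltn_trans (leq0n _) lt_r) d0.
have [|B HB] := @dense_system_path k r (8 * k) lt_r _ (r * k) d'; first by rewrite muln_gt0.
exists B, N => n e D Nn edges dense incr leD.
have [D' sysD' leD'] := sep n e D Nn incr leD.
(* At the start all labels are 0 and all attached paths are empty, so the deficit is [r * k]. *)
apply: (HB n e D' (fun=> 0) (fun=> [::])) => //; first exact: leq_trans Nn.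
by rewrite leq_addl.
Qed.

(** * Rows of an induced path *)

Section RowCount.
Variables (a b L : nat) (part : nat -> nat).
Local Notation row s := (part s %/ b).
Hypotheses (b2 : 2 <= b) (L_ge : 2 * (a + b) <= L.+1).
Hypothesis part_lt : forall s, s < L -> part s < a * b.
Hypothesis part_mono : forall s t, s <= t < L -> part s <= part t.
(** Parts will be cliques, whereas these two vertices are nonadjacent on an induced path. *)
Hypothesis part_two : forall s, s.+2 < L -> part s != part s.+2.

Definition row_jump s := (row s == row s.+1) && (part s != part s.+1).

(** The gap [s.+3 <= t] means that the path has no edge between the two jumping pairs. *)
Hypothesis one_jump_row : forall s t, row_jump s -> row_jump t -> row s < row t ->
  s.+3 <= t -> t.+1 < L -> False.

Definition row_card i := #|[set s : 'I_L | row s == i]|.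

Lemma part_steps s m : s + 2 * m < L -> part s + m <= part (s + 2 * m).
Proof.
elim: m => [|m IH] lt_L; first by rewrite muln0 !addn0.
have e : s + 2 * m.+1 = (s + 2 * m).+2 by rewrite mulnS; lia.
rewrite e in lt_L *; have := IH (ltnW (ltnW lt_L)).
have := part_two lt_L; have : part (s + 2 * m) <= part (s + 2 * m).+2.
  by apply: part_mono; rewrite lt_L; lia.
by move: (part _) (part _) (part _); lia.
Qed.

(** By monotonicity a row occupies an interval of the path, and two steps always increase the part,
    whence the bound [2 * b]. *)
Lemma row_span i : 3 <= row_card i -> exists x z,
  [/\ x.+2 <= z, z < L, row_card i <= (z - x).+1, row_card i <= 2 * b &
   forall s, x <= s <= z -> row s = i].
Proof.
move=> card3; have /card_gt0P[s0 s0P] : 0 < row_card i by apply: leq_trans card3.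
case: (arg_minnP (fun s : 'I_L => val s) s0P) => x xP xmin.
case: (arg_maxnP (fun s : 'I_L => val s) s0P) => z zP zmax.
have rx : row x = i by have : x \in [set s : 'I_L | row s == i] by []; rewrite inE => /eqP.
have rz : row z = i by have : z \in [set s : 'I_L | row s == i] by []; rewrite inE => /eqP.
have xz : x <= z by apply: zmax.
have card_le : row_card i <= (z - x).+1.
  apply: (@card_window _ _ x) => s sP; rewrite (xmin s sP) /=.
  by have := zmax s sP => /= h; lia.
have span s : x <= s <= z -> row s = i.
  case/andP=> xs sz; apply/eqP; rewrite eqn_leq; apply/andP; split.
    by rewrite -rz leq_div2r // part_mono // sz ltn_ord.
  by rewrite -rx leq_div2r // part_mono // xs (leq_ltn_trans sz).
exists x, z; split => //; first by lia.
apply: leq_trans card_le _; pose h := (z - x)./2.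
have zx : z - x = odd (z - x) + 2 * h by rewrite mul2n -[LHS]odd_double_half.
have le_z : x + 2 * h <= z by lia.
have := @part_steps x h (leq_ltn_trans le_z (ltn_ord z)).
have p1 : i * b <= part x by rewrite -rx leq_divM.
have p2 : part (x + 2 * h) < i.+1 * b.
  rewrite -ltn_divLR; last by lia.
  by rewrite span // le_z leq_addr.
rewrite [i.+1 * b]mulSn in p2 => p3.
have h_lt : h < b by move: p1 p2 p3; move: (i * b) (part x) (part (x + 2 * h)) => A C D; clear; lia.
by case: (odd (z - x)) zx => /=; lia.
Qed.

Lemma first_jump x : x.+2 < L -> row x = row x.+2 -> exists2 h, x <= h <= x.+1 & row_jump h.
Proof.
move=> x2 rx.
have m1 : part x <= part x.+1 by apply: part_mono; rewrite leqnSn ltnW.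
have m2 : part x.+1 <= part x.+2 by apply: part_mono; rewrite leqnSn.
have r1 : row x = row x.+1.
  by apply/eqP; rewrite eqn_leq leq_div2r //= rx leq_div2r.
have [e|ne] := eqVneq (part x) (part x.+1).
  exists x.+1; first by rewrite leqnSn leqnn.
  rewrite /row_jump -rx -r1 eqxx /= -e; exact: part_two.
by exists x; rewrite ?leqnn ?leqnSn // /row_jump r1 eqxx.
Qed.

(** Each row has a jump among its first and among its last three vertices. The first jump of row [i]
    and the last jump of row [j] must be less than three apart, which leaves just three vertices per
    row, the two rows being consecutive. *)
Lemma two_rows i j x z x' z' : i < j ->
  x.+2 <= z -> z < L -> x'.+2 <= z' -> z' < L ->
  (forall s, x <= s <= z -> row s = i) -> (forall s, x' <= s <= z' -> row s = j) ->
  [/\ z = x.+2, x' = x + 3 & z' = x + 5].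
Proof.
move=> ij xz zL xz' z'L spi spj.
have rx' : row x' = j by apply: spj; rewrite leqnn; lia.
have zx' : z < x'.
  rewrite ltnNge; apply/negP => le_x'; have [le_xx'|lt_x'x] := leqP x x'.
    by have := spi x'; rewrite le_xx' le_x' rx' => /(_ isT) e; rewrite e ltnn in ij.
  have : row x' <= row x by rewrite leq_div2r // part_mono // (ltnW lt_x'x); lia.
  have -> : row x = i by apply: spi; rewrite leqnn; lia.
  by rewrite rx' leqNgt ij.
have [h /andP[h1 h2] jh] : exists2 h, x <= h <= x.+1 & row_jump h.
  by apply: first_jump; [lia|rewrite [LHS]spi ?[RHS]spi //; lia].
have [y ey] : exists y, z' = y.+2 by exists (z' - 2); lia.
rewrite ey in xz' z'L spj *; rewrite !ltnS in xz'.
have [h' /andP[h3 h4] jh'] : exists2 h, y <= h <= y.+1 & row_jump h.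
  by apply: first_jump; [lia|rewrite [LHS]spj ?[RHS]spj //; lia].
have [le3|lt3] := leqP h.+3 h'; last by split; lia.
by case: (one_jump_row jh jh') => //; [rewrite [row h]spi ?[row h']spj //|]; lia.
Qed.

Lemma rows_too_long : False.
Proof.
have total : \sum_(i < a) row_card i = L.
  rewrite -[RHS]card_ord -sum1_card.
  have lt_row (s : 'I_L) : row s < a by rewrite ltn_divLR ?part_lt //; lia.
  rewrite (partition_big (fun s => Ordinal (lt_row s)) xpredT) //=.
  by apply: eq_bigr => i _; rewrite sum1dep_card /row_card; apply: eq_card => s; rewrite !inE.
pose H := [set i : 'I_a | 3 <= row_card i].
have le_total : L <= 2 * a + \sum_(i in H) (row_card i - 2).
  rewrite -total; apply: leq_trans (_ : \sum_(i < a) (2 + (row_card i - 2)) <= _).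
    by apply: leq_sum => i _; lia.
  rewrite big_split /= sum_nat_const card_ord mulnC leq_add2l.
  rewrite [X in X <= _](bigID (mem H)) /= [X in _ + X]big1 ?addn0 // => i.
  by rewrite inE -ltnNge; lia.
have bound i : i \in H -> row_card i <= 2 * b.
  by rewrite inE => /row_span[x [z []]].
have pair i j : i \in H -> j \in H -> i < j -> row_card i = 3 /\ row_card j = 3.
  rewrite !inE => ci cj ij; move: (ci) (cj).
  move=> /row_span[x [z [xz zL le1 _ spi]]] /row_span[x' [z' [xz' z'L le2 _ spj]]].
  have [e1 e2 e3] := two_rows ij xz zL xz' z'L spi spj.
  by split; lia.
(* With at most one row of three or more vertices, the path has at most [2 * a + (2 * b - 2)]
   vertices, one too few. *)
have [le1|gt1] := leqP #|H| 1.
  have : \sum_(i in H) (row_card i - 2) <= \sum_(i in H) (2 * b - 2).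
    by apply: leq_sum => i /bound; lia.
  by rewrite sum_nat_const; nia.
have three i : i \in H -> row_card i = 3.
  move=> iH; have /card_gt0P[j] : 0 < #|H :\ i| by rewrite (cardsD1 i) iH in gt1; lia.
  rewrite in_setD1 => /andP[ji jH]; case: (ltngtP i j) => [ij|ij|/val_inj ij].
  - by have [] := pair i j iH jH ij.
  - by have [] := pair j i jH iH ij.
  - by rewrite ij eqxx in ji.
(* With three such rows, [two_rows] would put the same vertex [x + 5] at the end of two of them.
   With two, both have three vertices, and [2 * a + 2] is too small because [b >= 2]. *)
have le2 : #|H| <= 2.
  rewrite leqNgt; apply/negP => gt2.
  have /card_gt0P[i1 i1H] : 0 < #|H| by lia.
  case: (arg_minnP (fun i : 'I_a => val i) i1H) => i iH0 imin; have iH : i \in H by [].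
  case: (arg_maxnP (fun i : 'I_a => val i) i1H) => j jH0 jmax; have jH : j \in H by [].
  have /card_gt0P[l] : 0 < #|H :\ i :\ j|.
    have := cardsD1 i H; have := cardsD1 j (H :\ i); rewrite iH => e1 e2.
    move: gt2 e1 e2; case: (j \in _); move: #|H :\ i :\ j| #|H :\ i| #|H| => p q s; clear; lia.
  rewrite in_setD1 in_setD1 => /and3P[lj li lH].
  have il : i < l by rewrite ltn_neqAle imin // andbT eq_sym.
  have lj' : l < j by rewrite ltn_neqAle lj; have := jmax l lH.
  have iH' : 3 <= row_card i by move: iH; rewrite inE.
  have jH' : 3 <= row_card j by move: jH; rewrite inE.
  have lH' : 3 <= row_card l by move: lH; rewrite inE.
  have [x [z [xz zL _ _ spi]]] := row_span iH'.
  have [x' [z' [xz' z'L _ _ spl]]] := row_span lH'.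
  have [x2 [z2 [xz2 z2L _ _ spj]]] := row_span jH'.
  have [_ _ e1] := two_rows il xz zL xz' z'L spi spl.
  have [_ _ e2] := two_rows (ltn_trans il lj') xz zL xz2 z2L spi spj.
  have rl : row z' = l by apply: spl; rewrite leqnn; lia.
  have rj : row z2 = j by apply: spj; rewrite leqnn; lia.
  by rewrite e1 -e2 rj in rl; rewrite rl ltnn in lj'.
have : \sum_(i in H) (row_card i - 2) <= \sum_(i in H) 1.
  by apply: leq_sum => i /three ->.
rewrite sum1_card; lia.
Qed.

End RowCount.

From mathcomp Require Import all_order lra.
From mathcomp Require Import all_classical all_reals all_analysis.
Import Order.TTheory GRing.Theory Num.Theory.
Import numFieldNormedType.Exports.

(** * The upper bound *)

Lemma indpath_monotone n (G : ograph n) s :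
  indpath G s -> has_induced_monotone_path (size s) G.
Proof.
move=> ps; case: s ps => [_|x0 s ps].
  have v : 'I_0 -> 'I_n by case.
  by exists v; split; case.
set s' := x0 :: s in ps *.
exists (fun i => nth x0 s' i); split=> [i j ij|].
  by have := indpath_nth x0 ps (i := i) (j := j); rewrite ij ltn_ord => /(_ isT)/andP[].
suff H (i j : 'I_(size s')) : i < j ->
    G (nth x0 s' i) (nth x0 s' j) = ((i.+1 == j :> nat) || (j.+1 == i :> nat)).
  move=> i j; case: (ltngtP i j) => [/H//|ji|/val_inj->].
    by rewrite edge_sym H // orbC.
  by rewrite edge_irr; apply/esym/negbTE; rewrite orbb neq_ltn ltnSn orbT.
move=> ij; have := indpath_nth x0 ps (i := i) (j := j).
rewrite ij ltn_ord => /(_ isT)/andP[_ /eqP->].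
by rewrite eq_sym [j.+1 == i](gtn_eqF _) ?orbF // ltnS ltnW.
Qed.

Lemma no_biclique_edge n (G : ograph n) t : ~ has_biclique t (compl G) ->
  forall A B : {set 'I_n}, before A B -> t <= #|A| -> t <= #|B| -> edge_between G A B.
Proof.
move=> no A B ltAB leA leB.
have [/existsP[x /existsP[y /and3P[xA yB Gxy]]]|/existsPn none] :=
    boolP [exists x, exists y, [&& x \in A, y \in B & G x y]]; first by exists x, y.
case: no; have [A' [A'A cA' _]] := top_set leA; have [B' [B'B cB' _]] := top_set leB.
have lt' x y : x \in A' -> y \in B' -> x < y.
  by move=> /(fintype.subsetP A'A) xA /(fintype.subsetP B'B); apply: ltAB.
exists A', B'; split=> // [|x y xA yB].
  by apply/pred0P => x /=; apply/negP => /andP[xA xB]; have := lt' x x xA xB; rewrite ltnn.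
rewrite /= /compl_edge; apply/andP; split.
  by rewrite neq_ltn lt'.
apply/negP => Gxy; have /existsPn/(_ y)/negP[] := none x.
by rewrite Gxy (fintype.subsetP A'A) // (fintype.subsetP B'B).
Qed.

Definition clique_fun r n (G : ograph n) : {set {ffun 'I_r -> 'I_n}} :=
  [set z : {ffun 'I_r -> 'I_n} | [forall i : 'I_r, forall j : 'I_r, (i < j) ==> (z i < z j) && ~~ G (z i) (z j)]].

Definition cliques r n (G : ograph n) : {set {set 'I_n}} :=
  [set A : {set 'I_n} | (#|A| == r) && is_clique G A].

Lemma card_cliques_le r n (G : ograph n) : #|cliques r (compl G)| <= #|clique_fun r G|.
Proof.
apply: leq_trans (leq_imset_card (fun z : {ffun 'I_r -> 'I_n} => [set z i | i : 'I_r]%SET) _).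
apply: subset_leq_card; apply/fintype.subsetP => A; rewrite inE => /andP[/eqP cA cl].
have [r0|r0] := posnP r.
  rewrite r0 in cA *; apply/imsetP; have v : 'I_0 -> 'I_n by case.
    exists [ffun i => v i]; first by rewrite inE; apply/forallP; case.
  have /eqP := cA; rewrite cards_eq0 => /eqP->; apply/setP => x; rewrite inE.
  by apply/esym/negbTE/negP => /imsetP[[]].
have /card_gt0P[x0 _] : 0 < #|A| by rewrite cA.
have srt : sorted (fun i j : 'I_n => i < j) (enum A).
  rewrite /enum_mem; apply: sorted_filter; first by move=> x y z; apply: ltn_trans.
  by have := iota_ltn_sorted 0 n; rewrite -val_enum_ord sorted_map enumT.
have sA : size (enum A) = r by rewrite -cardE.
have zA (i : 'I_r) : nth x0 (enum A) i \in A by rewrite -mem_enum mem_nth // sA.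
apply/imsetP; exists [ffun i : 'I_r => nth x0 (enum A) i].
  rewrite inE; apply/forallP => i; apply/forallP => j; apply/implyP => ij; rewrite !ffunE.
  have lt_z : nth x0 (enum A) i < nth x0 (enum A) j.
    apply: (sorted_ltn_nth _ _ srt) => //; first by move=> x y z; apply: ltn_trans.
      by rewrite inE sA.
    by rewrite inE sA.
  rewrite lt_z /=; have /forall_inP/(_ _ (zA i))/forall_inP/(_ _ (zA j)) := cl.
  by rewrite neq_ltn lt_z /= /compl_edge => /andP[].
apply/setP => x; apply/idP/imsetP => [xA|[i _ ->]]; last by rewrite ffunE.
have xi : index x (enum A) < r by rewrite -sA index_mem mem_enum.
by exists (Ordinal xi); rewrite // ffunE nth_index // mem_enum.
Qed.

Lemma ffact_lower n r : 2 * r <= n -> n ^ r <= 2 ^ r * n ^_ r.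
Proof.
move=> le_r; rewrite ffact_prod -{2}[r]card_ord -prod_nat_const -big_split /=.
rewrite -[X in _ ^ X]card_ord -prod_nat_const.
by apply: leq_prod => i _; have := ltn_ord i; lia.
Qed.

Local Open Scope ring_scope.

Lemma density_tuples (R : realType) (r : nat) (eps : R) : 0 < eps -> exists2 d : nat,
  (0 < d)%N & forall n (G : ograph n), (2 * r <= n)%N -> eps < clique_density R r (compl G) ->
  (n ^ r <= d * #|clique_fun r G|)%N.
Proof.
move=> eps0; pose q := (Num.truncn eps^-1).+1.
(* Here [2 ^ r] compares [n ^ r] with the falling factorial, [r!] passes to the binomial
   coefficient, and [q] exceeds [1 / eps]. *)
exists (2 ^ r * r`! * q)%N; first by rewrite !muln_gt0 expn_gt0 fact_gt0.
move=> n G le_r; rewrite /clique_density -/(cliques r (compl G)) => dens.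
apply: leq_trans (_ : 2 ^ r * (n ^_ r) <= _)%N; first exact: ffact_lower.
rewrite -bin_ffact mulnA mulnAC -!mulnA !leq_mul2l; do 2!(apply/orP; right).
have c0 : 0 < 'C(n, r)%:R :> R by rewrite ltr0n bin_gt0; lia.
rewrite ltr_pdivlMr // in dens.
have le1 : #|cliques r (compl G)|%:R <= #|clique_fun r G|%:R :> R.
  by rewrite ler_nat card_cliques_le.
have q1 : 1 <= eps * q%:R.
  have h : eps^-1 < q%:R by apply: truncnS_gt.
  rewrite -[X in X <= _](mulfV (lt0r_neq0 eps0)) ler_pM2l //.
  by apply: Order.POrderTheory.ltW.
have : ('C(n, r)%:R : R) <= (q * #|clique_fun r G|)%:R.
  rewrite natrM; have q0 : (0 : R) <= q%:R by [].
  apply: le_trans (_ : q%:R * (eps * 'C(n, r)%:R) <= _); last first.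
    by rewrite ler_wpM2l // ltW // (lt_le_trans dens).
  by rewrite mulrA [q%:R * _]mulrC ler_peMl // ltW.
by rewrite ler_nat.
Qed.

Theorem upper_forces (R : realType) (k r : nat) : (0 < k)%N -> ('C(k, 2) < r)%N ->
  forces_biclique R k r.
Proof.
move=> k0 lt_r eps eps0.
have [d d0 Hd] := density_tuples r eps0.
have [B [N HBN]] := clique_tuples_path lt_r k0 d0.
(* The first summand yields [th] below; the second makes [n] at least [N] and [2 * r]. *)
pose M := (36 * k * B.+1 + (N + 2 * r)).+1.
have ln2 : 0 < ln 2 :> R by rewrite ln_gt0 // ltr1n.
exists (ln 2 / M%:R); first by rewrite divr_gt0.
move=> n G n2 no_path dens; rewrite /has_biclique_real.
set x := _ / ln n%:R; set t := Num.truncn x.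
apply: contrapT => no_bic.
have lnn : ln 2 <= ln n%:R :> R by rewrite ler_ln ?posrE ?ltr0n ?ler_nat //; lia.
have lnn0 : 0 < ln n%:R :> R by apply: lt_le_trans lnn.
have x0 : 0 <= x by rewrite /x !mulr_ge0 ?invr_ge0 // ltW.
have t0 : (0 < t)%N.
  rewrite lt0n; apply/eqP => t0; apply: no_bic; rewrite t0.
  exists finset.set0, finset.set0; split=> [|||y z]; rewrite ?cards0 ?inE //.
  by apply/pred0P => y; rewrite /= inE.
have tx : t%:R * (M%:R * ln n%:R) <= ln 2 * n%:R :> R.
  have : t%:R <= x by rewrite truncn_le.
  rewrite /x ler_pdivlMr // => h.
  have M0 : 0 < M%:R :> R by rewrite ltr0n.
  by rewrite mulrCA mulrC -ler_pdivlMr // [X in _ <= X]mulrAC.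
have nM : (M <= n)%N.
  rewrite -(ler_nat R) -(ler_pM2l ln2); apply: le_trans tx.
  apply: le_trans (_ : 1 * (M%:R * ln n%:R) <= _); last first.
    by apply: ler_wpM2r; [rewrite mulr_ge0 // ltW | rewrite ler1n].
  by rewrite mul1r mulrC ler_wpM2l.
have Nn : (N <= n)%N by lia.
have rn : (2 * r <= n)%N by lia.
(* The number of halvings; [h * ln 2 <= 2 * ln n] is the source of the logarithm in the size of the
   biclique. *)
pose h := (trunc_log 2 n).+1.
have le_h : (n <= 2 ^ h)%N by rewrite ltnW // trunc_log_ltn.
have h_ln : h%:R * ln 2 <= 2 * ln n%:R :> R.
  rewrite /h -addn1 natrD mulrDl mul1r [2 * _]mulrDl mul1r lerD //.
  rewrite mulr_natl -lnXn // -natrX ler_ln ?posrE ?ltr0n ?expn_gt0 //; last by lia.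
  by rewrite ler_nat trunc_logP //; lia.
have th : (18 * k * B.+1 * (t * h) <= n)%N.
  have : (M * (t * h) <= 2 * n)%N.
    rewrite -(ler_nat R) -(ler_pM2l ln2) !natrM.
    apply: le_trans (_ : t%:R * M%:R * (2 * ln n%:R) <= _).
      rewrite (_ : ln 2 * _ = t%:R * M%:R * (h%:R * ln 2)); last by ring.
      by rewrite ler_wpM2l.
    by rewrite (_ : _ * (2 * ln _) = 2 * (t%:R * (M%:R * ln n%:R))); [rewrite [X in _ <= X]mulrCA ler_wpM2l|ring].
  have : (36 * k * B.+1 * (t * h) <= M * (t * h))%N by rewrite leq_mul2r; apply/orP; right; rewrite /M; lia.
  move=> /leq_trans h1 /h1; rewrite (_ : 36 * _ * _ * _ = 2 * (18 * k * B.+1 * (t * h)))%N; last by ring.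
  by rewrite leq_pmul2l.
have edges := no_biclique_edge no_bic.
have Bt : (B * t <= n)%N.
  apply: leq_trans th; rewrite (_ : 18 * k * B.+1 * (t * h) = (18 * k * h) * (B.+1 * t))%N; last by ring.
  by apply: leq_trans (leq_pmull _ _); rewrite ?leq_mul2r ?leqnSn ?orbT // !muln_gt0 k0.
have lin : linear_edges G B.
  have [-> A C ltAC|B0] := posnP B; first by rewrite mul0n leqn0; lia.
  move=> A C ltAC leA leC; apply: edges => //.
    by rewrite -(leq_pmul2l B0); apply: leq_trans leA.
  by rewrite -(leq_pmul2l B0); apply: leq_trans leC.
(* Otherwise all backward degrees in [U] are below [#|U| / (8 * k)], and [sparse_path] yields
   [2 * k] vertices: degrees cost at most [#|U| / 4], and the terms with [t] at most
   [13 * k * t * h <= 13 / 18 * #|U|]. *)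
have dense : locally_dense G (8 * k) B.
  move=> U leU; apply/exists_inP; rewrite -[X in is_true X]negbK; apply/negP => /exists_inPn none.
  apply: no_path.
  have [u uU||s ps <-] := @sparse_path n G t edges (2 * k) h (#|U| %/ (8 * k)) U t0 le_h _ _.
  - by rewrite leq_divRL ?muln_gt0 ?k0 // mulnC ltnW // ltnNge none.
  - have le1 : (8 * k * (#|U| %/ (8 * k)) <= #|U|)%N by rewrite mulnC leq_divM.
    have le2 : (18 * k * (t * h) * B <= #|U| * B)%N.
      rewrite [X in (_ <= X)%N]mulnC; apply: leq_trans leU; apply: leq_trans th.
      rewrite (_ : 18 * k * B.+1 * (t * h) = 18 * k * (t * h) * B.+1)%N; last by ring.
      by rewrite leq_mul2l leqnSn orbT.
    have B0 : (0 < B)%N by rewrite lt0n; apply/eqP => B0; move: leU; rewrite B0 mul0n leqn0; lia.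
    rewrite leq_pmul2r // in le2.
    have h0 : (0 < h)%N by [].
    have kth : (t <= k * (t * h))%N by rewrite mulnCA leq_pmulr // muln_gt0 k0.
    have kt : (k * t <= k * (t * h))%N by rewrite leq_mul2l leq_pmulr // orbT.
    move: le1 le2 kth kt; move: (#|U| %/ (8 * k))%N => q; move: #|U| => u; clear.
    rewrite (_ : 3 * t + 2 * k * (3 * t * h + 2 * t + q) =
       3 * t + 6 * (k * (t * h)) + 4 * (k * t) + 2 * (k * q))%N; last by ring.
    rewrite -!mulnA; move: (k * (t * h))%N (k * t)%N (k * q)%N => a b c; lia.
  - exact: indpath_monotone.
apply: no_path; have [z i j|s ps <-] := HBN n G (clique_fun r G) Nn lin dense _ (Hd n G rn dens).
  by rewrite inE => /forallP/(_ i)/forallP/(_ j)/implyP; apply.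
exact: indpath_monotone.
Qed.

(** * Concentration on the grid *)

Section Transport.
Variable R : realType.

(** With [s = sqrt a], the inequality [ln s >= 1 - 1 / s] gives [a * ln a >= 2 * s ^ 2 - 2 * s]. *)
Lemma entropy_hellinger (a : R) : 0 <= a -> (Num.sqrt a - 1) ^+ 2 <= a * ln a - a + 1.
Proof.
rewrite le_eqVlt => /orP[/eqP<-|a0]; first by rewrite sqrtr0 mul0r; lra.
have s0 : 0 < Num.sqrt a by rewrite sqrtr_gt0.
have aE : a = Num.sqrt a ^+ 2 by rewrite sqr_sqrtr // ltW.
set s := Num.sqrt a in s0 aE *.
have h : 1 - ln s <= s^-1.
  by have := expR_ge1Dx (- ln s); rewrite expRN lnK.
have {}h : s - s * ln s <= 1.
  by rewrite -(mulfV (lt0r_neq0 s0)) -{1}[s]mulr1 -mulrBr ler_pM2l.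
rewrite aE lnXn // mulr2n; nra.
Qed.

(** A form of Pinsker's inequality. With [s = sqrt (a i)], write [|a i - 1| = |s - 1| * (s + 1)],
    split the product by the arithmetic-geometric mean inequality with weights depending on [V], and
    apply [entropy_hellinger]. *)
Lemma entropy_variation m (a : 'I_m -> R) : (0 < m)%N -> (forall i, 0 <= a i) ->
  \sum_i a i = m%:R ->
  (\sum_i `|a i - 1|) ^+ 2 <= 4 * m%:R * \sum_i a i * ln (a i).
Proof.
move=> m0 a0 sum_a; set V := \sum_i `|a i - 1|.
have V0 : 0 <= V by apply: sumr_ge0.
have M0 : 0 < m%:R :> R by rewrite ltr0n.
have sum1 : \sum_(i < m) (1 : R) = m%:R by rewrite sumr_const card_ord.
have term i : V * m%:R * `|a i - 1| <=
    2 * m%:R ^+ 2 * (a i * ln (a i) - a i + 1) + V ^+ 2 / 4 * (a i + 1).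
  have h := entropy_hellinger (a0 i).
  have aE : a i = Num.sqrt (a i) ^+ 2 by rewrite sqr_sqrtr.
  have := sqrtr_ge0 (a i); set s := Num.sqrt (a i) in h aE * => s0.
  have -> : `|a i - 1| = `|s - 1| * (s + 1).
    rewrite -[X in _ * X]ger0_norm; last by lra.
    by rewrite -normrM; congr `|_|; rewrite {1}aE; ring.
  have := normr_ge0 (s - 1); have := real_normK (num_real (s - 1)).
  move: `|s - 1| => w wE w0.
  apply: le_trans (_ : 2 * m%:R ^+ 2 * w ^+ 2 + V ^+ 2 / 8 * (s + 1) ^+ 2 <= _).
    by have := sqr_ge0 (4 * m%:R * w - V * (s + 1)); nra.
  apply: lerD; first by rewrite ler_pM2l ?mulr_gt0 ?exprn_gt0 // wE.
  have : (s + 1) ^+ 2 <= 2 * (a i + 1) by rewrite {1}aE; have := sqr_ge0 (s - 1); nra.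
  by have := sqr_ge0 V; nra.
have : \sum_i V * m%:R * `|a i - 1| <= \sum_i
   (2 * m%:R ^+ 2 * (a i * ln (a i) - a i + 1) + V ^+ 2 / 4 * (a i + 1)).
  by apply: ler_sum => i _; apply: term.
rewrite -mulr_sumr -/V big_split /= -!mulr_sumr !big_split /= sumrN sum_a sum1.
set L := \sum_i a i * ln (a i) => h.
have : V ^+ 2 * m%:R <= (4 * m%:R * L) * m%:R by nra.
by rewrite ler_pM2r.
Qed.

Definition overlap (a b c d : R) := Num.max 0 (Num.min b d - Num.max a c).

Lemma overlapC a b c d : overlap a b c d = overlap c d a b.
Proof. by rewrite /overlap [Num.min b d]minC [Num.max a c]maxC. Qed.

Lemma overlap_clamp a b c d : a <= b -> c <= d ->
  overlap a b c d = Num.min (Num.max d a) b - Num.min (Num.max c a) b.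
Proof.
move=> ab cd; rewrite /overlap !maxEle !minEle.
by do !case: ifPn; rewrite -?ltNge; lra.
Qed.

Definition cdf m (a : 'I_m -> R) (i : nat) := (\sum_(l < m | (l < i)%N) a l) / m%:R.

Lemma cdfS m (a : 'I_m -> R) (i : 'I_m) : cdf a i.+1 = cdf a i + a i / m%:R.
Proof.
rewrite /cdf (bigD1 i) ?ltnSn //= -mulrDl addrC; congr ((_ + _) / _).
by apply: eq_bigl => l; rewrite ltnS [(l < i)%N]ltn_neqAle andbC.
Qed.

Lemma cdf_mono m (a : 'I_m -> R) i : (forall i, 0 <= a i) -> cdf a i <= cdf a i.+1.
Proof.
move=> a0; rewrite /cdf ler_wpM2r ?invr_ge0 // [leRHS](bigID (fun l : 'I_m => (l < i)%N)) /=.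
rewrite [X in _ <= X + _](eq_bigl (fun l : 'I_m => (l < i)%N)); last first.
  by move=> l; rewrite ltnS andb_idl // => /ltnW.
by rewrite lerDl sumr_ge0.
Qed.

Lemma cdf_bounds m (a : 'I_m -> R) i : (0 < m)%N -> (forall i, 0 <= a i) ->
  \sum_i a i = m%:R -> 0 <= cdf a i <= 1.
Proof.
move=> m0 a0 sum_a; rewrite /cdf divr_ge0 ?sumr_ge0 //=.
rewrite ler_pdivrMr ?ltr0n // mul1r -sum_a.
by rewrite [leRHS](bigID (fun l : 'I_m => (l < i)%N)) /= lerDl sumr_ge0.
Qed.

(** The intervals between consecutive values of [cdf b] partition [[0, 1]]; clamped to [[x, y]],
    their lengths telescope. *)
Lemma overlap_marginal m (b : 'I_m -> R) x y : (0 < m)%N -> (forall i, 0 <= b i) ->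
  \sum_i b i = m%:R -> 0 <= x -> x <= y -> y <= 1 ->
  \sum_(j < m) overlap x y (cdf b j) (cdf b j.+1) = y - x.
Proof.
move=> m0 b0 sum_b x0 xy y1.
pose F i := Num.min (Num.max (cdf b i) x) y.
rewrite (eq_bigr (fun j : 'I_m => F j.+1 - F j)); last first.
  by move=> j _; rewrite overlap_clamp // cdf_mono.
rewrite -(big_mkord xpredT (fun j => F j.+1 - F j)) telescope_sumr // /F.
have -> : cdf b m = 1.
  rewrite /cdf (eq_bigl xpredT) ?sum_b ?mulfV ?pnatr_eq0 -?lt0n //.
  by move=> l; rewrite ltn_ord.
have -> : cdf b 0 = 0 by rewrite /cdf big_pred0 ?mul0r.
by rewrite !maxEle !minEle; do !case: ifPn; rewrite -?ltNge; lra.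
Qed.

Lemma cdf_dist m (a : 'I_m -> R) i : (0 < m)%N -> (i <= m)%N ->
  `|cdf a i - i%:R / m%:R| <= (\sum_i `|a i - 1|) / m%:R.
Proof.
move=> m0 im.
have -> : i%:R = \sum_(l < m | (l < i)%N) (1 : R).
  by rewrite (big_ord_narrow im) sumr_const card_ord.
rewrite /cdf -mulrBl normrM [`|_^-1|]ger0_norm ?invr_ge0 // ler_wpM2r ?invr_ge0 //.
rewrite -sumrB; apply: le_trans (ler_norm_sum _ _ _) _.
by rewrite [leRHS](bigID (fun l : 'I_m => (l < i)%N)) /= lerDl sumr_ge0.
Qed.

(** A functional form of concentration (Maurey's property tau, dual to a transport inequality),
    chosen because it passes to products. *)
Definition transport (A : finType) (c : A -> A -> R) (C : R) :=
  forall u v : A -> R, (forall x, 0 <= u x) -> (forall x, 0 <= v x) ->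
  (forall x y, u x * v y <= expR (c x y)) ->
  (\sum_x u x) * (\sum_x v x) <= C * #|A|%:R ^+ 2.

(* The monotone coupling moves no mass further than the total variation distances. *)
Lemma transport_grid m : (0 < m)%N ->
  transport (fun i j : 'I_m => ((i%:R - j%:R) / m%:R) ^+ 2 / 12) (expR ((m%:R ^+ 2)^-1)).
Proof.
move=> m0 u v u0 v0 uv; rewrite card_ord.
have M0 : 0 < m%:R :> R by rewrite ltr0n.
have Mn0 : m%:R != 0 :> R by rewrite lt0r_neq0.
set U := \sum_x u x; set V := \sum_x v x.
have U0 : 0 <= U by apply: sumr_ge0.
have V0 : 0 <= V by apply: sumr_ge0.
move: U0; rewrite le_eqVlt => /orP[/eqP<-|U0].
  by rewrite mul0r mulr_ge0 ?expR_ge0 ?exprn_ge0.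
move: V0; rewrite le_eqVlt => /orP[/eqP<-|V0].
  by rewrite mulr0 mulr_ge0 ?expR_ge0 ?exprn_ge0.
pose a i := u i * m%:R / U; pose b i := v i * m%:R / V.
have a0 i : 0 <= a i by rewrite /a !mulr_ge0 // invr_ge0 ltW.
have b0 i : 0 <= b i by rewrite /b !mulr_ge0 // invr_ge0 ltW.
have sum_a : \sum_i a i = m%:R.
  by rewrite /a -!mulr_suml -/U mulrAC mulfV ?mul1r // lt0r_neq0.
have sum_b : \sum_i b i = m%:R.
  by rewrite /b -!mulr_suml -/V mulrAC mulfV ?mul1r // lt0r_neq0.
pose lam := U * V / m%:R ^+ 2.
have lam0 : 0 < lam by rewrite /lam divr_gt0 ?mulr_gt0 ?exprn_gt0.
suff le_lam : ln lam <= (m%:R ^+ 2)^-1.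
  rewrite -ler_pdivrMr ?exprn_gt0 // -/lam -[lam]lnK ?posrE //.
  by rewrite ler_expR.
pose Da := (\sum_i `|a i - 1|) / m%:R; pose Db := (\sum_i `|b i - 1|) / m%:R.
have Da0 : 0 <= Da by rewrite divr_ge0 ?sumr_ge0.
have Db0 : 0 <= Db by rewrite divr_ge0 ?sumr_ge0.
have ent (c : 'I_m -> R) : (forall i, 0 <= c i) -> \sum_i c i = m%:R ->
    ((\sum_i `|c i - 1|) / m%:R) ^+ 2 / 4 <= (\sum_i c i * ln (c i)) / m%:R.
  move=> c0 sum_c; have := entropy_variation m0 c0 sum_c.
  rewrite expr_div_n; set y := \sum_i c i * ln (c i) => h.
  rewrite ler_pdivrMr // ler_pdivrMr ?exprn_gt0 //.
  by rewrite (_ : y / _ * _ * _ = 4 * m%:R * y) //; field.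
(* This is the monotone coupling of the densities [a] and [b]. *)
pose p i j := overlap (cdf a i) (cdf a i.+1) (cdf b j) (cdf b j.+1).
have p0 i j : 0 <= p i j by rewrite /p /overlap le_max lexx.
have pa (i : 'I_m) : \sum_(j < m) p i j = a i / m%:R.
  have /andP[h1 _] := cdf_bounds i m0 a0 sum_a.
  have /andP[_ h2] := cdf_bounds i.+1 m0 a0 sum_a.
  by rewrite overlap_marginal ?cdf_mono // cdfS addrAC subrr add0r.
have pb (j : 'I_m) : \sum_(i < m) p i j = b j / m%:R.
  have /andP[h1 _] := cdf_bounds j m0 b0 sum_b.
  have /andP[_ h2] := cdf_bounds j.+1 m0 b0 sum_b.
  rewrite /p; under eq_bigr do rewrite overlapC.
  by rewrite overlap_marginal ?cdf_mono // cdfS addrAC subrr add0r.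
have total : \sum_(i < m) \sum_(j < m) p i j = 1.
  by under eq_bigr do rewrite pa; rewrite -mulr_suml sum_a mulfV.
(* Where [p i j > 0] the two intervals meet, so [i / m] and [j / m] differ by at most
   [Da + Db + 1 / m]. After averaging over [p], the entropies of [a] and [b] absorb the terms in
   [Da] and [Db] by [ent]. *)
have bound (i j : 'I_m) : p i j * (ln lam + ln (a i) + ln (b j)) <=
    p i j * ((m%:R ^+ 2)^-1 + Da ^+ 2 / 4 + Db ^+ 2 / 4).
  have [p_pos|] := ltP 0 (p i j); last first.
    move=> p_neg; have -> : p i j = 0 by apply/eqP; rewrite eq_le p_neg p0.
    by rewrite !mul0r.
  rewrite ler_pM2l //.
  move: (p_pos); rewrite /p /overlap lt_max ltxx /= subr_gt0 lt_min !gt_max.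
  move=> /andP[/andP[a_pos lt1] /andP[lt2 b_pos]].
  rewrite cdfS ltrDl in a_pos; rewrite cdfS ltrDl in b_pos.
  have ai0 : 0 < a i by rewrite -(pmulr_lgt0 _ (_ : 0 < m%:R^-1)) ?invr_gt0.
  have bj0 : 0 < b j by rewrite -(pmulr_lgt0 _ (_ : 0 < m%:R^-1)) ?invr_gt0.
  have le1 : ln lam + ln (a i) + ln (b j) <= ((i%:R - j%:R) / m%:R) ^+ 2 / 12.
    have la0 : 0 < lam * a i by rewrite mulr_gt0.
    have lab0 : 0 < lam * a i * b j by rewrite mulr_gt0.
    have -> : ln lam + ln (a i) + ln (b j) = ln (lam * a i * b j).
      by rewrite lnM ?posrE // lnM ?posrE.
    rewrite -[X in _ <= X]expRK ler_ln ?posrE ?expR_gt0 //.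
    apply: le_trans (uv i j); rewrite le_eqVlt; apply/orP; left; apply/eqP.
    by rewrite /lam /a /b; field; rewrite Mn0 !lt0r_neq0.
  apply: le_trans le1 _.
  have ca k : (k <= m)%N -> `|cdf a k - k%:R / m%:R| <= Da by apply: cdf_dist.
  have cb k : (k <= m)%N -> `|cdf b k - k%:R / m%:R| <= Db by apply: cdf_dist.
  have := ca i (ltnW (ltn_ord i)); have := ca i.+1 (ltn_ord i).
  have := cb j (ltnW (ltn_ord j)); have := cb j.+1 (ltn_ord j).
  rewrite !ler_norml -(natr1 i) -(natr1 j) !mulrDl mul1r mulNr -exprVn.
  move=> /andP[h1 h2] /andP[h3 h4] /andP[h5 h6] /andP[h7 h8].
  have iv0 : 0 <= m%:R^-1 :> R by rewrite invr_ge0.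
  clear ca cb; move: lt1 lt2 h1 h2 h3 h4 h5 h6 h7 h8 iv0 Da0 Db0.
  generalize Da, Db => da db.
  move: (cdf a i) (cdf a i.+1) (cdf b j) (cdf b j.+1) => c1 c2 c3 c4.
  move: (i%:R / m%:R) => x; move: (j%:R / m%:R) => y; move: m%:R^-1 => w lt1 lt2 h1 h2 h3 h4 h5 h6 h7 h8 w0 da0 db0.
  have le1 : x - y <= da + db + w by lra.
  have le2 : y - x <= da + db + w by lra.
  have : (x - y) ^+ 2 <= (da + db + w) ^+ 2 by rewrite !expr2; nra.
  by have := sqr_ge0 (da - db); have := sqr_ge0 (da - w); have := sqr_ge0 (db - w); rewrite !expr2; nra.
have sum_left (F : 'I_m -> R) : \sum_(i < m) \sum_(j < m) p i j * F i = (\sum_i a i * F i) / m%:R.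
  rewrite mulr_suml; apply: eq_bigr => i _; rewrite -mulr_suml pa mulrAC //.
have sum_right (F : 'I_m -> R) : \sum_(i < m) \sum_(j < m) p i j * F j = (\sum_i b i * F i) / m%:R.
  rewrite exchange_big mulr_suml; apply: eq_bigr => i _; rewrite -mulr_suml pb mulrAC //.
have : \sum_(i < m) \sum_(j < m) p i j * (ln lam + ln (a i) + ln (b j)) <=
    \sum_(i < m) \sum_(j < m) p i j * ((m%:R ^+ 2)^-1 + Da ^+ 2 / 4 + Db ^+ 2 / 4).
  by apply: ler_sum => i _; apply: ler_sum.
have const (x : R) : \sum_(i < m) \sum_(j < m) p i j * x = x.
  by under eq_bigr do rewrite -mulr_suml; rewrite -mulr_suml total mul1r.
rewrite const; under eq_bigr do under eq_bigr do rewrite !mulrDr.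
under eq_bigr do rewrite !big_split /=.
rewrite !big_split /= const sum_left sum_right => h.
have := ent a a0 sum_a; have := ent b b0 sum_b; rewrite -/Da -/Db => h1 h2.
lra.
Qed.

End Transport.

Section Cons.
Variable A : finType.

Definition fcons d (a : A) (g : {ffun 'I_d -> A}) : {ffun 'I_d.+1 -> A} :=
  [ffun i => oapp g a (unlift ord0 i)].

Lemma fcons0 d a (g : {ffun 'I_d -> A}) : fcons a g ord0 = a.
Proof. by rewrite ffunE unlift_none. Qed.

Lemma fconsS d a (g : {ffun 'I_d -> A}) i : fcons a g (lift ord0 i) = g i.
Proof. by rewrite ffunE liftK. Qed.

Lemma big_ffun_recl (S : Type) (idx : S) (op : Monoid.com_law idx) d (F : {ffun 'I_d.+1 -> A} -> S) :
  \big[op/idx]_f F f = \big[op/idx]_a \big[op/idx]_g F (fcons a g).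
Proof.
rewrite pair_bigA /=; apply: (reindex (fun p : A * {ffun 'I_d -> A} => fcons p.1 p.2)).
exists (fun f : {ffun 'I_d.+1 -> A} => (f ord0, [ffun i => f (lift ord0 i)])) => [[a g] _|f _] /=.
  by rewrite fcons0; congr (_, _); apply/ffunP => i; rewrite ffunE fconsS.
apply/ffunP => i; case: (unliftP ord0 i) => [j ->|->]; last by rewrite fcons0.
by rewrite fconsS ffunE.
Qed.

End Cons.

Section Product.
Variable R : realType.

(** Tensorization: for fixed tails [g] and [h] the one-dimensional property, applied to the first
    coordinate, shows that the sums over that coordinate satisfy the hypothesis in dimension [d]. *)
Lemma transport_ffun (A : finType) (c : A -> A -> R) (C : R) d :
  0 < C -> (0 < #|A|)%N -> transport c C ->
  transport (fun x y : {ffun 'I_d -> A} => \sum_i c (x i) (y i)) (C ^+ d).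
Proof.
move=> C0 A0 tau; elim: d => [|d IH] u v u0 v0 uv.
  rewrite card_ffun card_ord expn0 expr0 mul1r expr1n.
  have x0 : {ffun 'I_0 -> A} by apply: finfun; case.
  have one (f : {ffun 'I_0 -> A} -> R) : \sum_x f x = f x0.
    rewrite (eq_bigr (fun=> f x0)) ?sumr_const ?card_ffun ?card_ord ?expn0 ?mulr1n // => x _.
    by congr f; apply/ffunP; case.
  by rewrite !one; have := uv x0 x0; rewrite big_ord0 expR0.
have K0 : 0 < C * #|A|%:R ^+ 2 by rewrite mulr_gt0 ?exprn_gt0 ?ltr0n.
pose u' g := (\sum_a u (fcons a g)) / (C * #|A|%:R ^+ 2).
pose v' g := \sum_a v (fcons a g).
have key g h : u' g * v' h <= expR (\sum_i c (g i) (h i)).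
  set E := expR _.
  have E0 : 0 < E by apply: expR_gt0.
  have p1 a : 0 <= u (fcons a g) / E by rewrite divr_ge0 // ltW.
  have p3 a b : u (fcons a g) / E * v (fcons b h) <= expR (c a b).
    rewrite mulrAC ler_pdivrMr // -expRD; apply: le_trans (uv _ _) _.
    rewrite ler_expR big_ord_recl !fcons0 lerD2l.
    by under eq_bigr do rewrite !fconsS.
  have := tau _ _ p1 (fun b => v0 (fcons b h)) p3.
  rewrite -mulr_suml => le1; rewrite /u' /v' mulrAC ler_pdivrMr //.
  by rewrite [X in _ <= X]mulrC -ler_pdivrMr // mulrAC.
have u'0 g : 0 <= u' g by rewrite divr_ge0 ?sumr_ge0 // ltW.
have v'0 g : 0 <= v' g by rewrite sumr_ge0.
have := IH u' v' u'0 v'0 key.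
have -> : \sum_g u' g = (\sum_f u f) / (C * #|A|%:R ^+ 2).
  by rewrite -mulr_suml big_ffun_recl exchange_big.
have -> : \sum_g v' g = \sum_f v f by rewrite /v' exchange_big -big_ffun_recl.
rewrite mulrAC ler_pdivrMr // => H.
apply: le_trans H _.
by rewrite !card_ffun !card_ord expnS natrM [C ^+ d.+1]exprS le_eqVlt; apply/orP; left; apply/eqP; ring.
Qed.

Definition sqdist m d (x y : {ffun 'I_d -> 'I_m}) : R :=
  \sum_i (((x i)%:R - (y i)%:R) / m%:R) ^+ 2.

(** Apply the transport property to the indicator of [S] scaled by [expR (rho / 12)] and to the
    indicator of [T]. The condition [K * d <= m ^ 2] bounds the product of the [K * d]
    one-dimensional constants by [e]. *)
Lemma separated_card m d K (S T : {set {ffun 'I_K -> {ffun 'I_d -> 'I_m}}}) (rho : R) :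
  (0 < m)%N -> (K * d <= m ^ 2)%N ->
  (forall x y, x \in S -> y \in T -> rho <= \sum_k sqdist (x k) (y k)) ->
  #|S|%:R * #|T|%:R <= expR (1 - rho / 12) * (m ^ (K * d))%:R ^+ 2 :> R.
Proof.
move=> m0 Kd sep.
have card_pos : (0 < #|{ffun 'I_d -> 'I_m}|)%N by rewrite card_ffun !card_ord expn_gt0 m0.
have card_m : (0 < #|'I_m|)%N by rewrite card_ord.
have tau2 := @transport_ffun _ _ _ d (expR_gt0 _) card_m (@transport_grid R m m0).
have tau3 := @transport_ffun _ _ _ K (exprn_gt0 d (expR_gt0 _)) card_pos tau2.
have := tau3 (fun x => (x \in S)%:R * expR (rho / 12)) (fun y => (y \in T)%:R).
have p1 (x : {ffun 'I_K -> {ffun 'I_d -> 'I_m}}) : 0 <= (x \in S)%:R * expR (rho / 12) :> R.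
  by rewrite mulr_ge0 ?expR_ge0.
move=> /(_ p1 (fun y => ler0n _ _)) le1.
have {le1} := le1 _; rewrite -mulr_suml -!natr_sum -!big_mkcond /= !sum1_card.
rewrite !card_ffun !card_ord -expnM [(d * K)%N]mulnC -exprM => le1.
have {le1} le1 : #|S|%:R * expR (rho / 12) * #|T|%:R <=
    expR (m%:R ^+ 2)^-1 ^+ (d * K) * (m ^ (K * d))%:R ^+ 2.
  apply: le1 => x y.
  have [xS|_] := boolP (x \in S); last by rewrite !mul0r expR_ge0.
  have [yT|_] := boolP (y \in T); last by rewrite mulr0 expR_ge0.
  rewrite mul1r mulr1 ler_expR; under eq_bigr do rewrite -mulr_suml.
  by rewrite -mulr_suml ler_pM2r ?invr_gt0 //; apply: sep.
rewrite expRD expRN mulrAC ler_pdivlMr ?expR_gt0 //.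
rewrite mulrAC; apply: le_trans le1 _; rewrite ler_wpM2r ?exprn_ge0 //.
rewrite -expRM_natl ler_expR.
rewrite ler_pdivrMr ?exprn_gt0 ?ltr0n // mul1r -natrX ler_nat mulnC.
by [].
Qed.

End Product.

(** * Correlated pairs and blocks *)

Section Moments.
Variables (R : realType) (m : nat).

Definition coord (c : 'I_m) : R := (2 * c%:R - (m%:R - 1)) / m%:R.

Definition iprod d (x y : {ffun 'I_d -> 'I_m}) : R := \sum_i coord (x i) * coord (y i).

Definition reflect d (x : {ffun 'I_d -> 'I_m}) : {ffun 'I_d -> 'I_m} :=
  [ffun i => rev_ord (x i)].

Lemma coord_rev c : coord (rev_ord c) = - coord c.
Proof.
have mE : m%:R = (rev_ord c)%:R + c%:R + 1 :> R.
  by rewrite -natrD natr1; congr (_%:R); rewrite /=; have := ltn_ord c; lia.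
by rewrite /coord -mulNr; congr (_ / _); rewrite mE; ring.
Qed.

Lemma reflectK d : involutive (@reflect d).
Proof. by move=> x; apply/ffunP => i; rewrite !ffunE rev_ordK. Qed.

Lemma iprodC d (x y : {ffun 'I_d -> 'I_m}) : iprod x y = iprod y x.
Proof. by apply: eq_bigr => i _; rewrite mulrC. Qed.

Lemma iprod_reflect d (x y : {ffun 'I_d -> 'I_m}) : iprod (reflect x) y = - iprod x y.
Proof. by rewrite -sumrN; apply: eq_bigr => i _; rewrite ffunE coord_rev mulNr. Qed.

Lemma sqdist_coord d (x y : {ffun 'I_d -> 'I_m}) : (0 < m)%N ->
  4 * sqdist R x y = \sum_i (coord (x i) - coord (y i)) ^+ 2.
Proof.
move=> m0; rewrite mulr_sumr; apply: eq_bigr => i _; rewrite /coord; field.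
by rewrite pnatr_eq0 -lt0n.
Qed.

Hypothesis m2 : (2 <= m)%N.

Let M0 : 0 < m%:R :> R.
Proof. by rewrite ltr0n ltnW. Qed.

Lemma coord_le1 c : `|coord c| <= 1.
Proof.
rewrite /coord normf_div (ger0_norm (ltW M0)) ler_pdivrMr // mul1r.
have : c%:R + 1 <= m%:R :> R by rewrite natr1 ler_nat.
by have : 0 <= c%:R :> R by []; rewrite ler_norml => *; apply/andP; split; lra.
Qed.

Lemma sum_coord_odd k : odd k -> \sum_c coord c ^+ k = 0.
Proof.
move=> k_odd; have : \sum_c coord c ^+ k = - \sum_c coord c ^+ k.
  rewrite {1}(reindex_inj rev_ord_inj) -sumrN; apply: eq_bigr => c _.
  by rewrite coord_rev exprNn -signr_odd k_odd expr1 mulN1r.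
by lra.
Qed.

(** The sum equals [(m ^ 2 - 1) / (3 * m)], which is at least [m / 4] from [m = 2] on. *)
Lemma sum_coord2 : m%:R / 4 <= \sum_c coord c ^+ 2.
Proof.
have sums n : \sum_(c < n) (c%:R : R) = n%:R * (n%:R - 1) / 2 /\
   \sum_(c < n) (c%:R : R) ^+ 2 = n%:R * (n%:R - 1) * (2 * n%:R - 1) / 6.
  elim: n => [|n [IH1 IH2]]; first by rewrite !big_ord0 !mul0r.
  by rewrite !big_ord_recr /= IH1 IH2 -natr1; split; field.
have [s1 s2] := sums m.
have -> : \sum_c coord c ^+ 2 =
    (4 * (\sum_(c < m) (c%:R : R) ^+ 2) - 4 * (m%:R - 1) * (\sum_(c < m) (c%:R : R))
     + m%:R * (m%:R - 1) ^+ 2) / m%:R ^+ 2.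
  have -> : m%:R * (m%:R - 1) ^+ 2 = \sum_(c < m) (m%:R - 1) ^+ 2 :> R.
    by rewrite sumr_const card_ord mulr_natl.
  rewrite !mulr_sumr -sumrB -big_split /= mulr_suml; apply: eq_bigr => c _.
  by rewrite /coord; field; rewrite lt0r_neq0.
rewrite s1 s2 ler_pdivlMr ?exprn_gt0 //.
have : 2 <= m%:R :> R by rewrite ler_nat.
move: (m%:R) => x x2.
have : 0 <= (x - 2) * (x + 2) * x by rewrite !mulr_ge0 //; lra.
lra.
Qed.

Let S2 : R := \sum_c coord c ^+ 2.

Lemma sum_pairs (F G : 'I_m -> R) :
  \sum_a \sum_b F a * G b = (\sum_a F a) * (\sum_b G b).
Proof. by rewrite mulr_suml; apply: eq_bigr => a _; rewrite mulr_sumr. Qed.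

Lemma iprod_cons d a b (g h : {ffun 'I_d -> 'I_m}) :
  iprod (fcons a g) (fcons b h) = coord a * coord b + iprod g h.
Proof.
rewrite /iprod big_ord_recl !fcons0; congr (_ + _).
by apply: eq_bigr => i _; rewrite !fconsS.
Qed.

Lemma sum_iprod_recl d (F : R -> R) :
  \sum_(x : {ffun 'I_d.+1 -> 'I_m}) \sum_(y : {ffun 'I_d.+1 -> 'I_m}) F (iprod x y) =
  \sum_(g : {ffun 'I_d -> 'I_m}) \sum_(h : {ffun 'I_d -> 'I_m})
    \sum_a \sum_b F (coord a * coord b + iprod g h).
Proof.
rewrite big_ffun_recl exchange_big /=; apply: eq_bigr => g _.
transitivity (\sum_a \sum_b \sum_(h : {ffun 'I_d -> 'I_m}) F (coord a * coord b + iprod g h)).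
  apply: eq_bigr => a _; rewrite big_ffun_recl; apply: eq_bigr => b _; apply: eq_bigr => h _.
  by rewrite iprod_cons.
by rewrite [RHS]exchange_big /=; apply: eq_bigr => a _; exact: exchange_big.
Qed.

(** The variance of a product of two independent uniform coordinates; [Q d] counts the pairs of
    points. *)
Let sigma : R := S2 ^+ 2 / m%:R ^+ 2.
Let Q d : R := (m ^ d)%:R ^+ 2.

Let sigma_ge : 1 / 16 <= sigma.
Proof.
have := sum_coord2; rewrite -/S2 => h.
rewrite /sigma -expr_div_n; have : 1 / 4 <= S2 / m%:R by rewrite ler_pdivlMr // mulrC mulrA mulr1.
move: (S2 / _) => x hx; rewrite expr2; nra.
Qed.

Let S2E : S2 ^+ 2 = sigma * m%:R ^+ 2.
Proof. by rewrite /sigma mulfVK // expf_neq0 // lt0r_neq0. Qed.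

Let card2 d (x : R) :
  \sum_(g : {ffun 'I_d -> 'I_m}) \sum_(h : {ffun 'I_d -> 'I_m}) x = x * Q d.
Proof.
rewrite sumr_const sumr_const card_ffun !card_ord /Q expr2 mulrA.
by rewrite -[LHS]mulr_natr -[X in X * _ = _]mulr_natr.
Qed.

Let sum2_affine d c b (F : {ffun 'I_d -> 'I_m} -> {ffun 'I_d -> 'I_m} -> R) :
  \sum_g \sum_h (c + b * F g h) = c * Q d + b * \sum_g \sum_h F g h.
Proof.
under eq_bigr do rewrite big_split /=.
rewrite big_split /= card2; congr (_ + _); rewrite mulr_sumr.
by apply: eq_bigr => g _; rewrite mulr_sumr.
Qed.

Let sum_m (x : R) : \sum_(a < m) \sum_(b < m) x = x * m%:R ^+ 2.
Proof.
rewrite sumr_const sumr_const card_ord expr2 mulrA.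
by rewrite -[LHS]mulr_natr -[X in X * _ = _]mulr_natr.
Qed.

Lemma second_moment d : \sum_(x : {ffun 'I_d -> 'I_m}) \sum_(y : {ffun 'I_d -> 'I_m})
  iprod x y ^+ 2 = d%:R * sigma * Q d.
Proof.
elim: d => [|d IH].
  rewrite !mul0r big1 // => x _; rewrite big1 // => y _.
  by rewrite /iprod big_ord0 expr0n.
rewrite (sum_iprod_recl _ (fun z => z ^+ 2)).
have inner z : \sum_a \sum_b (coord a * coord b + z) ^+ 2 = sigma * m%:R ^+ 2 + m%:R ^+ 2 * z ^+ 2.
  have e1 : \sum_c coord c ^+ 1 = 0 by apply: sum_coord_odd.
  rewrite -S2E -[X in _ = _ + X]mulrC -sum_m.
  have -> : S2 ^+ 2 = \sum_a \sum_b (coord a ^+ 2) * (coord b ^+ 2).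
    by rewrite sum_pairs expr2.
  have z0 : 0 = \sum_a \sum_b (2 * z * coord a) * coord b ^+ 1.
    by rewrite (sum_pairs (fun a => 2 * z * coord a) (fun b => coord b ^+ 1)) e1 mulr0.
  rewrite -[RHS]addr0 [X in _ = _ + X]z0 -!big_split /=; apply: eq_bigr => a _.
  by rewrite -!big_split /=; apply: eq_bigr => b _; ring.
under eq_bigr do under eq_bigr do rewrite inner.
rewrite sum2_affine IH /Q expnS natrM -natr1; ring.
Qed.

(** Coordinates are split off one at a time: odd moments vanish by symmetry, and [|coord| <= 1]
    bounds the fourth moment of a coordinate by its second. *)
Lemma fourth_moment d : \sum_(x : {ffun 'I_d -> 'I_m}) \sum_(y : {ffun 'I_d -> 'I_m})
  iprod x y ^+ 4 <= (d%:R * sigma + 3 * (d%:R * sigma) ^+ 2) * Q d.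
Proof.
elim: d => [|d IH].
  rewrite !mul0r expr0n mulr0 addr0 mul0r big1 // => x _; rewrite big1 // => y _.
  by rewrite /iprod big_ord0 expr0n.
rewrite (sum_iprod_recl _ (fun z => z ^+ 4)).
have inner z : \sum_a \sum_b (coord a * coord b + z) ^+ 4 <=
    sigma * m%:R ^+ 2 + 6 * (sigma * m%:R ^+ 2) * z ^+ 2 + m%:R ^+ 2 * z ^+ 4.
  have e1 : \sum_c coord c ^+ 1 = 0 by apply: sum_coord_odd.
  have e3 : \sum_c coord c ^+ 3 = 0 by apply: sum_coord_odd.
  have -> : \sum_a \sum_b (coord a * coord b + z) ^+ 4 =
     (\sum_a coord a ^+ 4) ^+ 2 + 6 * (sigma * m%:R ^+ 2) * z ^+ 2 + m%:R ^+ 2 * z ^+ 4.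
    rewrite -S2E -[X in _ = _ + X]mulrC -sum_m.
    have -> : 6 * S2 ^+ 2 * z ^+ 2 = \sum_a \sum_b (6 * z ^+ 2 * coord a ^+ 2) * (coord b ^+ 2).
      by rewrite (sum_pairs (fun a => 6 * z ^+ 2 * coord a ^+ 2)) -mulr_sumr /S2; ring.
    have z1 : 0 = \sum_a \sum_b (4 * z ^+ 3 * coord a) * coord b ^+ 1.
      by rewrite (sum_pairs (fun a => 4 * z ^+ 3 * coord a) (fun b => coord b ^+ 1)) e1 mulr0.
    have z3 : 0 = \sum_a \sum_b (4 * z * coord a ^+ 3) * coord b ^+ 3.
      by rewrite (sum_pairs (fun a => 4 * z * coord a ^+ 3) (fun b => coord b ^+ 3)) e3 mulr0.
    rewrite [X in _ = X + _ + _]expr2 -sum_pairs.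
    rewrite -[RHS]addr0 [X in _ = _ + X]z1 -[RHS]addr0 [X in _ = _ + X]z3.
    rewrite -!big_split /=; apply: eq_bigr => a _.
    by rewrite -!big_split /=; apply: eq_bigr => b _; ring.
  rewrite !lerD2r -S2E ler_pXn2r ?nnegrE //; try by apply: sumr_ge0 => a _; rewrite exprn_even_ge0.
  apply: ler_sum => a _; have := coord_le1 a; rewrite ler_norml => /andP[h1 h2].
  have : coord a ^+ 2 <= 1 by rewrite expr2; nra.
  have := sqr_ge0 (coord a); rewrite (_ : coord a ^+ 4 = coord a ^+ 2 * coord a ^+ 2); last by ring.
  by move: (coord a ^+ 2) => x; nra.
apply: le_trans (_ : \sum_(g : {ffun 'I_d -> 'I_m}) \sum_(h : {ffun 'I_d -> 'I_m})
  (sigma * m%:R ^+ 2 + 6 * (sigma * m%:R ^+ 2) * iprod g h ^+ 2 + m%:R ^+ 2 * iprod g h ^+ 4) <= _).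
  by apply: ler_sum => g _; apply: ler_sum.
have -> : \sum_(g : {ffun 'I_d -> 'I_m}) \sum_(h : {ffun 'I_d -> 'I_m})
  (sigma * m%:R ^+ 2 + 6 * (sigma * m%:R ^+ 2) * iprod g h ^+ 2 + m%:R ^+ 2 * iprod g h ^+ 4) =
  sigma * m%:R ^+ 2 * Q d + 6 * (sigma * m%:R ^+ 2) * (d%:R * sigma * Q d) +
  m%:R ^+ 2 * \sum_(g : {ffun 'I_d -> 'I_m}) \sum_(h : {ffun 'I_d -> 'I_m}) iprod g h ^+ 4.
  rewrite -second_moment -sum2_affine mulr_sumr -big_split /=; apply: eq_bigr => g _.
  by rewrite mulr_sumr -big_split.
have QE : Q d.+1 = m%:R ^+ 2 * Q d by rewrite /Q expnS natrM exprMn.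
have Q0 : 0 <= Q d by rewrite exprn_ge0.
apply: le_trans (lerD (lexx _) (ler_wpM2l _ IH)) _; first by rewrite exprn_ge0 // ltW.
rewrite QE -natr1.
have : 0 <= sigma ^+ 2 * (m%:R ^+ 2 * Q d) by rewrite mulr_ge0 ?sqr_ge0 // mulr_ge0 ?sqr_ge0.
lra.
Qed.

(** The factor 1/6 makes [tau d ^+ 2 = d / 36] at most half of the mean square [d * sigma], since
    [sigma >= 1 / 16]. *)
Definition tau d : R := Num.sqrt d%:R / 6.

Lemma tau_sqr d : tau d ^+ 2 = d%:R / 36.
Proof. by rewrite /tau expr_div_n sqr_sqrtr //; congr (_ / _); ring. Qed.

(* Paley-Zygmund: the fourth moment of the inner product is at most 19 times the square
   of its second moment. *)
Lemma many_correlated d : (0 < d)%N -> Q d <= 152 *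
  \sum_(x : {ffun 'I_d -> 'I_m}) \sum_(y : {ffun 'I_d -> 'I_m}) (tau d <= iprod x y)%R%:R.
Proof.
move=> d0; set P := \sum_x _.
have Q0 : 0 <= Q d by rewrite exprn_ge0.
pose q := d%:R * sigma.
have D1 : 1 <= d%:R :> R by rewrite ler1n.
have q16 : 1 / 16 <= q by rewrite /q; have := sigma_ge; nra.
have tau0 : 0 <= tau d by rewrite divr_ge0 ?sqrtr_ge0.
have tau_q : tau d ^+ 2 <= q / 2.
  by rewrite tau_sqr /q; have := sigma_ge; move: D1; nra.
have symm : \sum_(x : {ffun 'I_d -> 'I_m}) \sum_(y : {ffun 'I_d -> 'I_m})
    (iprod x y <= - tau d)%R%:R = P.
  rewrite (reindex_inj (inv_inj (@reflectK d))) /=; apply: eq_bigr => x _.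
  by apply: eq_bigr => y _; rewrite iprod_reflect lerN2.
(* Since [1 <= 16 * q], the mean fourth power is at most [19 * q ^ 2], so dividing by [76 * q] costs
   [q / 4]. The remaining quarter of [q * Q d] is at most [38 * q * P], which gives 152. *)
have term (z : R) : z ^+ 2 <= q / 2 + z ^+ 4 / (76 * q) + 19 * q * ((tau d <= z)%R%:R + (z <= - tau d)%R%:R).
  have q0 : 0 < q by lra.
  have z4 : 0 <= z ^+ 4 / (76 * q) by rewrite divr_ge0 ?exprn_even_ge0 // ltW // mulr_gt0.
  have big1' : z ^+ 2 <= z ^+ 4 / (76 * q) + 19 * q.
    rewrite -subr_ge0 (_ : _ - _ = (z ^+ 2 - 38 * q) ^+ 2 / (76 * q)).
      by rewrite divr_ge0 ?sqr_ge0 // ltW // mulr_gt0.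
    by field; rewrite lt0r_neq0.
  case: (leP (tau d) z) => h1; first by case: (z <= - tau d)%R => /=; lra.
  case: (leP z (- tau d)) => h2; first by rewrite /=; lra.
  have : z ^+ 2 <= tau d ^+ 2 by rewrite !expr2; nra.
  by rewrite /= addr0 mulr0; lra.
have : \sum_(x : {ffun 'I_d -> 'I_m}) \sum_(y : {ffun 'I_d -> 'I_m}) iprod x y ^+ 2 <=
    \sum_(x : {ffun 'I_d -> 'I_m}) \sum_(y : {ffun 'I_d -> 'I_m})
     (q / 2 + (76 * q)^-1 * iprod x y ^+ 4 + 19 * q * ((tau d <= iprod x y)%R%:R + (iprod x y <= - tau d)%R%:R)).
  by apply: ler_sum => x _; apply: ler_sum => y _; rewrite [_^-1 * _]mulrC; apply: term.
have -> : \sum_(x : {ffun 'I_d -> 'I_m}) \sum_(y : {ffun 'I_d -> 'I_m})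
     (q / 2 + (76 * q)^-1 * iprod x y ^+ 4 + 19 * q * ((tau d <= iprod x y)%R%:R + (iprod x y <= - tau d)%R%:R))
   = q / 2 * Q d + (76 * q)^-1 *
     (\sum_(g : {ffun 'I_d -> 'I_m}) \sum_(h : {ffun 'I_d -> 'I_m}) iprod g h ^+ 4) + 19 * q * (P + P).
  rewrite -sum2_affine -{2}symm -big_split /= mulr_sumr -big_split /=; apply: eq_bigr => x _.
  by rewrite -big_split /= mulr_sumr -big_split.
rewrite second_moment -/q => h.
have h4 := fourth_moment d; rewrite -/q in h4.
set F := \sum_x _ in h h4.
have q0 : 0 < q by lra.
have {}h4 : (76 * q)^-1 * F <= q / 4 * Q d.
  have q76 : 0 < 76 * q by lra.
  rewrite mulrC ler_pdivrMr //; apply: le_trans h4 _.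
  by rewrite mulrAC ler_wpM2r //; nra.
have {h h4} h : q * Q d <= q / 2 * Q d + q / 4 * Q d + 19 * q * (P + P).
  by apply: le_trans h _; rewrite lerD2r lerD2l.
have : q * Q d <= q * (152 * P).
  by move: h; generalize (Q d), P, q => x y z; lra.
by rewrite ler_pM2l.
Qed.

End Moments.

Section Counting.
Variable R : realType.

Lemma sum_sqr (I : finType) (a : I -> R) :
  (\sum_i a i) ^+ 2 <= #|I|%:R * \sum_i a i ^+ 2.
Proof.
have : 0 <= \sum_i \sum_j (a i - a j) ^+ 2 by do 2!(apply: sumr_ge0 => ? _); rewrite sqr_ge0.
have -> : \sum_i \sum_j (a i - a j) ^+ 2 =
    2 * (#|I|%:R * \sum_i a i ^+ 2) - 2 * (\sum_i a i) ^+ 2.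
  have e1 : \sum_i \sum_(j : I) a i ^+ 2 = #|I|%:R * \sum_i a i ^+ 2.
    by rewrite mulr_sumr; apply: eq_bigr => i _; rewrite sumr_const mulr_natl.
  have e2 : \sum_(i : I) \sum_j a j ^+ 2 = #|I|%:R * \sum_i a i ^+ 2.
    by rewrite exchange_big e1.
  have e3 : \sum_i \sum_j a i * a j = (\sum_i a i) ^+ 2.
    by rewrite expr2 mulr_suml; apply: eq_bigr => i _; rewrite mulr_sumr.
  rewrite [2 * (#|I|%:R * _)]mulr_natl mulr2n -{1}e1 -e2 -e3 mulr_sumr -big_split -sumrB /=.
  by apply: eq_bigr => i _; rewrite mulr_sumr -big_split -sumrB; apply: eq_bigr => j _ /=; ring.
by lra.
Qed.

(** Sidorenko's inequality for the 4-cycle, by Cauchy-Schwarz twice: first for the degrees, then for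
    the codegrees [D]. *)
Lemma four_cycles (B : finType) (f : B -> B -> R) :
  (\sum_x \sum_y f x y) ^+ 4 <= #|B|%:R ^+ 4 *
    \sum_x1 \sum_x2 \sum_y1 \sum_y2 (f x1 y1 * f x2 y1) * (f x1 y2 * f x2 y2).
Proof.
pose D x1 x2 := \sum_y f x1 y * f x2 y.
have -> : \sum_x1 \sum_x2 \sum_y1 \sum_y2 (f x1 y1 * f x2 y1) * (f x1 y2 * f x2 y2) =
    \sum_p D p.1 p.2 ^+ 2.
  rewrite -(pair_bigA _ (fun x1 x2 => D x1 x2 ^+ 2)) /=.
  apply: eq_bigr => x1 _; apply: eq_bigr => x2 _; rewrite expr2 mulr_suml.
  by apply: eq_bigr => y1 _; rewrite mulr_sumr.
have h1 := sum_sqr (fun p : B * B => D p.1 p.2).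
have h2 := sum_sqr (fun y => \sum_x f x y).
have e1 : \sum_p D p.1 p.2 = \sum_y (\sum_x f x y) ^+ 2.
  rewrite -(pair_bigA _ D) /=.
  under eq_bigr do rewrite exchange_big.
  rewrite exchange_big; apply: eq_bigr => y _.
  by rewrite expr2 mulr_suml; apply: eq_bigr => x _; rewrite mulr_sumr.
rewrite [X in X ^+ 4]exchange_big.
rewrite e1 card_prod natrM in h1.
rewrite (_ : _ ^+ 4 = ((\sum_y \sum_x f x y) ^+ 2) ^+ 2); last by rewrite -exprM.
have N0 : 0 <= #|B|%:R :> R by [].
apply: le_trans (_ : (#|B|%:R * \sum_y (\sum_x f x y) ^+ 2) ^+ 2 <= _).
  by rewrite ler_pXn2r // nnegrE ?sqr_ge0 ?mulr_ge0 ?sumr_ge0 // => y _; apply: sqr_ge0.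
rewrite exprMn; apply: le_trans (ler_wpM2l (sqr_ge0 _) h1) _.
by rewrite mulrA le_eqVlt; apply/orP; left; apply/eqP; ring.
Qed.

Lemma marginal (I B : finType) (F : {ffun I -> B} -> R) p :
  #|B|%:R * \sum_y F y = \sum_y \sum_v F (upd y p v).
Proof.
rewrite big_upd mulr_sumr; apply: eq_bigr => y _.
by rewrite sumr_const mulr_natl.
Qed.

End Counting.

Section Blocks.
Variables (R : realType) (m d r : nat) (row : 'I_r -> nat).
Hypotheses (m2 : (2 <= m)%N) (d0 : (0 < d)%N).
Local Notation B := {ffun 'I_d -> 'I_m}.
Local Notation quad := ('I_r * 'I_r * 'I_r * 'I_r)%type.
Local Notation tau := (@tau R d).
Local Notation iprod := (@iprod R m d).

Definition crossing (k : quad) : bool :=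
  let: (p1, p2, p3, p4) := k in
  [&& row p1 == row p2, p1 != p2, row p3 == row p4, p3 != p4 & (row p1 < row p3)%N].

(** Crossing blocks prescribe the sign pattern between two rows. The other blocks make the points of
    [p1] and [p2] obtuse, hence far apart, which serves pairs of parts in one row. *)
Definition block_event (k : quad) (y : {ffun 'I_r -> B}) : bool :=
  let: (p1, p2, p3, p4) := k in
  if crossing k then
    [&& tau <= iprod (y p1) (y p3), tau <= iprod (y p2) (y p4),
        iprod (y p1) (y p4) <= - tau & iprod (y p2) (y p3) <= - tau]
  else (p1 != p2) ==> (iprod (y p1) (y p2) <= - tau).

Let N : R := (m ^ d)%:R.

Let N0 : 0 < N.
Proof. by rewrite ltr0n expn_gt0 (ltnW m2). Qed.

Let cardB : #|{: B}|%:R = N.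
Proof. by rewrite card_ffun !card_ord. Qed.

Let cardT : #|{: {ffun 'I_r -> B}}|%:R = N ^+ r.
Proof. by rewrite card_ffun [#|{: B}|]card_ffun !card_ord natrX. Qed.

Let f (x y : B) : R := (tau <= iprod x y)%R%:R.

Let sum_f : N ^+ 2 <= 152 * \sum_x \sum_y f x y.
Proof. exact: many_correlated. Qed.

Let sum_f_reflect : \sum_x \sum_y (iprod x y <= - tau)%R%:R = \sum_x \sum_y f x y :> R.
Proof.
rewrite (reindex_inj (inv_inj (@reflectK m d))) /=; apply: eq_bigr => x _.
by apply: eq_bigr => y _; rewrite iprod_reflect lerN2.
Qed.

Let marginal2 (g : B -> B -> R) p1 p2 : p1 != p2 ->
  N ^+ 2 * \sum_(y : {ffun 'I_r -> B}) g (y p1) (y p2) = N ^+ r * \sum_x \sum_y g x y.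
Proof.
move=> p12; rewrite expr2 -mulrA -cardB (marginal _ p2).
under eq_bigr do under eq_bigr do rewrite !updE eqxx (negbTE p12).
rewrite (marginal (fun y : {ffun 'I_r -> B} => \sum_v g (y p1) v) p1).
under eq_bigr do under eq_bigr do rewrite !updE eqxx.
by rewrite sumr_const -[LHS]mulr_natl cardT cardB.
Qed.

Let marginal4 (g : B -> B -> B -> B -> R) p1 p2 p3 p4 :
  p1 != p2 -> p1 != p3 -> p1 != p4 -> p2 != p3 -> p2 != p4 -> p3 != p4 ->
  N ^+ 4 * \sum_(y : {ffun 'I_r -> B}) g (y p1) (y p2) (y p3) (y p4) =
  N ^+ r * \sum_x1 \sum_x2 \sum_y1 \sum_y2 g x1 x2 y1 y2.
Proof.
move=> p12 p13 p14 p23 p24 p34; rewrite (_ : N ^+ 4 = N ^+ 2 * N * N); last by rewrite -!exprSr.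
rewrite -mulrA -mulrA -cardB (marginal _ p4).
under eq_bigr do under eq_bigr do
  rewrite !updE eqxx (negbTE p14) (negbTE p24) (negbTE p34).
rewrite (marginal (fun y : {ffun 'I_r -> B} => \sum_v g (y p1) (y p2) (y p3) v) p3).
under eq_bigr do under eq_bigr do rewrite !updE eqxx (negbTE p13) (negbTE p23).
rewrite cardB (marginal2 (fun x1 x2 => \sum_v \sum_w g x1 x2 v w)) //.
Qed.

(** Reflecting the points of [p2] and [p4] turns the sign pattern of a crossing block into a 4-cycle
    of the relation [tau <= iprod x y], whose density is at least 1/152. *)
Lemma block_event_many k : N ^+ r <= 152 ^+ 4 * \sum_y (block_event k y)%:R.
Proof.
case: k => -[[p1 p2] p3] p4; rewrite /block_event.
case cr: (crossing (p1, p2, p3, p4)); last first.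
  have [->|p12] := eqVneq p1 p2.
    rewrite /= sumr_const cardT.
    by rewrite ler_peMl ?exprn_ge0 ?ltW //; lra.
  have := marginal2 (fun x y => (iprod x y <= - tau)%R%:R) p12; rewrite sum_f_reflect => e1.
  have N2 : 0 < N ^+ 2 by rewrite exprn_gt0.
  have le1 : N ^+ r * N ^+ 2 <= 152 * (N ^+ 2 * \sum_(y : {ffun 'I_r -> B}) (iprod (y p1) (y p2) <= - tau)%R%:R).
    by rewrite e1 [152 * _]mulrCA ler_wpM2l // exprn_ge0 ?ltW.
  rewrite /=; move: le1; rewrite [X in X <= _]mulrC [152 * _]mulrCA ler_pM2l // => /le_trans; apply.
  by rewrite ler_wpM2r ?sumr_ge0 //; lra.
have /and5P[/eqP r12 p12 /eqP r34 p34 r13] := cr.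
have p13 : p1 != p3 by apply: contraTneq r13 => ->; rewrite ltnn.
have p14 : p1 != p4 by apply: contraTneq r13 => ->; rewrite r34 ltnn.
have p23 : p2 != p3 by apply: contraTneq r13 => p23; rewrite r12 p23 ltnn.
have p24 : p2 != p4 by apply: contraTneq r13 => p24; rewrite r12 p24 r34 ltnn.
pose g (x1 x2 y1 y2 : B) : R := [&& tau <= iprod x1 y1, tau <= iprod x2 y2,
  iprod x1 y2 <= - tau & iprod x2 y1 <= - tau]%R%:R.
have := marginal4 g p12 p13 p14 p23 p24 p34; rewrite /g => e1.
have cyc := four_cycles f; rewrite cardB in cyc.
set S := (X in _ <= _ * X) in cyc.
have e2 : \sum_x1 \sum_x2 \sum_y1 \sum_y2 g x1 x2 y1 y2 = S.
  apply: eq_bigr => x1 _; rewrite (reindex_inj (inv_inj (@reflectK m d))) /=.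
  apply: eq_bigr => x2 _; apply: eq_bigr => y1 _.
  rewrite (reindex_inj (inv_inj (@reflectK m d))) /=; apply: eq_bigr => y2 _.
  have r1 (x y : B) : iprod x (reflect y) = - iprod x y by rewrite iprodC iprod_reflect iprodC.
  rewrite /g /f !iprod_reflect !r1.
  rewrite opprK !lerN2.
  by rewrite -!mulnb !natrM; ring.
rewrite -/g e2 in e1.
have N4 : 0 < N ^+ 8 by rewrite exprn_gt0.
rewrite -(ler_pM2l N4); apply: le_trans (_ : 152 ^+ 4 * (N ^+ 4 * (N ^+ 4 * \sum_(y : {ffun 'I_r -> B}) g (y p1) (y p2) (y p3) (y p4))) <= _); last first.
  by rewrite le_eqVlt; apply/orP; left; apply/eqP; ring.
rewrite e1 (_ : 152 ^+ 4 * _ = N ^+ r * (152 ^+ 4 * (N ^+ 4 * S))); last by ring.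
rewrite [X in X <= _]mulrC ler_pM2l ?exprn_gt0 //.
apply: le_trans (ler_wpM2l _ cyc); last by rewrite exprn_ge0.
rewrite -exprMn (_ : N ^+ 8 = (N ^+ 2) ^+ 4); last by rewrite -exprM.
rewrite ler_pXn2r // ?nnegrE ?sqr_ge0 // mulr_ge0 // !sumr_ge0 // => x _; exact: sumr_ge0.
Qed.

Local Notation K := #|{: quad}|.

Definition block (x : {ffun 'I_r -> {ffun 'I_K -> B}}) (k : 'I_K) : {ffun 'I_r -> B} :=
  [ffun p => x p k].

Definition good_points : {set {ffun 'I_r -> {ffun 'I_K -> B}}} :=
  [set x | [forall k : 'I_K, block_event (enum_val k) (block x k)]].

(** Each event depends on its own block only, so the count is a product over the blocks. *)
Lemma many_good_points : (m ^ (d * r * K) <= 152 ^ (4 * K) * #|good_points|)%N.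
Proof.
have card_good : #|good_points|%:R = \prod_(k < K) \sum_y (block_event (enum_val k) y)%:R :> R.
  rewrite bigA_distr_bigA /= -sum1_card natr_sum.
  pose h (z : {ffun 'I_K -> {ffun 'I_r -> B}}) : {ffun 'I_r -> {ffun 'I_K -> B}} :=
    [ffun p => [ffun k => z k p]].
  have hK z k : block (h z) k = z k by apply/ffunP => p; rewrite !ffunE.
  rewrite big_mkcond (reindex h) /=; last first.
    exists (fun x => [ffun k => block x k]) => [z _|x _].
      by apply/ffunP => k; rewrite ffunE hK.
    by apply/ffunP => p; apply/ffunP => k; rewrite !ffunE.
  apply: eq_bigr => z _; rewrite inE.
  under eq_forallb do rewrite hK.
  have [/forallP all_z|/forallPn[k k_z]] := boolP [forall k : 'I_K, block_event (enum_val k) (z k)].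
    by rewrite big1 // => k _; rewrite all_z.
  by rewrite (bigD1 k) //= (negbTE k_z) mul0r.
have : \prod_(k < K) (N ^+ r) <= \prod_(k < K) (152 ^+ 4 * \sum_y (block_event (enum_val k) y)%:R).
  by apply: ler_prod => k _; rewrite block_event_many exprn_ge0 ?ltW.
rewrite big_split /= !prodr_const !card_ord -card_good -!exprM.
by rewrite /N -!natrX -expnM mulnA -natrM ler_nat.
Qed.

End Blocks.

(** * The lower bound *)

Section Geometry.
Variables (R : realType) (m d r : nat) (row : 'I_r -> nat).
Local Notation quad := ('I_r * 'I_r * 'I_r * 'I_r)%type.
Local Notation K := #|{: quad}|.
Local Notation B := {ffun 'I_d -> 'I_m}.
Local Notation P := {ffun 'I_K -> B}.
Local Notation tau := (tau R d).
Hypothesis m0 : (0 < m)%N.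

(** By [sqdist_coord], [4 * sqdist] is the squared distance in the centred coordinates in which
    [iprod] is computed. *)
Definition close_points (x y : P) : bool := \sum_k 4 * sqdist R (x k) (y k) < 2 * tau.

Definition quad_link (p q : 'I_r) (k : quad) (x y : B) : bool :=
  let: (p1, p2, p3, p4) := k in
  [&& ((p == p1) && (q == p3)) ==> (tau <= iprod R x y),
      ((p == p2) && (q == p4)) ==> (tau <= iprod R x y),
      ((p == p1) && (q == p4)) ==> (iprod R x y <= - tau) &
      ((p == p2) && (q == p3)) ==> (iprod R x y <= - tau)].

Definition linked (p q : 'I_r) (x y : P) : bool :=
  [forall k : 'I_K, crossing row (enum_val k) ==> quad_link p q (enum_val k) (x k) (y k)].

Definition point_adj (p q : 'I_r) (x y : P) : bool :=
  if p == q then true else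
  if row p == row q then close_points x y else
  if (row p < row q)%N then ~~ linked p q x y else ~~ linked q p y x.

Lemma sqdistC (x y : B) : sqdist R x y = sqdist R y x.
Proof. by apply: eq_bigr => i _; rewrite -sqrrN -mulNr opprB. Qed.

Lemma close_pointsC x y : close_points x y = close_points y x.
Proof. by rewrite /close_points; under eq_bigr do rewrite sqdistC. Qed.

Lemma point_adjC p q x y : point_adj p q x y = point_adj q p y x.
Proof.
rewrite /point_adj [q == p]eq_sym [row q == _]eq_sym close_pointsC.
by case: (p == q) => //; case: ltngtP.
Qed.

Lemma tau_ge0 : 0 <= tau.
Proof. by rewrite divr_ge0 // sqrtr_ge0. Qed.

Lemma sqdist_ge0 (x y : B) : 0 <= sqdist R x y.
Proof. by apply: sumr_ge0 => i _; rewrite sqr_ge0. Qed.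

Lemma sqdist_obtuse (x y : B) : iprod R x y <= - tau -> 2 * tau <= 4 * sqdist R x y.
Proof.
move=> h; rewrite sqdist_coord //.
have : 0 <= \sum_i coord R (x i) ^+ 2 + \sum_i coord R (y i) ^+ 2.
  by rewrite addr_ge0 // sumr_ge0 // => i _; rewrite sqr_ge0.
have -> : \sum_i (coord R (x i) - coord R (y i)) ^+ 2 =
    \sum_i coord R (x i) ^+ 2 + \sum_i coord R (y i) ^+ 2 - 2 * iprod R x y.
  by rewrite /iprod mulr_sumr -big_split -sumrB /=; apply: eq_bigr => i _; ring.
lra.
Qed.

Lemma obtuse_far (x y : P) (k : 'I_K) : iprod R (x k) (y k) <= - tau -> close_points x y = false.
Proof.
move=> /sqdist_obtuse h; apply/negbTE; rewrite -leNgt; apply: le_trans h _.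
rewrite [X in _ <= X](bigD1 k) //= lerDl sumr_ge0 // => i _.
by rewrite mulr_ge0 // sqdist_ge0.
Qed.

Lemma close_block (x y : P) (k : 'I_K) : close_points x y -> 4 * sqdist R (x k) (y k) < 2 * tau.
Proof.
apply: le_lt_trans; rewrite [X in _ <= X](bigD1 k) //= lerDl sumr_ge0 // => i _.
by rewrite mulr_ge0 // sqdist_ge0.
Qed.

(** If all four cross pairs were linked, then in the block of this quadruple the inner product of
    [x1 - x2] and [x3 - x4] would be at least [4 * tau], while half the sum of their squared lengths
    is below [2 * tau]. *)
Lemma no_two_pairs (p1 p2 p3 p4 : 'I_r) (x1 x2 x3 x4 : P) :
  p1 != p2 -> row p1 = row p2 -> p3 != p4 -> row p3 = row p4 -> (row p1 < row p3)%N ->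
  close_points x1 x2 -> close_points x3 x4 ->
  [|| point_adj p1 p3 x1 x3, point_adj p1 p4 x1 x4, point_adj p2 p3 x2 x3 | point_adj p2 p4 x2 x4].
Proof.
move=> p12 r12 p34 r34 r13 n12 n34.
have cross p q x y : row p = row p1 -> row q = row p3 -> ~~ point_adj p q x y -> linked p q x y.
  move=> rp rq; rewrite /point_adj rp rq r13 (ltn_eqF r13).
  by case: eqP => [e|_]; [move: r13; rewrite -rp -rq e ltnn | rewrite negbK].
apply: contraT => /norP[a13 /norP[a14 /norP[a23 a24]]].
have l13 := cross _ _ _ _ erefl erefl a13; have l14 := cross _ _ _ _ erefl (esym r34) a14.
have l23 := cross _ _ _ _ (esym r12) erefl a23.
have l24 := cross _ _ _ _ (esym r12) (esym r34) a24.
pose k := enum_rank (p1, p2, p3, p4).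
have cr : crossing row (enum_val k).
  by rewrite enum_rankK /= r12 r34 !eqxx p12 p34 -r12 -r34 r13.
have at_k p q x y : linked p q x y -> quad_link p q (p1, p2, p3, p4) (x k) (y k).
  by move=> /forallP/(_ k); rewrite cr /= enum_rankK.
have := at_k _ _ _ _ l13; have := at_k _ _ _ _ l14.
have := at_k _ _ _ _ l23; have := at_k _ _ _ _ l24.
rewrite /quad_link !eqxx /=.
move=> /and4P[_ h24 _ _] /and4P[_ _ _ h23] /and4P[_ _ h14 _] /and4P[h13 _ _ _].
have := close_block k n12; have := close_block k n34; rewrite !sqdist_coord // => s34 s12.
have : 0 <= \sum_i ((coord R (x1 k i) - coord R (x2 k i)) - (coord R (x3 k i) - coord R (x4 k i))) ^+ 2.
  by rewrite sumr_ge0 // => i _; rewrite sqr_ge0.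
have -> : \sum_i ((coord R (x1 k i) - coord R (x2 k i)) - (coord R (x3 k i) - coord R (x4 k i))) ^+ 2 =
  \sum_i (coord R (x1 k i) - coord R (x2 k i)) ^+ 2 + \sum_i (coord R (x3 k i) - coord R (x4 k i)) ^+ 2
  - 2 * (iprod R (x1 k) (x3 k) - iprod R (x1 k) (x4 k) - iprod R (x2 k) (x3 k) + iprod R (x2 k) (x4 k)).
  by rewrite /iprod mulrDr !mulrBr !mulr_sumr -!sumrB -!big_split -!sumrB /=; apply: eq_bigr => i _; ring.
have := tau_ge0; lra.
Qed.

Hypothesis sibling : forall p : 'I_r, exists2 p', p != p' & row p = row p'.

Lemma nonadjacent_far p q x y : ~~ point_adj p q x y -> p != q /\ tau / 2 <= \sum_k sqdist R (x k) (y k).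
Proof.
move=> nadj; have pq : p != q by apply: contraNneq nadj => ->; rewrite /point_adj eqxx.
split=> //; suff : close_points x y = false.
  by move=> /negbT; rewrite -leNgt -mulr_sumr; lra.
wlog rpq : p q x y nadj pq / (row p <= row q)%N.
  move=> W; have [le|/ltnW le] := leqP (row p) (row q); first exact: W nadj pq le.
  by rewrite close_pointsC; apply: W le; rewrite 1?point_adjC // eq_sym.
move: nadj; rewrite /point_adj (negbTE pq); case: eqP => [_ /negbTE//|/eqP ne].
rewrite ltn_neqAle ne rpq /= negbK => lnk.
(* With siblings, [p] and [q] become the first and fourth part of a crossing block, where being
   linked means an inner product of at most [- tau]. *)
have [p2 pp2 rp] := sibling p; have [q2 qq2 rq] := sibling q.
pose k := enum_rank (p, p2, q2, q); apply: (obtuse_far (k := k)).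
have := forallP lnk k; rewrite enum_rankK /= rp rq !eqxx pp2 eq_sym qq2 /= -rp -rq.
by rewrite ltn_neqAle ne rpq /= => /and4P[].
Qed.

Lemma good_nonadjacent (x : {ffun 'I_r -> P}) p q : x \in good_points R m d row ->
  p != q -> ~~ point_adj p q (x p) (x q).
Proof.
rewrite inE => /forallP good pq.
wlog rpq : p q pq / (row p <= row q)%N.
  move=> W; have [le|/ltnW le] := leqP (row p) (row q); first exact: W pq le.
  by rewrite point_adjC W // eq_sym.
rewrite /point_adj (negbTE pq); case: eqP => [rpq'|/eqP ne].
  (* This quadruple is not crossing, so its block makes the points of [p] and [q] obtuse. *)
  pose k := enum_rank (p, q, q, q); apply/negbT; apply: (obtuse_far (k := k)).
  by have := good k; rewrite enum_rankK /block_event /crossing /= [q == q]eqxx /= !andbF pq !ffunE.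
rewrite ltn_neqAle ne rpq /= negbK; apply/forallP => k; apply/implyP.
have := good k; move: (enum_val k) => -[[[p1 p2] p3] p4] + cr.
rewrite /block_event cr !ffunE => /and4P[h13 h24 h14 h23].
by apply/and4P; split; apply/implyP => /andP[/eqP-> /eqP->].
Qed.

End Geometry.

(** * The graph of labelled vertices: paths, bicliques and cliques of the complement *)

Section PointGraph.
Variables (R : realType) (m d a b n : nat).
Local Notation r := (a * b)%N.
Local Notation K := #|{: 'I_r * 'I_r * 'I_r * 'I_r}|.
Local Notation P := {ffun 'I_K -> {ffun 'I_d -> 'I_m}}.
Variables (part : 'I_n -> 'I_r) (pt : 'I_n -> P).
Hypotheses (m2 : (2 <= m)%N) (d0 : (0 < d)%N) (b2 : (2 <= b)%N).
Definition grid_row (p : 'I_r) : nat := (p %/ b)%N.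
Local Notation adj := (point_adj R grid_row).

Let m0 : (0 < m)%N. Proof. exact: ltnW. Qed.

Definition point_edge : rel 'I_n :=
  fun u v => (u != v) && adj (part u) (part v) (pt u) (pt v).

Lemma point_edge_sym : symmetric point_edge.
Proof. by move=> u v; rewrite /point_edge eq_sym point_adjC. Qed.

Lemma point_edge_irr : irreflexive point_edge.
Proof. by move=> u; rewrite /point_edge eqxx. Qed.

Definition point_graph : ograph n := OGraph point_edge_sym point_edge_irr.

Lemma sibling (p : 'I_r) : exists2 p', p != p' & grid_row p = grid_row p'.
Proof.
have b0 : (0 < b)%N by exact: ltnW.
pose j := (if p %% b == 0 then 1 else 0)%N.
have jb : (j < b)%N by rewrite /j; case: ifP.
have lt_r : ((p %/ b) * b + j < r)%N.
  apply: leq_trans (_ : (p %/ b).+1 * b <= _)%N; first by rewrite mulSn addnC ltn_add2r.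
  by rewrite leq_mul2r ltn_divLR // ltn_ord orbT.
exists (Ordinal lt_r).
  apply/eqP => /(congr1 val) /= e; have : (p %% b = j)%N by rewrite e modnMDl modn_small.
  by rewrite /j; case: eqP => // ->.
by rewrite /grid_row /= divnMDl // (divn_small jb) addn0.
Qed.

Hypothesis part_homo : {homo part : u v / (u <= v)%N}.

Lemma point_graph_path k : (0 < k)%N -> (a + b = k)%N -> ~ has_induced_monotone_path (2 * k - 1) point_graph.
Proof.
move=> k0 abk [v [v_mono v_adj]]; set L := (2 * k - 1)%N in v v_mono v_adj.
have L0 : (0 < L)%N by rewrite /L; lia.
(* The path is extended to all natural numbers by its first vertex, to fit the indexing of
   [rows_too_long]. *)
pose w s := v (insubd (Ordinal L0) s).
have w_mono s t : (s < t < L)%N -> (w s < w t)%N.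
  by case/andP=> st tL; apply: v_mono; rewrite !val_insubd tL (ltn_trans st tL).
have w_adj s t : (s < L)%N -> (t < L)%N ->
    point_edge (w s) (w t) = ((s.+1 == t) || (t.+1 == s)).
  by move=> sL tL; have := v_adj (insubd (Ordinal L0) s) (insubd (Ordinal L0) t); rewrite !val_insubd sL tL.
have w_nonadj s t : (s.+1 < t < L)%N -> ~~ adj (part (w s)) (part (w t)) (pt (w s)) (pt (w t)).
  case/andP=> st tL; have sL : (s < L)%N by lia.
  have := w_adj s t sL tL; rewrite /point_edge neq_ltn w_mono /=; last by lia.
  by move=> ->; rewrite negb_or; lia.
have w_near s : (s.+1 < L)%N -> grid_row (part (w s)) = grid_row (part (w s.+1)) ->
    part (w s) != part (w s.+1) -> close_points R (pt (w s)) (pt (w s.+1)).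
  move=> sL re ne; have := w_adj s s.+1 (ltnW sL) sL; rewrite eqxx /=.
  by rewrite /point_edge /point_adj re eqxx (negbTE ne) => /andP[].
apply: (@rows_too_long a b L (fun s => part (w s))) => // [|s t /andP[]|s sL|s t].
- by rewrite abk /L; lia.
- rewrite leq_eqVlt => /orP[/eqP->//|st] tL; apply: part_homo; apply: ltnW.
  by apply: w_mono; rewrite st.
- apply/eqP => e; have := w_nonadj s s.+2; rewrite ltnSn sL => /(_ isT)/negP; apply.
  by rewrite (val_inj e) /point_adj eqxx.
move=> /andP[/eqP rs ns] /andP[/eqP rt nt] lt_row st tL.
have sL : (s.+1 < L)%N by lia.
have ns' : part (w s) != part (w s.+1) by apply: contraNneq ns => ->.
have nt' : part (w t) != part (w t.+1) by apply: contraNneq nt => ->.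
have := @no_two_pairs R m d r grid_row m0 _ _ _ _ _ _ _ _ ns' rs nt' rt lt_row
  (w_near s sL rs ns') (w_near t tL rt nt').
by move=> /or4P[]; apply/negP; apply: w_nonadj; lia.
Qed.

(** Restrict each side to its most frequent part, losing a factor [r], and pass to labels, losing a
    factor [M]. The two sets of labels are far apart by [nonadjacent_far], so [separated_card]
    applies. *)
Lemma point_graph_biclique t M : (K * d <= m ^ 2)%N -> (0 < t)%N ->
  (forall x, #|[set u | pt u == x]| <= M)%N ->
  has_biclique t (compl point_graph) ->
  t%:R ^+ 2 <= (r * M * m ^ (K * d))%:R ^+ 2 * expR (1 - tau R d / 24) :> R.
Proof.
move=> Km t0 mult [A [B [cA cB dAB AB]]].
have pigeon (C : {set 'I_n}) : #|C| = t -> exists p, (t <= r * #|[set u in C | part u == p]|)%N.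
  move=> cC; have [/existsP//|/existsPn none] := boolP [exists p, (t <= r * #|[set u in C | part u == p]|)%N].
  have /card_gt0P[u _] : (0 < #|C|)%N by rewrite cC.
  have r0 : (0 < r)%N by case: (part u) => i /=; lia.
  suff : (r * t < r * t)%N by rewrite ltnn.
  rewrite -{1}cC -sum1_card (partition_big part xpredT) //= big_distrr /=.
  apply: leq_trans (_ : \sum_(p < r) t <= _)%N; last by rewrite sum_nat_const card_ord.
  rewrite [X in (_ < X)%N](bigD1 (part u)) //= [X in (X < _)%N](bigD1 (part u)) //=.
  rewrite -addSn; apply: leq_add.
    by have := none (part u); rewrite -ltnNge -sum1dep_card.
  by apply: leq_sum => p _; have := none p; rewrite -ltnNge -sum1dep_card => /ltnW.
have image_card (C : {set 'I_n}) : (#|C| <= M * #|[set pt u | u in C]|)%N.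
  rewrite -[X in (X <= _)%N]sum1_card (partition_big_imset pt) /=.
  rewrite [(M * _)%N]mulnC -sum_nat_const; apply: leq_sum => x _; rewrite sum1dep_card.
  apply: leq_trans (mult x); apply: subset_leq_card; apply/fintype.subsetP => u.
  by rewrite !inE => /andP[].
have [p tp] := pigeon A cA; have [q tq] := pigeon B cB.
set A' := [set u in A | part u == p] in tp; set B' := [set u in B | part u == q] in tq.
have nadj u v : u \in A' -> v \in B' -> ~~ adj p q (pt u) (pt v).
  rewrite !inE => /andP[uA /eqP<-] /andP[vB /eqP<-]; have := AB u v uA vB.
  by rewrite /= /compl_edge /= /point_edge => /andP[->].
have := @separated_card R m d K [set pt u | u in A'] [set pt u | u in B'] (tau R d / 2) m0 Km.
have -> : tau R d / 2 / 12 = tau R d / 24 by field.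
have sep x y : x \in [set pt u | u in A'] -> y \in [set pt u | u in B'] ->
    tau R d / 2 <= \sum_k sqdist R (x k) (y k).
  by move=> /imsetP[u uA ->] /imsetP[v vB ->]; have [] := nonadjacent_far m0 sibling (nadj u v uA vB).
move=> /(_ sep) le_st; rewrite natrM exprMn -mulrA.
apply: le_trans (_ : (r * M)%:R ^+ 2 * (#|[set pt u | u in A']|%:R * #|[set pt u | u in B']|%:R) <= _).
  rewrite -!natrX -!natrM ler_nat.
  apply: leq_trans (_ : (r * M * #|[set pt u | u in A']|) * (r * M * #|[set pt u | u in B']|) <= _)%N.
    rewrite -mulnn; apply: leq_mul.
      by apply: leq_trans tp _; rewrite -[(r * M * _)%N]mulnA leq_mul2l image_card orbT.
    by apply: leq_trans tq _; rewrite -[(r * M * _)%N]mulnA leq_mul2l image_card orbT.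
  by rewrite leq_eqVlt; apply/orP; left; apply/eqP; ring.
by rewrite ler_wpM2l ?sqr_ge0 // [_ ^+ 2 * _]mulrC.
Qed.

Definition transversals : {set {ffun 'I_r -> 'I_n}} :=
  [set z : {ffun 'I_r -> 'I_n} | [forall p, part (z p) == p] &&
     [forall p, forall q, (p != q) ==> ~~ point_edge (z p) (z q)]].

(** Every good assignment of points to the parts lifts to at least [D ^ r] transversals. *)
Lemma many_transversals D :
  (forall p x, D <= #|[set u | (part u == p) && (pt u == x)]|)%N ->
  ((D * m ^ (K * d)) ^ r <= 152 ^ (4 * K) * #|transversals|)%N.
Proof.
move=> many; pose W := good_points R m d grid_row.
have le1 : (#|W| * D ^ r <= #|transversals|)%N.
  pose h (z : {ffun 'I_r -> 'I_n}) : {ffun 'I_r -> P} := [ffun p => pt (z p)].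
  pose F (x : {ffun 'I_r -> P}) p := [set u | (part u == p) && (pt u == x p)].
  pose T := [set z : {ffun 'I_r -> 'I_n} | (h z \in W) && [forall p, part (z p) == p]].
  apply: leq_trans (_ : #|T| <= _)%N; last first.
    apply: subset_leq_card; apply/fintype.subsetP => z; rewrite !inE => /andP[zW prt].
    rewrite prt; apply/forallP => p; apply/forallP => q; apply/implyP => pq.
    have := good_nonadjacent m0 (_ : h z \in W) pq; rewrite !ffunE /point_edge.
    rewrite !(eqP (forallP prt _)) => nadj; rewrite negb_and negbK nadj ?orbT // inE.
    exact: zW.
  rewrite -[#|T|]sum1_card (partition_big h (mem W)) /=; last by move=> z; rewrite inE => /andP[].
  rewrite -sum_nat_const; apply: leq_sum => x xW; rewrite sum1dep_card.
  apply: leq_trans (_ : #|family (F x)| <= _)%N.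
    rewrite card_family; apply: leq_trans (_ : \prod_(p < r) D <= _)%N.
      by rewrite prod_nat_const card_ord.
    by rewrite foldrE big_map -big_enum /=; apply: leq_prod => p _; apply: many.
  apply: subset_leq_card; apply/fintype.subsetP => z /familyP zF; rewrite inE.
  have hz : h z = x.
    by apply/ffunP => p; rewrite ffunE; have := zF p; rewrite inE => /andP[_ /eqP].
  rewrite hz eqxx andbT inE hz xW; apply/forallP => p.
  by have := zF p; rewrite inE => /andP[].
apply: leq_trans (_ : 152 ^ (4 * K) * (#|W| * D ^ r) <= _)%N; last by rewrite leq_mul2l le1 orbT.
rewrite mulnA expnMn mulnC leq_mul2r; apply/orP; right.
by rewrite -expnM (_ : K * d * r = d * r * K)%N; [exact: many_good_points | ring].
Qed.

(** A transversal is determined by the set of its first [r'] entries, whose parts tell them apart,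
    and by the list of the others. *)
Lemma many_cliques r' : (r' <= r)%N ->
  (#|transversals| <= #|cliques r' (compl point_graph)| * n ^ (r - r'))%N.
Proof.
move=> le_r.
pose I := [set p : 'I_r | (p < r')%N].
have cI : #|I| = r'.
  rewrite -sum1dep_card -(big_ord_widen r (fun=> 1%N) le_r) sum1_card card_ord //.
have shift (j : 'I_(r - r')) : (r' + j < r)%N by have := ltn_ord j; lia.
pose h (z : {ffun 'I_r -> 'I_n}) : {set 'I_n} * {ffun 'I_(r - r') -> 'I_n} :=
  ([set z p | p in I], [ffun j => z (Ordinal (shift j))]).
have part_z z p : z \in transversals -> part (z p) = p by rewrite inE => /andP[/forallP/(_ p)/eqP].
have inj_z z : z \in transversals -> injective z.
  by move=> zT p q e; rewrite -(part_z z p zT) e part_z.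
have hinj : {in transversals &, injective h}.
  move=> z z' zT zT' [eI eJ]; apply/ffunP => p.
  have [pr|rp] := ltnP p r'.
    have : z p \in [set z' p | p in I] by rewrite -eI imset_f // inE.
    by case/imsetP => q _ e; have := congr1 part e; rewrite !part_z // e => ->.
  have lt : (p - r' < r - r')%N by have := ltn_ord p; lia.
  have /ffunP/(_ (Ordinal lt)) := eJ; rewrite !ffunE.
  have -> // : Ordinal (shift (Ordinal lt)) = p by apply: val_inj => /=; lia.
rewrite -(card_in_imset hinj) -[n in (n ^ _)%N]card_ord -[(r - r')%N in X in (_ <= X)%N]card_ord -card_ffun.
rewrite -cardsT -cardsX; apply: subset_leq_card; apply/fintype.subsetP => _ /imsetP[z zT ->].
rewrite finset.in_setX [_ \in finset.setT]inE andbT inE card_imset ?cI ?eqxx //=; last exact: inj_z.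
apply/forall_inP => _ /imsetP[p _ ->]; apply/forall_inP => _ /imsetP[q _ ->].
apply/implyP => zpq; rewrite /= /compl_edge zpq.
move: zT; rewrite inE => /andP[_ /forallP/(_ p)/forallP/(_ q)/implyP]; apply.
by apply: contraNneq zpq => ->.
Qed.

End PointGraph.

Lemma lower_graph (R : realType) (m d a b n : nat) :
  let r := (a * b)%N in let K := #|{: 'I_r * 'I_r * 'I_r * 'I_r}| in
  (2 <= m)%N -> (0 < d)%N -> (0 < a)%N -> (2 <= b)%N -> (K * d <= m ^ 2)%N ->
  (m ^ (K * d) * r <= n)%N ->
  exists G : ograph n,
  [/\ ~ has_induced_monotone_path (2 * (a + b) - 1) G,
      forall r', (r' <= r)%N ->
        (n ^ r' <= (2 * r) ^ r * 152 ^ (4 * K) * #|cliques r' (compl G)|)%N &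
      forall t, (0 < t)%N -> has_biclique t (compl G) ->
        t%:R <= 2 * r%:R * n%:R * expR (1 - tau R d / 48) :> R].
Proof.
move=> r K m2 d0 a0 b2 Kd; set N := (m ^ (K * d))%N => Nn.
pose P := {ffun 'I_K -> {ffun 'I_d -> 'I_m}}.
have m0 : (0 < m)%N by exact: ltnW.
have N0 : (0 < N)%N by rewrite expn_gt0 m0.
have cP : #|P| = N by rewrite card_ffun card_ffun !card_ord -expnM mulnC.
have b0 : (0 < b)%N by exact: ltnW.
have r0 : (0 < r)%N by rewrite muln_gt0 a0 b0.
pose D := (n %/ (N * r))%N; pose q := (N * D)%N.
have Nr0 : (0 < N * r)%N by rewrite muln_gt0 N0 r0.
have D0 : (0 < D)%N by rewrite divn_gt0.
have q0 : (0 < q)%N by rewrite muln_gt0 N0.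
have rq : (r * q <= n)%N by rewrite /q mulnA [(r * N)%N]mulnC mulnC leq_divM.
have part_lt u : (minn (u %/ q) r.-1 < r)%N by rewrite gtn_min ltn_predL r0 orbT.
have pt_lt u : (u %% N < #|P|)%N by rewrite cP ltn_mod.
(* The parts are consecutive intervals of length [q], the last one also taking the remaining
   vertices; labels run cyclically through the [N] points. *)
pose part (u : 'I_n) := Ordinal (part_lt u).
pose pt (u : 'I_n) : P := enum_val (Ordinal (pt_lt u)).
have part_homo : {homo part : u v / (u <= v)%N}.
  by move=> u v uv /=; rewrite leq_min !geq_min leqnn leq_div2r ?orbT.
have ptE u x : (pt u == x) = (u %% N == enum_rank x)%N.
  apply/eqP/eqP => [<-|e]; first by rewrite enum_valK.
  by rewrite /pt -[RHS]enum_rankK; congr enum_val; apply: val_inj.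
pose M := (n %/ N).+1.
have mult x : (#|[set u | pt u == x]| <= M)%N.
  have lt_M (u : 'I_n) : (u %/ N < M)%N by rewrite ltnS leq_div2r // ltnW.
  rewrite -[X in (_ <= X)%N]card_ord; apply: (@leq_card_in _ _ (fun u => Ordinal (lt_M u))).
  move=> u v; rewrite !inE !ptE => /eqP eu /eqP ev /(congr1 val) /= e.
  by apply: val_inj; rewrite /= (divn_eq u N) (divn_eq v N) e eu ev.
have many p x : (D <= #|[set u | (part u == p) && (pt u == x)]|)%N.
  have cN : (enum_rank x < N)%N by rewrite -cP ltn_ord.
  have rem_lt (j : 'I_D) : (j * N + enum_rank x < q)%N.
    apply: leq_trans (_ : j.+1 * N <= _)%N; first by rewrite mulSn addnC ltn_add2r.
    by rewrite /q mulnC leq_mul2l ltn_ord orbT.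
  have lt_n (j : 'I_D) : (p * q + (j * N + enum_rank x) < n)%N.
    apply: leq_trans rq; apply: leq_trans (_ : p.+1 * q <= _)%N.
      by rewrite mulSn addnC ltn_add2r.
    by rewrite leq_mul2r ltn_ord orbT.
  pose h j : 'I_n := Ordinal (lt_n j).
  have hinj : injective h.
    move=> i j /(congr1 val) /= /addnI/addIn/eqP; rewrite eqn_pmul2r // => /eqP e.
    exact: val_inj.
  rewrite -{1}[D]card_ord -cardsT -(card_imset _ hinj); apply: subset_leq_card.
  apply/fintype.subsetP => _ /imsetP[j _ ->]; rewrite inE ptE; apply/andP; split.
    apply/eqP/val_inj => /=; rewrite divnMDl // divn_small // addn0.
    by apply/minn_idPl; have := ltn_ord p; lia.
  by rewrite /= addnA /q mulnCA mulnC -mulnDl modnMDl modn_small.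
pose G := point_graph R part pt.
exists G; split.
- by apply: (@point_graph_path R m d a b n part pt m2 d0 b2 part_homo (a + b)%N); rewrite ?addn_gt0 ?a0.
- move=> r' le_r'; have le1 := @many_transversals R m d a b n part pt m2 d0 D many.
  have le2 := @many_cliques R m d a b n part pt m2 d0 b2 r' le_r'.
  have n0 : (0 < n)%N by apply: leq_trans Nn.
  have n_le : (n <= 2 * r * (D * N))%N.
    rewrite {1}(divn_eq n (N * r)) -/D; have : (n %% (N * r) < N * r)%N by rewrite ltn_mod.
    have : (N * r <= D * (N * r))%N by rewrite leq_pmull.
    rewrite (_ : 2 * r * (D * N) = 2 * (D * (N * r)))%N; last by ring.
    lia.
  rewrite -(leq_pmul2r (_ : 0 < n ^ (r - r'))%N) ?expn_gt0 ?n0 // -expnD subnKC //.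
  apply: leq_trans (_ : (2 * r) ^ r * (D * N) ^ r <= _)%N.
    by rewrite -expnMn leq_exp2r.
  rewrite -!mulnA leq_mul2l; apply/orP; right; apply: leq_trans le1 _.
  by rewrite leq_mul2l le2 orbT.
move=> t t0 bic; have := @point_graph_biclique R m d a b n part pt m2 d0 b2 t M Kd t0 mult bic.
rewrite -/N -/r => le_t.
have MN : (M * N <= 2 * n)%N.
  have : (n %/ N * N <= n)%N by rewrite leq_divM.
  have : (N <= n)%N by apply: leq_trans Nn; rewrite leq_pmulr.
  by rewrite /M mulSn; lia.
have e0 : 0 < expR (1 - tau R d / 48) :> R by exact: expR_gt0.
have n20 : 0 <= 2 * r%:R * n%:R :> R by rewrite -!natrM ler0n.
have rhs0 : 0 <= 2 * r%:R * n%:R * expR (1 - tau R d / 48) :> R by apply: mulr_ge0 => //; exact: ltW.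
rewrite -(@ler_pXn2r R 2) ?nnegrE //.
apply: le_trans le_t _; rewrite [X in _ <= X]exprMn; apply: ler_pM.
- by rewrite sqr_ge0.
- by apply: ltW; exact: expR_gt0.
- rewrite ler_pXn2r ?nnegrE //.
  rewrite (_ : 2 * r%:R * n%:R = (r * (2 * n))%:R); last by rewrite !natrM; ring.
  by rewrite ler_nat -[(r * M * _)%N]mulnA leq_mul2l MN orbT.
(* The square of the claimed exponential has exponent [2 - tau / 24], more than the required
   [1 - tau / 24]. *)
rewrite -expRM_natr ler_expR.
by lra.
Qed.

(** * Choice of the dimension and growth estimates *)

Section Asymptotics.
Variable R : realType.

Lemma loglog_large (M : R) : exists N : nat, forall n, (N <= n)%N ->
  [/\ 0 < n%:R :> R, 0 < ln n%:R :> R & M <= ln (ln n%:R) :> R].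
Proof.
exists (Num.truncn (expR (expR M))).+1 => n le_n.
have lt_n : expR (expR M) <= n%:R.
  by apply: le_trans (ltW (truncnS_gt _)) _; rewrite ler_nat.
have n0 : 0 < n%:R :> R by apply: lt_le_trans lt_n; exact: expR_gt0.
have le1 : expR M <= ln n%:R by rewrite -ler_expR lnK.
have ln0 : 0 < ln n%:R :> R by apply: lt_le_trans le1; exact: expR_gt0.
by split=> //; rewrite -ler_expR lnK.
Qed.

Lemma expR_quintic (x : R) : 0 <= x -> (x / 5) ^+ 5 <= expR x.
Proof.
move=> x0; have -> : expR x = expR (x / 5) ^+ 5.
  by rewrite -expRM_natr; congr expR; field.
have x5 : 0 <= x / 5 by rewrite divr_ge0.
rewrite ler_pXn2r ?nnegrE ?expR_ge0 //; apply: le_trans (expR_ge1Dx _); lra.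
Qed.

Definition rate (n : nat) : R := Num.sqrt (ln n%:R / ln (ln n%:R)).

Lemma rate_large n : 0 < ln n%:R :> R -> 1 <= ln (ln n%:R) :> R ->
  ln (ln n%:R) ^+ 2 / 56 <= rate n.
Proof.
set u := ln (ln _) => l0 u1; have u0 : 0 < u by lra.
have -> : u ^+ 2 / 56 = Num.sqrt ((u ^+ 2 / 56) ^+ 2).
  by rewrite sqrtr_sqr ger0_norm // divr_ge0 // sqr_ge0.
have e : ln n%:R = expR u by rewrite lnK.
rewrite /rate -/u e ler_sqrt; last by rewrite divr_ge0 ?expR_ge0 // ltW.
(* The constant 56 works because [56 ^ 2 = 3136] exceeds [5 ^ 5 = 3125]. *)
rewrite ler_pdivlMr //; apply: le_trans (expR_quintic (ltW u0)).
have : 0 <= u ^+ 5 by rewrite exprn_ge0 // ltW.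
rewrite (_ : (u ^+ 2 / 56) ^+ 2 * u = u ^+ 5 / 3136); last by field.
rewrite (_ : (u / 5) ^+ 5 = u ^+ 5 / 3125); last by field.
lra.
Qed.

Lemma tau_rate (c : R) : 0 < c <= 1 -> exists2 beta : R, 0 < beta <= 1 &
  forall (d : nat) s, 0 <= s -> c * s ^+ 2 / 2 <= d%:R -> beta * s <= tau R d / 48.
Proof.
move=> /andP[c0 c1]; have [q [q0 q1 qE]] : exists q : R,
    [/\ 0 < q, 1 <= q & forall x : R, x / 6 / 48 = x / q].
  by exists 288; split; [lra | lra | move=> x; field].
exists (Num.sqrt (c / 2) / q).
  rewrite divr_gt0 ?sqrtr_gt0 ?divr_gt0 //= ler_pdivrMr // mul1r (le_trans _ q1) //.
  by rewrite -[X in _ <= X]sqrtr1 ler_sqrt //; lra.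
move=> d s s0 le_d; rewrite /tau qE mulrAC ler_pM2r ?invr_gt0 // -[s]ger0_norm //.
rewrite -sqrtr_sqr -sqrtrM; last by rewrite divr_ge0 // ltW.
by rewrite ler_sqrt // mulrAC.
Qed.

(** A grid of [k / 2] rows with [k - k / 2] parts each, in dimension of order [rate n ^ 2]. The
    bound is on [t.+1], so it also limits real sizes with floor [t]. *)
Lemma lower_family (k : nat) : (3 <= k)%N -> let r := (k ^ 2 %/ 4)%N in
  exists2 c : R, 0 < c & exists C n0 : nat, (0 < C)%N /\
  forall n, (n0 <= n)%N -> exists G : ograph n,
    [/\ ~ has_induced_monotone_path (2 * k - 1) G,
        (forall r', (r' <= r)%N -> (n ^ r' <= C * #|cliques r' (compl G)|)%N),
        (r <= n)%N &
        forall t, has_biclique t (compl G) -> t.+1%:R <= n%:R * expR (- (c * rate n))].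
Proof.
move=> k3 r; pose a := (k %/ 2)%N; pose b := (k - a)%N.
have rE : r = (a * b)%N by rewrite /r /b /a; nia.
have a0 : (0 < a)%N by rewrite divn_gt0; lia.
have b2 : (2 <= b)%N by rewrite /b /a; lia.
have abk : (a + b = k)%N by rewrite /b /a; lia.
pose K := #|{: 'I_r * 'I_r * 'I_r * 'I_r}|.
have r0 : (0 < r)%N by rewrite rE muln_gt0 a0 ltnW.
have K0 : (0 < K)%N by apply/card_gt0P; pose o := Ordinal r0; exists (o, o, o, o).
have K1 : 1 <= K%:R :> R by rewrite ler1n.
have [c0 [c00 c01 cK]] : exists c0 : R, [/\ 0 < c0, c0 <= 1 & c0 * (4 * K%:R) = 1].
  have K4 : 1 <= 4 * K%:R :> R by lra.
  have K40 : 0 < 4 * K%:R :> R by apply: lt_le_trans K4.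
  by exists (4 * K%:R)^-1; rewrite invr_gt0 invf_le1 // mulVf // lt0r_neq0.
have [beta /andP[beta0 beta1] tau_beta] := @tau_rate c0 (introT andP (conj c00 c01)).
exists (beta / 2); first by rewrite divr_gt0.
pose C := ((2 * r) ^ r * 152 ^ (4 * K))%N.
have r_gt0 : 0 < r%:R :> R by rewrite ltr0n.
have [Q Q0 QP] : exists2 Q : R, 0 <= Q & forall s, Q <= s -> 4 * r%:R * expR 1 <= expR (beta * s / 2).
  have c4 : 0 < 4 * r%:R * expR 1 :> R by rewrite mulr_gt0 ?expR_gt0 // mulr_gt0.
  exists (2 * `|ln (4 * r%:R * expR 1)| / beta).
    by rewrite divr_ge0 ?mulr_ge0 // ltW.
  move=> s; rewrite ler_pdivrMr // => le_s; rewrite -[X in X <= _](@lnK R) // ler_expR.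
  by apply: le_trans (ler_norm _) _; lra.
(* Once [u = ln (ln n) >= M], the estimate [s >= u ^ 2 / 56 >= M / 56] makes [s] exceed [Q] and
   [4 * K]. *)
have [M [M1 Mr MQ MK]] : exists M : R,
    [/\ 1 <= M, 4 + 2 * `|ln r%:R| <= M, 56 * Q <= M & 56 * (4 * K%:R) <= M].
  exists (4 + 2 * `|ln r%:R| + 56 * Q + 56 * (4 * K%:R)).
  have : 0 <= `|ln r%:R| :> R by []; move: K1 Q0; clear; split; lra.
have [n0 Hn0] := loglog_large M.
exists C, n0; split; first by rewrite muln_gt0 !expn_gt0 muln_gt0 r0.
move=> n le_n; have [n_gt0 l0 lM] := Hn0 n le_n.
set L := ln n%:R in l0 lM *; set u := ln L in lM.
have u1 : 1 <= u by apply: le_trans lM.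
have s_ge := rate_large l0 u1; rewrite -/L -/u in s_ge.
set s := rate n in s_ge *.
have u2 : u <= u ^+ 2 by rewrite expr2 ler_peMl //; lra.
have M_s : M <= 56 * s by lra.
have rabs : ln r%:R <= `|ln r%:R| :> R by rewrite ler_norm.
have rabs0 : 0 <= `|ln r%:R| :> R by [].
have s4 : 4 * K%:R <= s by lra.
have sQ : Q <= s by lra.
have s1 : 1 <= s by lra.
have u4 : 4 + 2 * `|ln r%:R| <= u by exact: le_trans lM.
have uL : 1 + u <= L by rewrite -[X in _ <= X](@lnK R) ?posrE // expR_ge1Dx.
have u0 : 0 <= u by lra.
have s2 : s ^+ 2 = L / u by rewrite sqr_sqrtr // divr_ge0 // ltW.
have su : s ^+ 2 * u = L by rewrite s2 divfK // lt0r_neq0 //; lra.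
have ss : s <= s ^+ 2 by rewrite expr2 ler_peMl //; lra.
pose x := c0 * s ^+ 2; pose d := Num.truncn x.
have x1 : 1 <= x by rewrite /x -[X in X <= _]cK ler_pM2l //; lra.
have d0 : (0 < d)%N by rewrite truncn_gt0.
have dx : d%:R <= x by rewrite truncn_le //; lra.
have xd : x / 2 <= d%:R.
  have : x < d.+1%:R by apply: truncnS_gt.
  have : 1 <= d%:R :> R by rewrite ler1n.
  by rewrite -natr1; lra.
(* This ensures [K * d <= m ^ 2], while [m <= ln n] and [K * d <= s ^ 2 / 4] keep the number
   [m ^ (K * d)] of labels at most [n ^ (1 / 4)]. *)
pose m := (K * d + 2)%N.
have m2 : (2 <= m)%N by rewrite leq_addl.
have Kd : (K * d <= m ^ 2)%N.
  by rewrite -mulnn; apply: leq_trans (leq_addr 2 _) (@leq_pmulr m m _); exact: ltnW m2.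
have Kd4 : (K * d)%:R <= s ^+ 2 / 4 :> R.
  rewrite natrM; apply: le_trans (_ : K%:R * x <= _); first by rewrite ler_wpM2l.
  rewrite /x (_ : K%:R * (c0 * s ^+ 2) = (c0 * (4 * K%:R)) * s ^+ 2 / 4); last by field.
  by rewrite cK mul1r.
have sL : s ^+ 2 <= L.
  by rewrite -su ler_peMr // sqr_ge0.
have mL : m%:R <= L by rewrite natrD; lra.
have m_gt0 : 0 < m%:R :> R by rewrite ltr0n ltnW.
have size_n : (m ^ (K * d) * r <= n)%N.
  rewrite -(ler_nat R) natrM natrX -ler_ln ?posrE ?mulr_gt0 ?exprn_gt0 // lnM ?posrE ?exprn_gt0 //.
  rewrite lnXn // -[_ *+ (K * d)]mulr_natl -/L.
  have ln_m : ln m%:R <= u by rewrite ler_ln ?posrE.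
  have : (K * d)%:R * ln m%:R <= s ^+ 2 / 4 * u.
    by apply: ler_pM => //; rewrite ln_ge0 // ler1n ltnW.
  rewrite (_ : s ^+ 2 / 4 * u = L / 4); last by rewrite -su; ring.
  have : ln r%:R <= L / 2 by lra.
  move: l0; clear; lra.
have := @lower_graph R m d a b n; rewrite /= -rE -/K => /(_ m2 d0 a0 b2 Kd size_n).
rewrite abk => -[G [G_path G_cl G_bic]]; exists G; split=> //.
  by apply: leq_trans size_n; rewrite leq_pmull // expn_gt0 ltnW.
have nL : n%:R = expR L by rewrite lnK.
case=> [_|t bic].
  rewrite nL -expRD -[X in X <= _]expR0 ler_expR.
  have : beta * s <= s by rewrite ler_piMl // (le_trans _ s1).
  by move: ss sL s1; clear; lra.
have := G_bic t.+1 isT bic; set y : R := t.+1%:R => le_y.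
have : t.+2%:R <= 2 * y.
  by rewrite /y -natrM ler_nat mul2n -addnn addSn ltnS leq_addl.
move=> /le_trans; apply; apply: le_trans (_ : 2 * (2 * r%:R * n%:R * expR (1 - tau R d / 48)) <= _).
  by rewrite ler_pM2l.
have tau_ge : beta * s <= tau R d / 48.
  by apply: tau_beta xd; exact: le_trans s1.
rewrite (_ : 2 * _ = n%:R * (4 * r%:R * expR (1 - tau R d / 48))); last by ring.
rewrite ler_pM2l // expRD mulrA.
apply: le_trans (ler_wpM2r (expR_ge0 _) (QP s sQ)) _; rewrite -expRD ler_expR.
by move: tau_ge; clear; lra.
Qed.
End Asymptotics.

Lemma bin_le_expn n r : ('C(n, r) <= n ^ r)%N.
Proof.
apply: leq_trans (_ : 'C(n, r) * r`! <= _)%N; first by rewrite leq_pmulr // fact_gt0.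
rewrite bin_ffact ffact_prod -[X in (_ <= _ ^ X)%N]card_ord -prod_nat_const.
by apply: leq_prod => i _; exact: leq_subr.
Qed.

Lemma density_ge (R : realType) n (G : ograph n) r C : (0 < C)%N -> (r <= n)%N ->
  (n ^ r <= C * #|cliques r G|)%N -> C%:R^-1 <= clique_density R r G.
Proof.
move=> C0 rn many; rewrite /clique_density -/(cliques r G).
rewrite ler_pdivlMr ?ltr0n ?bin_gt0 // mulrC ler_pdivrMr ?ltr0n // -natrM ler_nat.
by rewrite mulnC; apply: leq_trans many; exact: bin_le_expn.
Qed.

Lemma induced_path_le n (G : ograph n) s t : (s <= t)%N ->
  has_induced_monotone_path t G -> has_induced_monotone_path s G.
Proof.
move=> st [v [v_mono v_adj]]; exists (fun i => v (widen_ord st i)).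
split=> i j; first exact: (v_mono (widen_ord st i) (widen_ord st j)).
exact: (v_adj (widen_ord st i) (widen_ord st j)).
Qed.

Definition empty_graph n : ograph n :=
  @OGraph n (fun _ _ => false) (fun _ _ => erefl) (fun _ => erefl).

Lemma forces_biclique_gt (R : realType) k g : (3 <= k)%N -> forces_biclique R k g ->
  (k ^ 2 %/ 4 < g)%N.
Proof.
move=> k3 forces; rewrite ltnNge; apply/negP => le_g.
have [c c0 [C [n0 [C0 HG]]]] := lower_family R k3.
have Ci : 0 < C%:R^-1 :> R by rewrite invr_gt0 ltr0n.
have Ci2 : 0 < C%:R^-1 / 2 :> R by rewrite divr_gt0.
have [c' c'0 Hc'] := forces _ Ci2.
(* As [112 = 2 * 56], [rate_large] gives [c * s >= 2 * u] for [u = ln (ln n)]. This beats the factor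
   [expR (ln c' - u)] of the forced biclique, [u] exceeding [- ln c']. *)
pose M := 1 + 112 / c + `|ln c'|.
have M1 : 1 <= M by rewrite /M -addrA lerDl addr_ge0 // divr_ge0 // ltW.
have [N HN] := loglog_large M.
pose n := (n0 + N + 2)%N.
have [|n_gt0 l0 lM] := HN n; first by rewrite /n; lia.
have [|G [noP cl rn bic]] := HG n; first by rewrite /n; lia.
have n2 : (2 <= n)%N by rewrite /n leq_addl.
have noP2 : ~ has_induced_monotone_path (2 * k) G.
  by move=> hP; apply: noP; apply: induced_path_le hP; exact: leq_subr.
have dens : C%:R^-1 / 2 < clique_density R g (compl G).
  by have := density_ge R C0 (leq_trans le_g rn) (cl g le_g); lra.
have := bic _ (Hc' n G n2 noP2 dens); set x := _ / _.
move=> /(lt_le_trans (truncnS_gt x)).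
have u1 : 1 <= ln (ln n%:R) :> R by apply: le_trans lM.
move: (rate_large l0 u1); set s := rate R n; set u := ln (ln _) in lM u1 *.
have -> : x = n%:R * expR (ln c' - u).
  by rewrite expRD expRN !lnK ?posrE // /x; field; rewrite lt0r_neq0.
move=> s_ge; apply/negP; rewrite ltr_pM2l // -leNgt ler_expR.
have : - ln c' <= `|ln c'| by rewrite -normrN ler_norm.
have : u * 112 / 56 <= c * s.
  apply: le_trans (ler_wpM2l (ltW c0) s_ge).
  have : 112 <= c * u by rewrite -ler_pdivrMl // mulrC; rewrite /M in lM; have : 0 <= `|ln c'| by []; lra.
  rewrite expr2 => h; have : u * 112 <= u * (c * u) by rewrite ler_wpM2l //; lra.
  by move=> h'; rewrite mulrA ler_pM2r // mulrCA.
have : 0 <= 112 / c by rewrite divr_ge0 // ltW.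
rewrite /M in lM; lra.
Qed.

(** * Existence of the minimum and combination of the two bounds *)

Local Open Scope classical_set_scope.

Theorem theorem1p4 (R : realType) (k : nat) (hk : (3 <= k)%N) :
  [/\ (exists g : nat,
         is_g R k g /\ (k ^ 2 %/ 4 < g <= (k ^ 2 - k + 2) %/ 2)%N),
      forces_biclique R k ((k ^ 2 - k + 2) %/ 2)
    & exists2 eta : R, 0 < eta &
      exists G : forall n : nat, ograph n,
        (\forall n \near \oo,
           ~ has_induced_monotone_path (2 * k - 1) (G n) /\
           eta <= clique_density R (k ^ 2 %/ 4) (compl (G n))) /\
        (forall phi : nat -> R,
           phi =o_\oo (fun n : nat => Num.sqrt (ln n%:R / ln (ln n%:R) : R)) ->
           \forall n \near \oo,
             ~ has_biclique_real (n%:R / expR (phi n)) (compl (G n)))].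
Proof.
have upper : forces_biclique R k ((k ^ 2 - k + 2) %/ 2).
  apply: upper_forces; first by lia.
  rewrite bin2 (_ : k ^ 2 - k = k * k.-1)%N; last by case: (k) => // j; rewrite /=; lia.
  by rewrite addn2 -[_.+2]addn2 divnDr // divn2 addn1.
split=> //.
  have ex_g : exists g, `[< forces_biclique R k g >] by exists ((k ^ 2 - k + 2) %/ 2)%N; apply/asboolP.
  case: (ex_minnP ex_g) => g /asboolP forces g_min; exists g.
  split; first by split=> // r' /asboolP; exact: g_min.
  by rewrite (forces_biclique_gt hk forces) /=; apply: g_min; apply/asboolP.
have [c c0 [C [n0 [C0 HG]]]] := lower_family R hk.
(* Below [n0] the empty graph fills the sequence, so that choice applies for every [n]. *)
have H n : exists G : ograph n, (n0 <= n)%N ->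
    [/\ ~ has_induced_monotone_path (2 * k - 1) G,
        (forall r', (r' <= k ^ 2 %/ 4)%N -> (n ^ r' <= C * #|cliques r' (compl G)|)%N),
        (k ^ 2 %/ 4 <= n)%N &
        forall t, has_biclique t (compl G) -> t.+1%:R <= n%:R * expR (- (c * rate R n))].
  have [le|lt] := leqP n0 n; last by exists (empty_graph n).
  by have [G GP] := HG n le; exists G.
pose G n := sval (cid (H n)); have GP n := svalP (cid (H n)).
exists C%:R^-1; first by rewrite invr_gt0 ltr0n.
exists G; split.
  exists n0 => // n /= le_n; have [noP cl rn _] := GP n le_n; split=> //.
  exact: density_ge C0 rn (cl _ (leqnn _)).
move=> phi /eqoP/(_ c c0) phi_o; near=> n; rewrite /has_biclique_real => bic.
have le_n : (n0 <= n)%N by near: n; exists n0.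
have [_ _ _ /(_ _ bic)] := GP n le_n; apply/negP; rewrite -ltNge.
have : `|phi n| <= c * `|rate R n| by near: n; exact: phi_o.
rewrite [`|rate _ _|]ger0_norm ?sqrtr_ge0 // => le_phi.
(* One more than the floor exceeds [n * expR (- phi n)], which is at least
   [n * expR (- (c * rate n))]. *)
apply: le_lt_trans (truncnS_gt _); rewrite -expRN ler_wpM2l // ler_expR lerN2.
exact: le_trans (ler_norm _) le_phi.
Unshelve. all: by end_near.
Qed.
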